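(* There is an algorithm that takes as input a graph $G$ on $n$ vertices, a vertex set $K\subseteq V(G)$ and an integer $k$, and either computes a tree $K$-free-decomposition of $G$ of width at most $5k+5$ consisting of $\mathcal{O}(n)$ nodes, or correctly concludes that $\mathrm{tw}_K(G,K)>k$. The algorithm runs in time $2^{\mathcal{O}(k)}\cdot\mathrm{poly}(n)$ and uses polynomial space.
   Context: A tree $K$-free-decomposition of $G$ is a triple $(\mathbb{T},\chi,L)$ with $L\subseteq V(G)$, $\mathbb{T}$ a rooted tree and $\chi\colon V(\mathbb{T})\to 2^{V(G)}$ such that: (A) for each $v\in V(G)$ the nodes $\{x : v\in\chi(x)\}$ form a non-empty connected subtree of $\mathbb{T}$; (B) for each edge $uv\in E(G)$ some node $x$ has $\{u,v\}\subseteq\chi(x)$; (C) for each $v\in L$ there is a unique node $x$ with $v\in\chi(x)$, and this $x$ is a leaf of $\mathbb{T}$; (D) for every node $x$, $\chi(x)\cap L\cap K=\emptyset$. Its width is $\max\{0,\max_{x\in V(\mathbb{T})}|\chi(x)\setminus L|-1\}$. The $K$-free treewidth $\mathrm{tw}_K(G,K)$ is the minimum width of a tree $K$-free-decomposition of $G$. *)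

(* Defs.v *)
From mathcomp Require Import all_boot all_order all_algebra.
From mathcomp Require Import boolp.

Set Implicit Arguments.
Unset Strict Implicit.
Unset Printing Implicit Defensive.


Record sgraph (V : finType) := SGraph {
  edge : rel V;
  edge_sym : symmetric edge;
  edge_irr : irreflexive edge }.

(* A rooted tree on the node set T, given by its parent map.  By convention the
   root is its own parent; [parent_to_root] excludes any other cycle.  Since
   there is a root, T is non-empty. *)
Record rtree (T : finType) := RTree {
  root : T;
  parent : T -> T;
  parent_root : parent root = root;
  parent_to_root : forall x, exists i, iter i parent x = root }.

Section RootedTree.
Variables (T : finType) (t : rtree T).

Definition tree_adj : rel T :=
  fun x y => (x != y) && ((parent t x == y) || (parent t y == x)).

(* A leaf is a node without children, so the root of a one-node tree is one. *)
Definition is_leaf (x : T) : bool :=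
  [forall y, (y != root t) ==> (parent t y != x)].

Definition subtree (S : {set T}) : Prop :=
  S != set0 /\
  {in S &, forall x y,
     connect [rel a b | [&& a \in S, b \in S & tree_adj a b]] x y}.

End RootedTree.

Record triple (V T : finType) := Triple {
  tree : rtree T;
  bag : T -> {set V};
  lset : {set V} }.

Section Decomposition.
Variables (V : finType) (G : sgraph V) (K : {set V}).

Record kfree_decomposition (T : finType) (D : triple V T) : Prop := KFreeDec {
  kfd_A : forall v : V, subtree (tree D) [set x | v \in bag D x];
  kfd_B : forall u v : V, edge G u v ->
    exists x, (u \in bag D x) && (v \in bag D x);
  kfd_C : forall v, v \in lset D ->
    exists2 x, is_leaf (tree D) x & forall y, (v \in bag D y) = (y == x);
  kfd_D : forall x, bag D x :&: lset D :&: K = set0 }.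

(* Subtraction on nat is truncated and the empty maximum is 0, so this is
   max {0, max_x (|bag x \ L| - 1)}. *)
Definition width (T : finType) (D : triple V T) : nat :=
  \max_(x : T) (#|bag D x :\: lset D| - 1).

Definition has_kfree_width (w : nat) : Prop :=
  exists (T : finType) (D : triple V T),
    kfree_decomposition D /\ width D = w.

Lemma has_kfree_width_ex : exists w, `[< has_kfree_width w >].
Proof.
pose t := @RTree unit tt id erefl
  (fun x => ex_intro _ 0 (match x with tt => erefl end)).
pose D := @Triple V unit t (fun _ => setT) set0.
exists (width D); apply/asboolP; exists unit, D; split=> //; split=> /=.
- move=> v; split; first by apply/set0Pn; exists tt; rewrite !inE.
  by move=> [] [] _ _; apply: connect0.
- by move=> u v _; exists tt; rewrite !inE.
- by move=> v; rewrite inE.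
- by move=> x; rewrite setI0 set0I.
Qed.

Definition tw_K : nat := ex_minn has_kfree_width_ex.

End Decomposition.

(* Model of computation.

   A program is a finite list of mutually recursive unary functions of a
   first-order, pure Lisp whose only data are binary trees (S-expressions).  It
   is run by a deterministic abstract machine with an explicit environment and
   an explicit stack of pending frames.  Time is the number of machine steps;
   space is the largest size of a configuration reached, where every value in
   the environment and on the stack is counted in full (no sharing).  A step
   only moves, copies, pairs, splits or discards values already present, hence
   takes a Turing machine time polynomial in the size of the configuration; and
   Turing machines are simulated by tail-recursive programs with constant
   factor overhead in time and space.  So simultaneous bounds
   "2^O(k) poly(n) time and polynomial space" mean the same in both models. *)

Inductive sexp := Nil | Pair of sexp & sexp.

Fixpoint sexp_size (s : sexp) : nat :=
  if s is Pair a b then (sexp_size a + sexp_size b).+1 else 1.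

(* Variables are de Bruijn indices.  [Case e e0 e1] continues with e0 if e
   evaluates to Nil, and with e1 in the environment extended by the head
   (index 0) and the tail (index 1) otherwise. *)
Inductive expr :=
  | Var of nat
  | ENil
  | EPair of expr & expr
  | Case of expr & expr & expr
  | Let of expr & expr
  | Call of nat & expr.

Definition program := seq expr.
Definition env := seq sexp.

Inductive frame :=
  | FPairL of expr & env
  | FPairR of sexp
  | FCase of expr & expr & env
  | FLet of expr & env
  | FCall of nat.

Inductive config :=
  | Exec of expr & env & seq frame
  | Ret of sexp & seq frame.

(* An unbound variable denotes Nil and an undefined function returns Nil.
   [Ret v [::]] is the halting configuration with result v. *)
Definition step (p : program) (c : config) : config :=
  match c with
  | Exec (Var i) r F => Ret (nth Nil r i) F
  | Exec ENil r F => Ret Nil F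
  | Exec (EPair a b) r F => Exec a r (FPairL b r :: F)
  | Exec (Case e e0 e1) r F => Exec e r (FCase e0 e1 r :: F)
  | Exec (Let e e1) r F => Exec e r (FLet e1 r :: F)
  | Exec (Call f e) r F => Exec e r (FCall f :: F)
  | Ret v [::] => Ret v [::]
  | Ret v (FPairL b r :: F) => Exec b r (FPairR v :: F)
  | Ret v (FPairR u :: F) => Ret (Pair u v) F
  | Ret Nil (FCase e0 e1 r :: F) => Exec e0 r F
  | Ret (Pair a b) (FCase e0 e1 r :: F) => Exec e1 [:: a, b & r] F
  | Ret v (FLet e1 r :: F) => Exec e1 (v :: r) F
  | Ret v (FCall f :: F) => Exec (nth ENil p f) [:: v] F
  end.

Definition env_size (r : env) : nat := sumn [seq sexp_size v | v <- r].

(* Expressions occurring in a configuration are subexpressions of the fixed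
   program; each counts as a pointer of size 1. *)
Definition frame_size (f : frame) : nat :=
  match f with
  | FPairL _ r | FCase _ _ r | FLet _ r => (env_size r).+1
  | FPairR v => (sexp_size v).+1
  | FCall _ => 1
  end.

Definition stack_size (F : seq frame) : nat := sumn [seq frame_size f | f <- F].

Definition config_size (c : config) : nat :=
  match c with
  | Exec _ r F => (env_size r + stack_size F).+1
  | Ret v F => sexp_size v + stack_size F
  end.

Definition init (p : program) (x : sexp) : config := Exec (nth ENil p 0) [:: x] [::].

Definition computes_within (p : program) (x y : sexp) (time space : nat) : Prop :=
  iter time (step p) (init p x) = Ret y [::] /\
  forall i, config_size (iter i (step p) (init p x)) <= space.


Definition enc_bool (b : bool) : sexp := if b then Pair Nil Nil else Nil.
Definition enc_seq (s : seq sexp) : sexp := foldr Pair Nil s.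
Definition enc_unary (n : nat) : sexp := iter n (Pair Nil) Nil.

(* Little-endian, without leading zeros; 0 has no digits. *)
Definition binary_digits (n : nat) : seq bool :=
  [seq odd (n %/ 2 ^ i) | i <- iota 0 (up_log 2 n.+1)].

Definition enc_int (k : int) : sexp :=
  Pair (enc_bool (k < 0)%R) (enc_seq [seq enc_bool b | b <- binary_digits `|k|%N]).

Definition enc_set n (A : {set 'I_n}) : sexp :=
  enc_seq [seq enc_bool (i \in A) | i <- enum 'I_n].

Definition enc_graph n (G : sgraph 'I_n) : sexp :=
  enc_seq [seq enc_set [set j | edge G i j] | i <- enum 'I_n].

Definition enc_input n (G : sgraph 'I_n) (K : {set 'I_n}) (k : int) : sexp :=
  Pair (enc_graph G) (Pair (enc_set K) (enc_int k)).

(* The root, the list of all pairs (parent of x, bag of x), and L.  This is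
   never Nil, which is the answer "tw_K (G, K) > k". *)
Definition enc_triple n m (D : triple 'I_n 'I_m) : sexp :=
  Pair (enc_unary (root (tree D)))
    (Pair (enc_seq [seq Pair (enc_unary (parent (tree D) x)) (enc_set (bag D x))
                   | x <- enum 'I_m])
          (enc_set (lset D))).

Definition enc_reject : sexp := Nil.

(* Main.v *)
Require Import Defs.
From mathcomp Require Import all_boot all_order all_algebra.
From mathcomp Require Import zify.
From mathcomp Require Import boolp.
(* [Nil] has to mean the S-expression, not the empty sequence. *)
Import Defs.

Set Implicit Arguments.
Unset Strict Implicit.
Unset Printing Implicit Defensive.

(* An item (C, S) of the algorithm stands for the task of decomposing G[C :|: S]
   with S in the root bag, where all neighbours of C lie in C :|: S and
   #|S| <= 4k + 4.  If C avoids K, then a single leaf with C inside L does.  If S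
   is not full, then a vertex of C is moved to S.  Otherwise, a decomposition of
   width at most k provides a separator X with at most k + 1 vertices such that
   either both sides contain enough vertices of S, or one side avoids K and
   contains enough vertices of S.  The algorithm guesses how the separator splits
   S, which takes 2^O(k) attempts, and replaces the part of the separator inside
   C by a minimum vertex cut Y; the bag S :|: Y has at most 5k + 5 vertices, and
   both sides become items again.  Every node introduces a vertex, so there are
   at most n + 1 nodes.

   A minimum vertex cut is (A :|: N[P]) :\: P for a set P that maximizes
   #|P| - #|N[P] :\: A|, and by Koenig's theorem such a P consists of the vertices
   from which no alternating path of a maximum matching reaches a free vertex.

   The whole computation is one loop over states of polynomial size whose body is
   computable in polynomial time; the class of polynomial time functions is shown
   to be closed under first-order definitions over 'I_n and bounded iteration. *)

(** * The abstract machine *)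

(** There is no backtracking. For an item with full S whose C meets K, the invariant alone
    guarantees that some guess succeeds whenever a decomposition of width at most k exists. So a
    successful guess is never revised, and a single item all of whose guesses fail certifies
    rejection. The number of rounds is therefore n + 1 times 2^O(k) at most, and only one work list
    and one binary counter are stored, which keeps the space polynomial.

    The obstacle to the usual balanced separator argument is that a leaf bag may hold arbitrarily
    many vertices of L, so that most of S may sit in one leaf and cannot be balanced there. Such a
    part avoids K, hence becomes an item that a single leaf closes. Its S may grow to (4k + 4) + (k
    + 1) = 5k + 5, while every other item has to keep its S within 4k + 4. With 4k + 4 vertices in
    S, more than half of S minus a separator of k + 1 vertices still has k + 2 vertices, enough to
    pay for Y even when Y is enlarged to be non-empty. *)

Definition runs (q : program) (T S : nat) (c c' : config) : Prop :=
  exists t, [/\ t <= T, iter t (step q) c = c' &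
    forall i, i <= t -> config_size (iter i (step q) c) <= S].

Lemma runs_refl q S c : config_size c <= S -> runs q 0 S c c.
Proof. by move=> h; exists 0; split=> // i; rewrite leqn0 => /eqP->. Qed.

Lemma runs_trans q T1 T2 S c1 c2 c3 :
  runs q T1 S c1 c2 -> runs q T2 S c2 c3 -> runs q (T1 + T2) S c1 c3.
Proof.
move=> [t1 [h1 e1 s1]] [t2 [h2 e2 s2]]; exists (t2 + t1); split; first by lia.
  by rewrite iterD e1.
move=> i hi; case: (leqP i t1) => [/s1//|lt].
have -> : i = (i - t1) + t1 by lia.
by rewrite iterD e1; apply: s2; lia.
Qed.

Lemma runs_step q T S c c' :
  config_size c <= S -> runs q T S (step q c) c' -> runs q T.+1 S c c'.
Proof.
move=> h [t [ht e s]]; exists t.+1; split=> //; first by rewrite iterSr.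
by case=> [//|i] hi; rewrite iterSr; apply: s.
Qed.

Lemma runs_le q T T' S S' c c' :
  runs q T S c c' -> T <= T' -> S <= S' -> runs q T' S' c c'.
Proof.
move=> [t [ht e s]] hT hS; exists t; split=> //; first by lia.
by move=> i /s; lia.
Qed.

Lemma runs_last q T S c c' : runs q T S c c' -> config_size c' <= S.
Proof. by move=> [t [_ <- s]]; apply: s. Qed.

Definition embedded (q : program) (d : nat) (p : program) : Prop :=
  forall i, i < size p -> nth ENil q (d + i) = nth ENil p i.

Lemma embedded_cons q d b p :
  embedded q d (b :: p) -> nth ENil q d = b /\ embedded q d.+1 p.
Proof.
move=> h; split; first by have := h 0 erefl; rewrite addn0.
by move=> i hi; have := h i.+1 hi; rewrite addnS addSn.
Qed.

Lemma embedded_cat q d p1 p2 :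
  embedded q d (p1 ++ p2) -> embedded q d p1 /\ embedded q (d + size p1) p2.
Proof.
move=> h; split=> i hi.
  by rewrite h ?size_cat ?nth_cat ?hi //; lia.
by rewrite -addnA h ?size_cat ?nth_cat ?ltn_add2l // ltnNge leq_addr addKn.
Qed.

(* Code depends on the position at which it is linked, since calls are absolute. *)
Record code := Code {
  code_at :> nat -> program;
  code_len : nat;
  code_size : forall d, size (code_at d) = code_len }.

(** The host program [q], the position [d] and the pending frames [F] are arbitrary, so the
    statement applies to a call in the middle of any larger run; [S] counts only what lies above
    [F]. *)
Definition computes (p : code) (x y : sexp) (T S : nat) : Prop :=
  forall q d F, embedded q d (p d) ->
  runs q T (S + stack_size F) (Exec (nth ENil q d) [:: x] F) (Ret y F).

Lemma computes_size p x y T S : computes p x y T S -> sexp_size y <= S.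
Proof.
move=> h; have /runs_last := h (p 0) 0 [::] (fun i _ => erefl).
by rewrite /= !addn0.
Qed.

Lemma step_ret_call q v f F :
  step q (Ret v (FCall f :: F)) = Exec (nth ENil q f) [:: v] F.
Proof. by case: v. Qed.

Lemma step_ret_pairl q v b r F :
  step q (Ret v (FPairL b r :: F)) = Exec b r (FPairR v :: F).
Proof. by case: v. Qed.

Lemma step_ret_pairr q u v F : step q (Ret v (FPairR u :: F)) = Ret (Pair u v) F.
Proof. by case: v. Qed.

Ltac size_lia := rewrite /= /stack_size /= /frame_size /env_size /=; lia.

Ltac mstep := apply: runs_step;
  [size_lia | rewrite ?step_ret_call ?step_ret_pairl ?step_ret_pairr /=].

Fact single_size (b : expr) (d : nat) : size ((fun=> [:: b]) d) = 1.
Proof. by []. Qed.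
Definition single (b : expr) : code := Code (single_size b).

Lemma computes_var x : computes (single (Var 0)) x x 5 (sexp_size x + 5).
Proof.
move=> q d F /embedded_cons[-> _].
by apply: (@runs_le _ 1 _ _ _ _ _ _ _ (leqnn _)) => //; mstep; apply: runs_refl; size_lia.
Qed.

Lemma computes_nil x : computes (single ENil) x Nil 5 (sexp_size x + 5).
Proof.
move=> q d F /embedded_cons[-> _].
by apply: (@runs_le _ 1 _ _ _ _ _ _ _ (leqnn _)) => //; mstep; apply: runs_refl; size_lia.
Qed.

Definition shd (x : sexp) := if x is Pair a _ then a else Nil.
Definition stl (x : sexp) := if x is Pair _ b then b else Nil.

Lemma computes_hd x :
  computes (single (Case (Var 0) ENil (Var 0))) x (shd x) 5 (sexp_size x * 3 + 5).
Proof.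
move=> q d F /embedded_cons[-> _].
apply: (@runs_le _ 4 _ _ _ _ _ _ _ (leqnn _)) => //.
by mstep; mstep; case: x => [|a b]; (mstep; mstep; apply: runs_refl; size_lia).
Qed.

Lemma computes_tl x :
  computes (single (Case (Var 0) ENil (Var 1))) x (stl x) 5 (sexp_size x * 3 + 5).
Proof.
move=> q d F /embedded_cons[-> _].
apply: (@runs_le _ 4 _ _ _ _ _ _ _ (leqnn _)) => //.
by mstep; mstep; case: x => [|a b]; (mstep; mstep; apply: runs_refl; size_lia).
Qed.

Fact comp_size (pf pg : code) d :
  size (Call (d.+1 + code_len pg) (Call d.+1 (Var 0)) :: pg d.+1 ++ pf (d.+1 + code_len pg))
  = (code_len pg + code_len pf).+1.
Proof. by rewrite /= size_cat !code_size. Qed.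
Definition comp_code pf pg := Code (comp_size pf pg).

Lemma computes_comp pf pg x y z T1 S1 T2 S2 :
  computes pg x y T1 S1 -> computes pf y z T2 S2 ->
  computes (comp_code pf pg) x z (T1 + T2 + 9) (sexp_size x + S1 + S2 + 9).
Proof.
move=> hg hf q d F /embedded_cons[-> /embedded_cat[eg]]; rewrite code_size => ef.
have sy := computes_size hg.
apply: (@runs_le _ (T1 + T2.+1).+4 _ (sexp_size x + S1 + S2 + 9 + stack_size F)); try lia.
do 4 mstep; apply: runs_trans.
  by refine (runs_le (hg _ _ (FCall _ :: F) eg) _ _); size_lia.
by mstep; refine (runs_le (hf _ _ F ef) _ _); size_lia.
Qed.

Fact pair_size (pf pg : code) d :
  size (EPair (Call (d.+1 + code_len pg) (Var 0)) (Call d.+1 (Var 0))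
    :: pg d.+1 ++ pf (d.+1 + code_len pg))
  = (code_len pg + code_len pf).+1.
Proof. by rewrite /= size_cat !code_size. Qed.
Definition pair_code pf pg := Code (pair_size pf pg).

Lemma computes_pair pf pg x y z T1 S1 T2 S2 :
  computes pf x y T1 S1 -> computes pg x z T2 S2 ->
  computes (pair_code pf pg) x (Pair y z) (T1 + T2 + 10)
    (sexp_size x * 3 + S1 + S2 + 9).
Proof.
move=> hf hg q d F /embedded_cons[-> /embedded_cat[eg]]; rewrite code_size => ef.
have sy := computes_size hf; have sz := computes_size hg.
apply: (@runs_le _ (T1 + (T2 + 1).+4).+4 _ (sexp_size x * 3 + S1 + S2 + 9 + stack_size F)); try lia.
do 4 mstep; apply: runs_trans.
  by refine (runs_le (hf _ _ (FPairL _ _ :: F) ef) _ _); size_lia.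
do 4 mstep; apply: runs_trans.
  by refine (runs_le (hg _ _ (FPairR _ :: F) eg) _ _); size_lia.
by mstep; apply: runs_refl; size_lia.
Qed.

(** In the last branch the input has index 2, because [Case] has pushed the head and the tail of the
    tested value in front of it. *)
Fact case_size (pb pf pg : code) d :
  size (Case (Call d.+1 (Var 0)) (Call (d.+1 + code_len pb) (Var 0))
         (Call (d.+1 + code_len pb + code_len pf) (Var 2))
    :: pb d.+1 ++ pf (d.+1 + code_len pb) ++ pg (d.+1 + code_len pb + code_len pf))
  = (code_len pb + (code_len pf + code_len pg)).+1.
Proof. by rewrite /= !size_cat !code_size. Qed.
Definition case_code pb pf pg := Code (case_size pb pf pg).

Definition is_pair (x : sexp) : bool := if x is Pair _ _ then true else false.

Lemma computes_case pb pf pg x w y z T0 S0 T1 S1 T2 S2 :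
  computes pb x w T0 S0 -> (~~ is_pair w -> computes pf x y T1 S1) ->
  (is_pair w -> computes pg x z T2 S2) ->
  computes (case_code pb pf pg) x (if w is Pair _ _ then z else y)
   (T0 + (T1 + T2) + 10) (sexp_size x * 3 + S0 + S1 + S2 + 9).
Proof.
move=> hb hf hg q d F /embedded_cons[-> /embedded_cat[eb]]; rewrite code_size.
move=> /embedded_cat[ef]; rewrite code_size => eg.
have sw := computes_size hb.
apply: (@runs_le _ ((T0 + ((T1 + T2).+4)).+4) _ (sexp_size x * 3 + S0 + S1 + S2 + 9 + stack_size F)); try lia.
do 4 mstep; apply: runs_trans.
  by refine (runs_le (hb _ _ (FCase _ _ _ :: F) eb) _ _); size_lia.
case: w sw {hb} hf hg => [|a b] /= sw => [/(_ isT) hf _ | _ /(_ isT) hg]; do 4 mstep.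
  by refine (runs_le (hf _ _ F ef) _ _); size_lia.
by refine (runs_le (hg _ _ F eg) _ _); size_lia.
Qed.

(* The body returns [Pair (Pair _ _) z] to go on with z and [Pair Nil y] to stop
   with the result y.  The recursive call is a tail call, so the stack does not
   grow. *)
Fact while_size (pf : code) d :
  size (Case (Var 0) ENil (Case (Var 0) (Var 1) (Call d (Call d.+1 (Var 3)))) :: pf d.+1)
  = (code_len pf).+1.
Proof. by rewrite /= code_size. Qed.
Definition while_code pf := Code (while_size pf).

(** The trace of a loop with N evaluations of the body. All states obey the same bound S, so time
    adds up over the rounds while space does not. *)
Inductive while_run (pf : code) (T S : nat) : nat -> sexp -> sexp -> Prop :=
  | WhileStop y : sexp_size y + 2 <= S -> while_run pf T S 0 (Pair Nil y) y
  | WhileGo N a b z x y : sexp_size (Pair (Pair a b) z) <= S ->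
      computes pf z x T S -> while_run pf T S N x y ->
      while_run pf T S N.+1 (Pair (Pair a b) z) y.

Lemma computes_while pf T S N x y : while_run pf T S N x y ->
  computes (while_code pf) x y (N * (T + 12) + 10) (4 * S + 9).
Proof.
move=> h q d F /[dup] emb /embedded_cons[ed ef].
elim: h => {N x y} [y hy|N a b z x y hs hc _ IH]; rewrite ed.
  apply: (@runs_le _ 7 _ (4 * S + 9 + stack_size F)) => //.
  by do 7 mstep; apply: runs_refl; size_lia.
rewrite /= in hs.
apply: (@runs_le _ ((T + (N * (T + 12) + 10).+1).+3.+3.+4) _ (4 * S + 9 + stack_size F)); try lia.
do 10 mstep; apply: runs_trans.
  by refine (runs_le (hc _ _ (FCall _ :: F) ef) _ _); size_lia.
have sx := computes_size hc.
by mstep; exact: IH.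
Qed.

Lemma computes_le p x y T T' S S' :
  computes p x y T S -> T <= T' -> S <= S' -> computes p x y T' S'.
Proof.
move=> h hT hS q d F ed; apply: (runs_le (h q d F ed)) => //.
by rewrite leq_add2r.
Qed.

(** The body is evaluated N + 1 times: the last evaluation, on [st N], produces the stopping
    value. *)
Lemma computes_while_seq pf T S N (st : nat -> sexp) y :
  (forall t, t <= N -> sexp_size (st t) + 4 <= S) ->
  (forall t, t <= N -> computes pf (st t)
     (if t < N then Pair (Pair Nil Nil) (st t.+1) else Pair Nil y) T S) ->
  computes (while_code pf) (Pair (Pair Nil Nil) (st 0)) y (N.+1 * (T + 12) + 10) (4 * S + 9).
Proof.
move=> hs hc; apply: computes_while.
suff h t : t <= N -> while_run pf T S (N - t).+1 (Pair (Pair Nil Nil) (st t)) y.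
  by have := h 0 (leq0n _); rewrite subn0.
move: {2}(N - t) (erefl (N - t)) => d; elim: d t => [|d IH] t dE tN.
  have eN : t = N by lia.
  rewrite dE; apply: WhileGo (hc t tN) _.
    by have := hs t tN; rewrite /=; lia.
  rewrite eN ltnn; apply: WhileStop.
  by have := computes_size (hc t tN); rewrite eN ltnn /=; lia.
rewrite dE; apply: WhileGo (hc t tN) _.
  by have := hs t tN; rewrite /=; lia.
have lt : t < N by lia.
rewrite lt; have -> : d.+1 = (N - t.+1).+1 by lia.
by apply: IH; lia.
Qed.

(** * Functions computable in polynomial time and space *)

(** The base is at least 2, so constants, factors and sums are absorbed by the exponent, and one
    number c describes the whole bound. *)
Definition pbounded (I : Type) (s q : I -> nat) : Prop :=
  exists c, forall i, q i <= (s i).+2 ^ c.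

Section PolynomialBounds.
Variables (I : Type) (s : I -> nat).

Lemma pbounded_le q q' : (forall i, q i <= q' i) -> pbounded s q' -> pbounded s q.
Proof. by move=> h [c hc]; exists c => i; apply: leq_trans (h i) (hc i). Qed.

Lemma pbounded_const a : pbounded s (fun=> a).
Proof.
exists a => i; apply: leq_trans (ltnW (ltn_expl a (isT : 1 < 2))) _.
by case: a => // a; rewrite leq_exp2r.
Qed.

Lemma pbounded_id : pbounded s s.
Proof. by exists 1 => i; rewrite expn1; lia. Qed.

Lemma pbounded_mul q q' : pbounded s q -> pbounded s q' -> pbounded s (fun i => q i * q' i).
Proof. by move=> [c hc] [c' hc']; exists (c + c') => i; rewrite expnD leq_mul. Qed.

Lemma pbounded_add q q' : pbounded s q -> pbounded s q' -> pbounded s (fun i => q i + q' i).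
Proof.
move=> [c hc] [c' hc']; exists (c + c').+1 => i.
have h d : d <= c + c' -> (s i).+2 ^ d <= (s i).+2 ^ (c + c') by move=> ?; rewrite leq_exp2l.
have := h _ (leq_addr c' c); have := h _ (leq_addl c c').
by have := hc i; have := hc' i; rewrite expnS; nia.
Qed.

Lemma pbounded_exp q a : pbounded s q -> pbounded s (fun i => q i ^ a).
Proof.
move=> hq; elim: a => [|a IH].
  by apply: pbounded_le (pbounded_const 1) => i; rewrite expn0.
by apply: pbounded_le (pbounded_mul hq IH) => i; rewrite expnS.
Qed.

Lemma pbounded_trans q r : pbounded s q -> pbounded q r -> pbounded s r.
Proof.
move=> hq [c hc]; apply: pbounded_le hc _.
apply: pbounded_exp; apply: pbounded_le (pbounded_add hq (pbounded_const 2)) => i; lia.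
Qed.

End PolynomialBounds.

Lemma pbounded_reindex I J (h : J -> I) (s q : I -> nat) :
  pbounded s q -> pbounded (s \o h) (q \o h).
Proof. by move=> [c hc]; exists c => j; apply: hc. Qed.

Ltac pbd := repeat first
  [ assumption
  | apply: pbounded_add | apply: pbounded_mul | apply: pbounded_id
  | apply: pbounded_const ].

(* Inputs are indexed by I and encoded by e, so that data of a type depending on
   i : I, such as {set 'I_(n i)}, can be handled uniformly in i. *)
Definition feasible (I : Type) (e f : I -> sexp) : Prop :=
  exists (p : code) (T S : I -> nat),
    [/\ pbounded (sexp_size \o e) T, pbounded (sexp_size \o e) S &
        forall i, computes p (e i) (f i) (T i) (S i)].

Section PolyComputable.
Variable I : Type.
Implicit Types e f g : I -> sexp.

Lemma feasible_ext e f f' : f =1 f' -> feasible e f -> feasible e f'.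
Proof. by move=> E [p [T [S [hT hS h]]]]; exists p, T, S; split=> // i; rewrite -E. Qed.

Lemma feasible_size e f : feasible e f -> pbounded (sexp_size \o e) (sexp_size \o f).
Proof.
move=> [p [T [S [_ hS h]]]]; apply: pbounded_le hS => i.
exact: computes_size (h i).
Qed.

Lemma feasible_id e : feasible e e.
Proof.
exists (single (Var 0)), (fun=> 5), (fun i => sexp_size (e i) + 5); split; first by pbd.
  by pbd.
by move=> i; apply: computes_var.
Qed.

Lemma feasible_nil e : feasible e (fun=> Nil).
Proof.
exists (single ENil), (fun=> 5), (fun i => sexp_size (e i) + 5); split; first by pbd.
  by pbd.
by move=> i; apply: computes_nil.
Qed.

(** The bounds for g are polynomial in the size of [f i]. An output is never larger than the space
    used to produce it, so that size is itself polynomial in the size of [e i]. *)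
Lemma feasible_comp e f g : feasible e f -> feasible f g -> feasible e g.
Proof.
move=> hf; have sf := feasible_size hf; move: hf.
move=> [pf [Tf [Sf [hTf hSf hf]]]] [pg [Tg [Sg [hTg hSg hg]]]].
exists (comp_code pg pf), (fun i => Tf i + Tg i + 9),
  (fun i => sexp_size (e i) + Sf i + Sg i + 9); split.
- by pbd; exact: pbounded_trans hTg.
- by pbd; exact: pbounded_trans hSg.
- by move=> i; apply: computes_comp.
Qed.

Lemma feasible_hd e f : feasible e f -> feasible e (fun i => shd (f i)).
Proof.
move=> hf; apply: feasible_comp hf _.
exists (single (Case (Var 0) ENil (Var 0))), (fun=> 5), (fun i => sexp_size (f i) * 3 + 5).
by split=> [||i]; [pbd|pbd|apply: computes_hd].
Qed.

Lemma feasible_tl e f : feasible e f -> feasible e (fun i => stl (f i)).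
Proof.
move=> hf; apply: feasible_comp hf _.
exists (single (Case (Var 0) ENil (Var 1))), (fun=> 5), (fun i => sexp_size (f i) * 3 + 5).
by split=> [||i]; [pbd|pbd|apply: computes_tl].
Qed.

Lemma feasible_pair e f g : feasible e f -> feasible e g -> feasible e (fun i => Pair (f i) (g i)).
Proof.
move=> [pf [Tf [Sf [hTf hSf hf]]]] [pg [Tg [Sg [hTg hSg hg]]]].
exists (pair_code pf pg), (fun i => Tf i + Tg i + 10),
  (fun i => sexp_size (e i) * 3 + Sf i + Sg i + 9).
by split=> [||i]; [pbd|pbd|apply: computes_pair].
Qed.

Lemma feasible_snd e f g : feasible e (fun i => Pair (f i) (g i)) -> feasible e g.
Proof. exact: feasible_tl. Qed.

Lemma feasible_const e x : feasible e (fun=> x).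
Proof. by elim: x => [|a ha b hb]; [apply: feasible_nil|apply: feasible_pair]. Qed.

End PolyComputable.

Lemma feasible_reindex I J (h : J -> I) (e f : I -> sexp) :
  feasible e f -> feasible (e \o h) (f \o h).
Proof.
move=> [p [T [S [hT hS hp]]]]; exists p, (T \o h), (S \o h).
by split=> [||j]; [apply: pbounded_reindex hT|apply: pbounded_reindex hS|apply: hp].
Qed.

(** Weakening: the value of a new variable is paired in front of the context, and f ignores it. *)
Lemma feasible_wk I (X : I -> Type) (ex : forall i, X i -> sexp) (e f : I -> sexp) : feasible e f ->
  feasible (fun j : {i & X i} => Pair (ex _ (tagged j)) (e (tag j))) (fun j => f (tag j)).
Proof.
move=> /(feasible_reindex (fun j : {i & X i} => tag j)) h.
exact: feasible_comp (feasible_snd (feasible_id _)) h.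
Qed.

Lemma feasibleP I (e f : I -> sexp) : feasible e f -> exists (p : code) c, forall i,
  computes p (e i) (f i) ((sexp_size (e i)).+2 ^ c) ((sexp_size (e i)).+2 ^ c).
Proof.
move=> [p [T [S [[cT hT] [cS hS] h]]]]; exists p, (cT + cS) => i.
by apply: computes_le (h i) _ _; [apply: leq_trans (hT i) _|apply: leq_trans (hS i) _];
  rewrite leq_exp2l ?leq_addr ?leq_addl.
Qed.

(** Restricting the index type to the inputs that reach a branch lets the branch rely on the test,
    for example on a list being non-empty when its first element is used. *)
Lemma feasible_case_in I (e b f g : I -> sexp) : feasible e b ->
  feasible (fun j : {i | ~~ is_pair (b i)} => e (sval j)) (fun j => f (sval j)) ->
  feasible (fun j : {i | is_pair (b i)} => e (sval j)) (fun j => g (sval j)) ->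
  feasible e (fun i => if b i is Pair _ _ then g i else f i).
Proof.
move=> /feasibleP[pb [cb hb]] /feasibleP[pf [cf hf]] /feasibleP[pg [cg hg]].
pose P c i := (sexp_size (e i)).+2 ^ c.
have pP c : pbounded (sexp_size \o e) (P c) by exists c.
exists (case_code pb pf pg), (fun i => P cb i + (P cf i + P cg i) + 10),
  (fun i => sexp_size (e i) * 3 + P cb i + P cf i + P cg i + 9).
split=> [||i]; [by pbd|by pbd|].
by apply: computes_case (hb i) _ _ => hi; [apply: (hf (exist _ i hi))|apply: (hg (exist _ i hi))].
Qed.

Lemma feasible_case I (e b f g : I -> sexp) : feasible e b -> feasible e f -> feasible e g ->
  feasible e (fun i => if b i is Pair _ _ then g i else f i).
Proof. by move=> hb hf hg; apply: feasible_case_in => //; apply: (feasible_reindex (fun j => sval j)). Qed.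

Lemma feasible_if I (e : I -> sexp) (b : I -> bool) (f g : I -> sexp) : feasible e (fun i => enc_bool (b i)) -> feasible e f -> feasible e g ->
  feasible e (fun i => if b i then f i else g i).
Proof.
by move=> hb hf hg; apply: feasible_ext (feasible_case hb hg hf) => i; case: (b i).
Qed.


(** Polynomial bounds do not survive an unbounded number of compositions, so the states need the a
    priori bound B. The number N of rounds enters only the analysis; the body decides by itself when
    to stop. *)
Lemma feasible_while I (e : I -> sexp) (N : I -> nat) (st : I -> nat -> sexp) (y : I -> sexp) :
  feasible e (fun i => st i 0) ->
  feasible (fun j : {j : I * nat | j.2 <= N j.1} => st (sval j).1 (sval j).2)
    (fun j => if (sval j).2 < N (sval j).1 then
     Pair (Pair Nil Nil) (st (sval j).1 (sval j).2.+1) else Pair Nil (y (sval j).1)) ->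
  pbounded (sexp_size \o e) N ->
  (exists2 B, pbounded (sexp_size \o e) B &
    forall i t, t <= N i -> sexp_size (st i t) <= B i) ->
  feasible e y.
Proof.
move=> h0 [p [T [S [[cT hT] [cS hS] hp]]]] hN [B hB sB].
have pBX c : pbounded (sexp_size \o e) (fun i => (B i).+2 ^ c).
  by apply: pbounded_exp; apply: pbounded_le (pbounded_add hB (pbounded_const _ 2)) => i; lia.
pose BT i := (B i).+2 ^ cT; pose BS i := (B i).+2 ^ cS + B i + 10.
have pBT : pbounded (sexp_size \o e) BT by apply: pBX.
have pBS : pbounded (sexp_size \o e) BS by pbd; apply: pBX.
have [p1 [T1 [S1 [hT1 hS1 hp1]]]] : feasible e (fun i => Pair (Pair Nil Nil) (st i 0)).
  by apply: feasible_pair h0; apply: feasible_const.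
exists (comp_code (while_code p) p1), (fun i => T1 i + ((N i + 1) * (BT i + 12) + 10) + 9),
  (fun i => sexp_size (e i) + S1 i + (4 * BS i + 9) + 9); split; [by pbd|by pbd|].
move=> i; apply: computes_comp (hp1 i) _; rewrite addn1.
have hle c t : t <= N i -> (sexp_size (st i t)).+2 ^ c <= (B i).+2 ^ c.
  by move=> tN; case: c => // c; rewrite leq_exp2r // !ltnS sB.
apply: computes_while_seq => t tN.
  by rewrite /BS; have := sB i t tN; lia.
pose j : {j : I * nat | j.2 <= N j.1} := exist _ (i, t) tN.
apply: computes_le (hp j) _ _.
  exact: leq_trans (hT j) (hle _ _ tN).
apply: leq_trans (hS j) _; apply: leq_trans (hle _ _ tN) _.
by rewrite /BS -addnA leq_addr.
Qed.

Lemma size_enc_unary n : sexp_size (enc_unary n) = n.*2.+1.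
Proof. by elim: n => //= n IH; rewrite IH; lia. Qed.

Lemma size_map_le_enc (X : Type) (ex : X -> sexp) s : size s < sexp_size (enc_seq (map ex s)).
Proof. by elim: s => //= x s IH; lia. Qed.

(** A loop whose state consists of the remaining list, the accumulator and the input, on which F may
    depend. Sizes have to be bounded only for the accumulators that occur on prefixes of the
    list. *)
Lemma feasible_foldl I (e : I -> sexp) (X A : I -> Type) (ex : forall i, X i -> sexp)
    (ea : forall i, A i -> sexp) (s : forall i, seq (X i))
    (F : forall i, A i -> X i -> A i) (a0 : forall i, A i) :
  feasible e (fun i => enc_seq (map (@ex i) (s i))) ->
  feasible e (fun i => ea i (a0 i)) ->
  feasible (fun j : {i & (X i * A i)%type} =>
      Pair (Pair (ex _ (tagged j).1) (ea _ (tagged j).2)) (e (tag j)))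
    (fun j => ea _ (F _ (tagged j).2 (tagged j).1)) ->
  (exists2 B, pbounded (sexp_size \o e) B & forall i t, t <= size (s i) ->
    sexp_size (ea i (foldl (F i) (a0 i) (take t (s i)))) <= B i) ->
  feasible e (fun i => ea i (foldl (F i) (a0 i) (s i))).
Proof.
move=> hl h0 hF [B hB sB].
have sl := feasible_size hl.
pose st i t := Pair (enc_seq (map (@ex i) (drop t (s i))))
  (Pair (ea i (foldl (F i) (a0 i) (take t (s i)))) (e i)).
have size_drop_le i t :
    sexp_size (enc_seq (map (@ex i) (drop t (s i)))) <= sexp_size (enc_seq (map (@ex i) (s i))).
  elim: (s i) t => [|x l IH] [|t] //=; rewrite ?drop0 //.
  by have := IH t; lia.
apply: (@feasible_while I e (fun i => size (s i)) st).
- by rewrite /st; apply: feasible_pair; [apply: feasible_ext hl => i; rewrite drop0|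
    apply: feasible_pair (feasible_id e); apply: feasible_ext h0 => i; rewrite take0].
- pose J := {j : I * nat | j.2 <= size (s j.1)}.
  set e' := fun j : J => st (sval j).1 (sval j).2.
  have c0 : feasible e' e' := feasible_id _.
  have c1 := feasible_hd c0; have c2 := feasible_tl c0.
  apply: (feasible_ext (f := fun j : J =>
     if enc_seq (map (@ex _) (drop (sval j).2 (s (sval j).1))) is Pair _ _ then
       Pair (Pair Nil Nil) (st (sval j).1 (sval j).2.+1)
     else Pair Nil (ea _ (foldl (F _) (a0 _) (take (sval j).2 (s (sval j).1)))))).
    move=> [[i t] /= h]; case: ltnP => ht.
      by case E : (drop t (s i)) => [|x l] //; have := congr1 size E; rewrite size_drop /=; lia.
    by have -> : t = size (s i); [lia|rewrite drop_size take_size].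
  apply: feasible_case_in => //.
    exact: (feasible_reindex (fun j => sval j) (feasible_pair (feasible_nil _) (feasible_hd c2))).
  (* On these indices the list is not yet exhausted, which supplies the default element [x0] that
     [nth] needs. *)
  pose J' := {j : J | is_pair (enc_seq (map (@ex _) (drop (sval j).2 (s (sval j).1))))}.
  rewrite -/J'.
  have hJ (j : J') : (sval (sval j)).2 < size (s (sval (sval j)).1).
    case: j => -[[i t] /= h]; rewrite ltnNge.
    by apply: contraTN => ht; rewrite drop_oversize.
  have x0 (j : J') : X (sval (sval j)).1.
    case: j (hJ j) => -[[i t] /= h] _; case: (s i) => [|x _] // _; exact: x.
  pose h (j : J') : {i & (X i * A i)%type} := existT _ (sval (sval j)).1
    (nth (x0 j) (s _) (sval (sval j)).2,
      foldl (F _) (a0 _) (take (sval (sval j)).2 (s (sval (sval j)).1))).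
  have hF' := feasible_reindex h hF.
  have d1 := feasible_reindex (fun j : J' => sval j) c1.
  have d2 := feasible_reindex (fun j : J' => sval j) c2.
  have dr (j : J') : drop (sval (sval j)).2 (s (sval (sval j)).1) =
     nth (x0 j) (s _) (sval (sval j)).2 :: drop (sval (sval j)).2.+1 (s (sval (sval j)).1).
    by rewrite -drop_nth.
  apply: feasible_pair; first exact: feasible_const.
  apply: feasible_pair.
    by apply: feasible_ext (feasible_tl d1) => j /=; rewrite dr.
  apply: feasible_pair; last exact: feasible_tl d2.
  apply: (feasible_ext (f := fun j : J' => ea _ (F _ (tagged (h j)).2 (tagged (h j)).1))).
    by move=> j /=; rewrite (take_nth (x0 j)) ?hJ // -cats1 foldl_cat.
  apply: feasible_comp hF'; apply: feasible_pair; last exact: feasible_tl d2.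
  apply: feasible_pair; last exact: feasible_hd d2.
  by apply: feasible_ext (feasible_hd d1) => j /=; rewrite dr.
- by apply: pbounded_le sl => i /=; apply: ltnW; apply: size_map_le_enc.
- exists (fun i => sexp_size (enc_seq (map (@ex i) (s i))) + (B i + sexp_size (e i) + 2)); first by pbd.
  by move=> i t ti; rewrite /st /=; have := sB i t ti; have := size_drop_le i t; lia.
Qed.

Lemma feasible_iter I (e : I -> sexp) (m : I -> nat) (st : I -> nat -> sexp) :
  feasible e (fun i => enc_unary (m i)) ->
  feasible e (fun i => st i 0) ->
  feasible (fun j : I * nat => Pair (st j.1 j.2) (e j.1)) (fun j => st j.1 j.2.+1) ->
  (exists2 B, pbounded (sexp_size \o e) B &
    forall i t, t <= m i -> sexp_size (st i t) <= B i) ->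
  feasible e (fun i => st i (m i)).
Proof.
move=> hm h0 hs hB.
have E t : foldl (fun (a : nat) (_ : unit) => a.+1) 0 (nseq t tt) = t.
  by rewrite -{2}[t]add0n; elim: t 0 => [|t IH] b /=; rewrite ?addn0 // IH addSnnS.
apply: (feasible_ext (f := fun i => st i (foldl (fun a _ => a.+1) 0 (nseq (m i) tt)))).
  by move=> i; rewrite E.
(* A fold over m units. The accumulator is the round number t, but it is encoded as [st i t], so the
   program manipulates the state and never sees t. *)
apply: (@feasible_foldl I e (fun=> unit) (fun=> nat) (fun _ _ => Nil) st).
- by apply: feasible_ext hm => i; elim: (m i) => //= n ->.
- exact: h0.
- pose J := {i : I & (unit * nat)%type}; have c0 := feasible_id (fun j : J =>
    Pair (Pair Nil (st (tag j) (tagged j).2)) (e (tag j))).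
  apply: feasible_comp (feasible_pair (feasible_tl (feasible_hd c0)) (feasible_tl c0)) _.
  exact: (feasible_reindex (fun j : J => (tag j, (tagged j).2)) hs).
- case: hB => B hB hh; exists B => // i t; rewrite size_nseq => ti.
  by rewrite take_nseq // E; apply: hh.
Qed.

(** * Lists and unary numbers *)

Lemma feasible_iter_bounded I (e : I -> sexp) (A : I -> Type) (ea : forall i, A i -> sexp)
    (m : I -> nat) (F : forall i, A i -> A i) (a0 : forall i, A i) :
  feasible e (fun i => enc_unary (m i)) ->
  feasible e (fun i => ea i (a0 i)) ->
  feasible (fun j : {i & A i} => Pair (ea _ (tagged j)) (e (tag j)))
    (fun j => ea _ (F _ (tagged j))) ->
  (exists2 B, pbounded (sexp_size \o e) B & forall i a, sexp_size (ea i a) <= B i) ->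
  feasible e (fun i => ea i (iter (m i) (F i) (a0 i))).
Proof.
move=> hm h0 hF [B hB sB].
apply: (@feasible_iter I e m (fun i t => ea i (iter t (F i) (a0 i)))) => //.
  exact: (feasible_reindex (fun j : I * nat => existT _ j.1 (iter j.2 (F j.1) (a0 j.1))) hF).
by exists B.
Qed.

Lemma foldl_cons (X Y : Type) (h : X -> Y) s a :
  foldl (fun a x => h x :: a) a s = catrev (map h s) a.
Proof. by elim: s a => //= x s IH a; rewrite IH. Qed.

Lemma size_enc_catrev s a :
  sexp_size (enc_seq (catrev s a)) = sexp_size (enc_seq s) + sexp_size (enc_seq a) - 1.
Proof.
elim: s a => [|x s IH] a /=; first by lia.
by rewrite IH /=; case: (enc_seq s) => [|? ?] /=; lia.
Qed.

Lemma feasible_catrev I (e : I -> sexp) (s r : I -> seq sexp) :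
  feasible e (fun i => enc_seq (s i)) -> feasible e (fun i => enc_seq (r i)) ->
  feasible e (fun i => enc_seq (catrev (s i) (r i))).
Proof.
move=> hs hr; have bs := feasible_size hs; have br := feasible_size hr.
apply: (feasible_ext (f := fun i => enc_seq (foldl (fun a x => id x :: a) (r i) (s i)))).
  by move=> i; rewrite foldl_cons map_id.
apply: (@feasible_foldl I e (fun=> sexp) (fun=> seq sexp) (fun=> id) (fun=> enc_seq) s
  (fun _ a x => id x :: a) r) => //.
- by apply: feasible_ext hs => i; rewrite map_id.
- pose J := {i : I & (sexp * seq sexp)%type}; have c0 := feasible_id (fun j : J =>
    Pair (Pair (tagged j).1 (enc_seq (tagged j).2)) (e (tag j))).
  exact: feasible_pair (feasible_hd (feasible_hd c0)) (feasible_tl (feasible_hd c0)).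
- exists (fun i => sexp_size (enc_seq (s i)) + sexp_size (enc_seq (r i))); first by pbd.
  move=> i t _; rewrite foldl_cons map_id size_enc_catrev.
  suff : sexp_size (enc_seq (take t (s i))) <= sexp_size (enc_seq (s i)) by lia.
  by elim: (s i) t => [|x l IH] [|t] //=; have := IH t; lia.
Qed.

Lemma feasible_rev I (e : I -> sexp) (s : I -> seq sexp) :
  feasible e (fun i => enc_seq (s i)) -> feasible e (fun i => enc_seq (rev (s i))).
Proof. by move=> hs; apply: (feasible_catrev (r := fun=> [::])) hs (feasible_nil e). Qed.

Lemma feasible_cat I (e : I -> sexp) (s r : I -> seq sexp) :
  feasible e (fun i => enc_seq (s i)) -> feasible e (fun i => enc_seq (r i)) ->
  feasible e (fun i => enc_seq (s i ++ r i)).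
Proof.
move=> hs hr; apply: feasible_ext (feasible_catrev (feasible_rev hs) hr) => i.
by rewrite catrevE revK.
Qed.

Lemma feasible_map I (e : I -> sexp) (X : I -> Type) (ex h : forall i, X i -> sexp)
    (s : forall i, seq (X i)) :
  feasible e (fun i => enc_seq (map (@ex i) (s i))) ->
  feasible (fun j : {i & X i} => Pair (ex _ (tagged j)) (e (tag j))) (fun j => h _ (tagged j)) ->
  feasible e (fun i => enc_seq (map (@h i) (s i))).
Proof.
move=> hs hh; have bs := feasible_size hs; have [c hc] := feasible_size hh.
pose L i := sexp_size (enc_seq (map (@ex i) (s i))).
apply: (feasible_ext (f := fun i => enc_seq (rev (foldl (fun a x => h i x :: a) [::] (s i))))).
  by move=> i; rewrite foldl_cons catrevE cats0 revK.
apply: feasible_rev.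
apply: (@feasible_foldl I e X (fun=> seq sexp) ex (fun=> enc_seq) s
  (fun i a x => h i x :: a) (fun=> [::])) => //.
- exact: feasible_nil.
- pose J := {i : I & (X i * seq sexp)%type}.
  have c0 := feasible_id (fun j : J =>
    Pair (Pair (ex _ (tagged j).1) (enc_seq (tagged j).2)) (e (tag j))).
  apply: feasible_pair (feasible_tl (feasible_hd c0)).
  apply: feasible_comp (feasible_reindex (fun j : J => existT X (tag j) (tagged j).1) hh).
  exact: feasible_pair (feasible_hd (feasible_hd c0)) (feasible_tl c0).
(* There are at most [L i] elements, each of size at most [L i], so each image is bounded by one
   polynomial in [L i] and the size of the input. *)
- exists (fun i => L i * ((L i + sexp_size (e i) + 3) ^ c + 1) + 1).
    by pbd; apply: pbounded_exp; pbd.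
  move=> i t _; rewrite foldl_cons size_enc_catrev /= addnK.
  apply: (@leq_trans (sexp_size (enc_seq (map (@h i) (s i))))).
    by elim: (s i) t => [|x l IH] [|t] //=; have := IH t; lia.
  have sL : size (s i) <= L i by apply: ltnW; apply: size_map_le_enc.
  set Q := _ ^ c.
  have hQ x : sexp_size (ex i x) <= L i -> sexp_size (h i x) <= Q.
    move=> hx; apply: leq_trans (hc (existT _ i x)) _.
    by rewrite /Q /=; case: (c) => // c'; rewrite leq_exp2r //; lia.
  apply: (@leq_trans (size (s i) * (Q + 1) + 1)); last by rewrite leq_add2r leq_mul2r sL orbT.
  have : sexp_size (enc_seq (map (@ex i) (s i))) <= L i by [].
  elim: (s i) => [|x l IH] //= hL.
  have hx : sexp_size (ex i x) <= L i by lia.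
  have hl : sexp_size (enc_seq (map (@ex i) l)) <= L i by lia.
  by rewrite mulSn; have := IH hl; have := hQ _ hx; lia.
Qed.


(** A unary number is the list of that many copies of [Nil], so it arises by mapping every element
    to [Nil]. *)
Lemma feasible_length I (e : I -> sexp) (s : I -> seq sexp) :
  feasible e (fun i => enc_seq (s i)) -> feasible e (fun i => enc_unary (size (s i))).
Proof.
move=> hs; apply: (feasible_ext (f := fun i => enc_seq (map (fun=> Nil) (s i)))).
  by move=> i; elim: (s i) => //= x l ->.
apply: (@feasible_map I e (fun=> sexp) (fun=> id)) => //; last exact: feasible_nil.
by apply: feasible_ext hs => i; rewrite map_id.
Qed.

Lemma size_iter_stl t x : sexp_size (iter t stl x) <= sexp_size x.
Proof.
elim: t => //= t IH; apply: leq_trans IH.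
by case: (iter t stl x) => //= a b; lia.
Qed.

Lemma feasible_iter_stl I (e : I -> sexp) (m : I -> nat) (x : I -> sexp) :
  feasible e (fun i => enc_unary (m i)) -> feasible e x ->
  feasible e (fun i => iter (m i) stl (x i)).
Proof.
move=> hm hx; have bx := feasible_size hx.
apply: (@feasible_iter I e m (fun i t => iter t stl (x i))) => //.
  exact: feasible_tl (feasible_hd (feasible_id _)).
by exists (fun i => sexp_size (x i)) => // i t _; apply: size_iter_stl.
Qed.

Lemma shd_iter_stl t s : shd (iter t stl (enc_seq s)) = nth Nil s t.
Proof.
elim: s t => [|x s IH] [|t] //; last by rewrite iterSr IH.
by have -> : iter t.+1 stl Nil = Nil by elim: t => //= t ->.
Qed.

Lemma feasible_nth I (e : I -> sexp) (m : I -> nat) (s : I -> seq sexp) :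
  feasible e (fun i => enc_unary (m i)) -> feasible e (fun i => enc_seq (s i)) ->
  feasible e (fun i => nth Nil (s i) (m i)).
Proof.
move=> hm hs; apply: feasible_ext (feasible_hd (feasible_iter_stl hm hs)) => i.
exact: shd_iter_stl.
Qed.

Section Numbers.
Variables (I : Type) (e : I -> sexp).
Implicit Types (m p : I -> nat) (a b : I -> bool).

Lemma feasible_succ m : feasible e (fun i => enc_unary (m i)) -> feasible e (fun i => enc_unary (m i).+1).
Proof. exact: feasible_pair (feasible_nil e). Qed.

Lemma feasible_add m p : feasible e (fun i => enc_unary (m i)) -> feasible e (fun i => enc_unary (p i)) ->
  feasible e (fun i => enc_unary (m i + p i)).
Proof.
move=> hm hp; apply: feasible_ext (feasible_cat (s := fun i => nseq (m i) Nil) (r := fun i => nseq (p i) Nil) _ _).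
- by move=> i; rewrite cat_nseq /ncons -iterD addnC; elim: (_ + _) => //= n ->.
- by apply: feasible_ext hm => i; elim: (m i) => //= n ->.
- by apply: feasible_ext hp => i; elim: (p i) => //= n ->.
Qed.

(** Since [stl Nil] is [Nil], taking tails truncates at 0 exactly as subtraction on nat does. *)
Lemma feasible_sub m p : feasible e (fun i => enc_unary (m i)) -> feasible e (fun i => enc_unary (p i)) ->
  feasible e (fun i => enc_unary (m i - p i)).
Proof.
move=> hm hp; apply: feasible_ext (feasible_iter_stl hp hm) => i.
by elim: (p i) => [|n IH]; rewrite ?subn0 //= IH subnS; case: (_ - _).
Qed.

Lemma feasible_if_bool b f g : feasible e (fun i => enc_bool (b i)) ->
  feasible e (fun i => enc_bool (f i)) -> feasible e (fun i => enc_bool (g i)) ->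
  feasible e (fun i => enc_bool (if b i then f i else g i)).
Proof. by move=> hb hf hg; apply: feasible_ext (feasible_if hb hf hg) => i; case: (b i). Qed.

Lemma feasible_neg a : feasible e (fun i => enc_bool (a i)) -> feasible e (fun i => enc_bool (~~ a i)).
Proof. by move=> h; apply: (feasible_if_bool h); apply: feasible_const. Qed.

Lemma feasible_and a b : feasible e (fun i => enc_bool (a i)) -> feasible e (fun i => enc_bool (b i)) ->
  feasible e (fun i => enc_bool (a i && b i)).
Proof. by move=> ha hb; apply: (feasible_if_bool ha hb); apply: feasible_const. Qed.

Lemma feasible_or a b : feasible e (fun i => enc_bool (a i)) -> feasible e (fun i => enc_bool (b i)) ->
  feasible e (fun i => enc_bool (a i || b i)).
Proof. by move=> ha hb; apply: (feasible_if_bool ha _ hb); apply: feasible_const. Qed.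

Lemma feasible_imp a b : feasible e (fun i => enc_bool (a i)) -> feasible e (fun i => enc_bool (b i)) ->
  feasible e (fun i => enc_bool (a i ==> b i)).
Proof. by move=> ha hb; apply: (feasible_if_bool ha hb); apply: feasible_const. Qed.

Lemma feasible_pos m : feasible e (fun i => enc_unary (m i)) -> feasible e (fun i => enc_bool (0 < m i)).
Proof.
move=> hm; apply: feasible_ext (feasible_case hm (feasible_const e (enc_bool false)) (feasible_const e (enc_bool true))) => i.
by case: (m i).
Qed.

Lemma feasible_leq m p : feasible e (fun i => enc_unary (m i)) -> feasible e (fun i => enc_unary (p i)) ->
  feasible e (fun i => enc_bool (m i <= p i)).
Proof.
move=> hm hp; apply: feasible_ext (feasible_neg (feasible_pos (feasible_sub hm hp))) => i.
by rewrite subn_gt0 -leqNgt.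
Qed.

Lemma feasible_eqn m p : feasible e (fun i => enc_unary (m i)) -> feasible e (fun i => enc_unary (p i)) ->
  feasible e (fun i => enc_bool (m i == p i)).
Proof.
by move=> hm hp; apply: feasible_ext (feasible_and (feasible_leq hm hp) (feasible_leq hp hm)) => i; rewrite eqn_leq.
Qed.

Lemma feasible_if_unary b f g : feasible e (fun i => enc_bool (b i)) ->
  feasible e (fun i => enc_unary (f i)) -> feasible e (fun i => enc_unary (g i)) ->
  feasible e (fun i => enc_unary (if b i then f i else g i)).
Proof. by move=> hb hf hg; apply: feasible_ext (feasible_if hb hf hg) => i; case: (b i). Qed.

Lemma size_enc_map_unary l n : all (ltn^~ n) l ->
  sexp_size (enc_seq (map enc_unary l)) <= (size l) * (n.*2 + 2) + 1.
Proof. by elim: l => //= x l IH /andP[hx /IH]; rewrite size_enc_unary; nia. Qed.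

Lemma feasible_iota m : feasible e (fun i => enc_unary (m i)) ->
  feasible e (fun i => enc_seq (map enc_unary (iota 0 (m i)))).
Proof.
move=> hm; have bm := feasible_size hm.
apply: (feasible_ext (f := fun i => enc_seq (rev (map enc_unary (rev (iota 0 (m i))))))).
  by move=> i; rewrite map_rev revK.
apply: feasible_rev.
(* The list is built backwards together with its length t, which is the next number to push. *)
apply: (feasible_ext (f := fun i => stl (Pair (enc_unary (m i))
  (enc_seq (map enc_unary (rev (iota 0 (m i)))))))) => //.
apply: feasible_tl.
apply: (@feasible_iter I e m (fun i t => Pair (enc_unary t)
  (enc_seq (map enc_unary (rev (iota 0 t)))))) => //.
- exact: feasible_const.
- have c := feasible_hd (feasible_id (fun j : I * nat => Pair (Pair (enc_unary j.2)
    (enc_seq (map enc_unary (rev (iota 0 j.2))))) (e j.1))).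
  apply: feasible_pair; first exact: feasible_pair (feasible_nil _) (feasible_hd c).
  apply: feasible_ext (feasible_pair (feasible_hd c) (feasible_tl c)) => -[i t].
  by rewrite /= -[0 :: iota 1 t]/(iota 0 t.+1) -addn1 iotaD rev_cat.
- exists (fun i => sexp_size (enc_unary (m i)) * sexp_size (enc_unary (m i)) * 3 + 5); first by pbd.
  move=> i t ti; rewrite /= !size_enc_unary.
  have : all (ltn^~ (m i)) (rev (iota 0 t)).
    by apply/allP => x; rewrite mem_rev mem_iota /=; lia.
  by move/size_enc_map_unary; rewrite size_rev size_iota; nia.
Qed.

End Numbers.

(** * Sets and relations *)

(** For the edge relation of a graph this is convertible with [enc_graph]. *)
Definition enc_rel n (R : rel 'I_n) : sexp :=
  enc_seq [seq enc_set [set v | R u v] | u <- enum 'I_n].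

(** The context of a formula under one more quantifier over vertices: the bound vertex is paired in
    front, as with de Bruijn indices. Nesting [vctx] handles nested quantifiers. *)
Definition vctx I (e : I -> sexp) (n : I -> nat) (j : {i & 'I_(n i)}) : sexp :=
  Pair (enc_unary (tagged j)) (e (tag j)).
Arguments vctx {I} e n j.

Section FirstOrder.
Variables (I : Type) (e : I -> sexp) (n : I -> nat).

Lemma feasible_var : feasible (vctx e n) (fun j => enc_unary (tagged j)).
Proof. exact: feasible_hd (feasible_id (vctx e n)). Qed.

Lemma feasible_up f : feasible e f -> feasible (vctx e n) (fun j => f (tag j)).
Proof. exact: (@feasible_wk I (fun i => 'I_(n i)) (fun i v => enc_unary v) e f). Qed.

Hypothesis hn : feasible e (fun i => enc_unary (n i)).

Lemma feasible_vmap (h : forall i, 'I_(n i) -> sexp) :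
  feasible (vctx e n) (fun j => h _ (tagged j)) ->
  feasible e (fun i => enc_seq [seq h i v | v <- enum 'I_(n i)]).
Proof.
move=> hh; apply: (@feasible_map I e (fun i => 'I_(n i)) (fun i v => enc_unary v)) => //.
apply: feasible_ext (feasible_iota hn) => i.
by rewrite -val_enum_ord -map_comp.
Qed.

Lemma feasible_set (P : forall i, 'I_(n i) -> bool) :
  feasible (vctx e n) (fun j => enc_bool (P _ (tagged j))) ->
  feasible e (fun i => enc_set [set v | P i v]).
Proof.
move=> hP; apply: feasible_ext (feasible_vmap (h := fun i v => enc_bool (P i v)) hP) => i.
by congr enc_seq; apply: eq_map => v; rewrite inE.
Qed.

Lemma feasible_rel (R : forall i, rel 'I_(n i)) :
  feasible (vctx e n) (fun j => enc_set [set v | R _ (tagged j) v]) ->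
  feasible e (fun i => enc_rel (R i)).
Proof. exact: feasible_vmap. Qed.

Lemma feasible_mem (v : forall i, 'I_(n i)) (A : forall i, {set 'I_(n i)}) :
  feasible e (fun i => enc_unary (v i)) -> feasible e (fun i => enc_set (A i)) ->
  feasible e (fun i => enc_bool (v i \in A i)).
Proof.
move=> hv hA; apply: feasible_ext (feasible_nth hv hA) => i.
by rewrite (nth_map (v i)) ?size_enum_ord // nth_ord_enum.
Qed.

Lemma feasible_relapp (u v : forall i, 'I_(n i)) (R : forall i, rel 'I_(n i)) :
  feasible e (fun i => enc_unary (u i)) -> feasible e (fun i => enc_unary (v i)) ->
  feasible e (fun i => enc_rel (R i)) -> feasible e (fun i => enc_bool (R i (u i) (v i))).
Proof.
move=> hu hv hR.
have hrow : feasible e (fun i => enc_set [set w | R i (u i) w]).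
  apply: feasible_ext (feasible_nth hu hR) => i.
  by rewrite (nth_map (u i)) ?size_enum_ord // nth_ord_enum.
by apply: feasible_ext (feasible_mem hv hrow) => i; rewrite inE.
Qed.

Lemma feasible_card (A : forall i, {set 'I_(n i)}) :
  feasible e (fun i => enc_set (A i)) -> feasible e (fun i => enc_unary #|A i|).
Proof.
move=> hA; have bn := feasible_size hn.
pose F (a : nat) (b : bool) := if b then a.+1 else a.
have E a s : foldl F a s = a + count id s.
  by elim: s a => [|[] s IH] a /=; rewrite ?addn0 // IH /F; lia.
apply: (feasible_ext (f := fun i => enc_unary (foldl F 0 [seq v \in A i | v <- enum 'I_(n i)]))).
  by move=> i; rewrite E add0n count_map cardE enumT -size_filter /enum_mem.
apply: (@feasible_foldl I e (fun=> bool) (fun=> nat) (fun=> enc_bool) (fun=> enc_unary) _ (fun=> F)).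
- by apply: feasible_ext hA => i; rewrite -map_comp.
- exact: feasible_const.
- pose J := {i : I & (bool * nat)%type}.
  have c := feasible_hd (feasible_id (fun j : J =>
    Pair (Pair (enc_bool (tagged j).1) (enc_unary (tagged j).2)) (e (tag j)))).
  apply: (feasible_if_unary (b := fun j : J => (tagged j).1) (feasible_hd c) _ (feasible_tl c)).
  exact: feasible_succ (feasible_tl c).
- exists (fun i => sexp_size (enc_unary (n i))) => // i t ti.
  rewrite E !size_enc_unary add0n ltnS leq_double.
  apply: leq_trans (count_size _ _) _; rewrite size_map size_enum_ord in ti.
  by rewrite size_take_min size_map size_enum_ord geq_minr.
Qed.

Lemma feasible_exists (P : forall i, 'I_(n i) -> bool) :
  feasible (vctx e n) (fun j => enc_bool (P _ (tagged j))) ->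
  feasible e (fun i => enc_bool [exists v, P i v]).
Proof.
move=> hP; apply: feasible_ext (feasible_pos (feasible_card (feasible_set hP))) => i.
congr enc_bool; apply/card_gt0P/existsP => -[v]; rewrite ?inE => h; exists v => //.
by rewrite inE.
Qed.

Lemma feasible_forall (P : forall i, 'I_(n i) -> bool) :
  feasible (vctx e n) (fun j => enc_bool (P _ (tagged j))) ->
  feasible e (fun i => enc_bool [forall v, P i v]).
Proof.
move=> hP; apply: feasible_ext (feasible_neg (feasible_exists (P := fun i v => ~~ P i v)
  (feasible_neg hP))) => i.
by rewrite negb_exists; congr enc_bool; apply: eq_forallb => v; rewrite negbK.
Qed.

End FirstOrder.

Arguments feasible_up {I e} n {f}.
Arguments feasible_var {I} e n.

Ltac feasible_hyp :=
  match goal with H : feasible _ _ |- _ =>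
    first [ exact H | exact (feasible_up _ H) | exact (feasible_up _ (feasible_up _ H))
          | exact (feasible_up _ (feasible_up _ (feasible_up _ H))) ] end.

Ltac feasible_atom := first
  [ feasible_hyp
  | exact: feasible_var
  | exact: (feasible_up _ (feasible_var _ _))
  | exact: (feasible_up _ (feasible_up _ (feasible_var _ _))) ].

(** Follows the syntax of a first-order formula, one closure lemma per connective. Application of a
    relation needs a higher-order pattern, because the relation and both arguments depend on the
    context. *)
Ltac feasible_step := first
  [ feasible_atom
  | apply: feasible_exists | apply: feasible_forall | apply: feasible_neg
  | apply: feasible_and | apply: feasible_or | apply: feasible_imp | apply: feasible_leq
  | apply: feasible_eqn | apply: feasible_mem
  | match goal with |- feasible _ (fun j => enc_bool (?R (@?i j) (@?u j) (@?v j))) =>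
      refine (feasible_relapp (R := fun j => R (i j)) (u := u) (v := v) _ _ _) end
  | apply: feasible_card ].

Ltac feasible_tac := repeat feasible_step.

Section SetOperations.
Variables (I : Type) (e : I -> sexp) (n : I -> nat).
Hypothesis hn : feasible e (fun i => enc_unary (n i)).
Implicit Types (A B : forall i, {set 'I_(n i)}).

Lemma feasible_setU A B :
  feasible e (fun i => enc_set (A i)) -> feasible e (fun i => enc_set (B i)) ->
  feasible e (fun i => enc_set (A i :|: B i)).
Proof.
move=> hA hB; apply: (feasible_ext (f := fun i => enc_set [set v | (v \in A i) || (v \in B i)])).
  by move=> i; congr enc_set; apply/setP => v; rewrite !inE.
by apply: feasible_set => //; feasible_tac.
Qed.

Lemma feasible_setI A B :
  feasible e (fun i => enc_set (A i)) -> feasible e (fun i => enc_set (B i)) ->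
  feasible e (fun i => enc_set (A i :&: B i)).
Proof.
move=> hA hB; apply: (feasible_ext (f := fun i => enc_set [set v | (v \in A i) && (v \in B i)])).
  by move=> i; congr enc_set; apply/setP => v; rewrite !inE.
by apply: feasible_set => //; feasible_tac.
Qed.

Lemma feasible_setD A B :
  feasible e (fun i => enc_set (A i)) -> feasible e (fun i => enc_set (B i)) ->
  feasible e (fun i => enc_set (A i :\: B i)).
Proof.
move=> hA hB; apply: (feasible_ext (f := fun i => enc_set [set v | ~~ (v \in B i) && (v \in A i)])).
  by move=> i; congr enc_set; apply/setP => v; rewrite !inE.
by apply: feasible_set => //; feasible_tac.
Qed.

Lemma feasible_setT : feasible e (fun i => enc_set [set: 'I_(n i)]).
Proof. by apply: (feasible_set hn (P := fun i _ => true)); apply: feasible_const. Qed.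

Lemma feasible_set0 : feasible e (fun i => enc_set (set0 : {set 'I_(n i)})).
Proof.
apply: (feasible_ext (f := fun i => enc_set [set v : 'I_(n i) | false])).
  by move=> i; congr enc_set; apply/setP => v; rewrite !inE.
by apply: (feasible_set hn (P := fun i _ => false)); apply: feasible_const.
Qed.

Lemma feasible_set_neq0 A :
  feasible e (fun i => enc_set (A i)) -> feasible e (fun i => enc_bool (A i != set0)).
Proof.
move=> hA; apply: feasible_ext (feasible_pos (feasible_card hn hA)) => i.
by rewrite card_gt0.
Qed.

Lemma feasible_if_set (b : I -> bool) A B : feasible e (fun i => enc_bool (b i)) ->
  feasible e (fun i => enc_set (A i)) -> feasible e (fun i => enc_set (B i)) ->
  feasible e (fun i => enc_set (if b i then A i else B i)).
Proof. by move=> hb hA hB; apply: feasible_ext (feasible_if hb hA hB) => i; case: (b i). Qed.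

Lemma size_enc_set m (A : {set 'I_m}) : sexp_size (enc_set A) <= m * 4 + 1.
Proof.
rewrite /enc_set -[X in X * 4](size_enum_ord m); elim: (enum _) => //= v s.
by case: (v \in A) => /=; lia.
Qed.

Lemma size_enc_rel m (R : rel 'I_m) : sexp_size (enc_rel R) <= m * (m * 4 + 2) + 1.
Proof.
rewrite /enc_rel -[X in X * _](size_enum_ord m); elim: (enum _) => //= u s.
move=> IH; rewrite mulSn; move: (size_enc_set [set v | R u v]) IH.
by move: (sexp_size _) (sexp_size _) (size s * _) => x y z; lia.
Qed.

End SetOperations.

Section Least.
Variable n : nat.
Implicit Type A : {set 'I_n}.

(** A choice operator that returns a singleton instead of a vertex, hence needs no default when A is
    empty. It makes the algorithm deterministic and is first-order definable. *)
Definition least A : {set 'I_n} := [set v | (v \in A) && [forall u, (u \in A) ==> (v <= u)]].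

Lemma leastP A : A != set0 -> exists2 v, v \in A & least A = [set v].
Proof.
case/set0Pn => v0 vA; case: (arg_minnP (fun v : 'I_n => v : nat) vA) => v vA1 vmin.
have vA' : v \in A by [].
exists v => //; apply/setP => u; rewrite !inE; apply/idP/eqP => [/andP[uA /forallP /(_ v)]|->].
  by rewrite vA' /= => uv; apply/val_inj/eqP; rewrite eqn_leq uv vmin.
by rewrite vA' /=; apply/forallP => w; apply/implyP => /vmin.
Qed.

End Least.

Lemma feasible_least I (e : I -> sexp) (n : I -> nat) (A : forall i, {set 'I_(n i)}) :
  feasible e (fun i => enc_unary (n i)) -> feasible e (fun i => enc_set (A i)) ->
  feasible e (fun i => enc_set (least (A i))).
Proof. by move=> hn hA; apply: feasible_set => //; feasible_tac. Qed.

(** * Bipartite matching *)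

Section Matching.
Variables (n : nat) (adj : rel 'I_n) (Lf : {set 'I_n}).
Hypothesis adjLf : forall l r, adj l r -> l \in Lf.
Implicit Types (M : rel 'I_n) (D : {set 'I_n}).

(** A matching is written [M r l], right vertex first. The universal quantifier covers both ways to
    end at r: either r is free, or its partner is already in D. *)
Definition reach_next M D : {set 'I_n} :=
  [set l | [exists r, adj l r && [forall l', M r l' ==> (l' \in D)]]].

Definition unmatched M : {set 'I_n} := [set l | (l \in Lf) && ~~ [exists r, M r l]].

Definition search_step M (D : {set 'I_n} * {set 'I_n}) :=
  if D.2 :&: unmatched M != set0 then D else (D.2, reach_next M D.2).

(* The first two consecutive levels of vertices with an alternating path to a free
   right vertex such that the second level contains an unmatched vertex. *)
Definition search M := iter n (search_step M) (set0, reach_next M set0).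

Definition augment_left M := least ((search M).2 :&: unmatched M).

Definition augment_right M := least [set r | [exists l, (l \in augment_left M) && adj l r]
   && [forall l', M r l' ==> (l' \in (search M).1)]].

(** Only the first edge of an augmenting path is switched: the right vertex takes the unmatched left
    vertex and releases its old partner, if any. No path ever has to be stored. *)
Definition augment M : rel 'I_n := fun r l =>
  if r \in augment_right M then l \in augment_left M else M r l.

Definition improve M : rel 'I_n :=
  if (search M).2 :&: unmatched M != set0 then augment M else M.

(** The potential defined below starts at no more than n (n + 1) + n, which is less than the (n +
    1)^2 rounds made here. Nesting two iterations gives this number of rounds without computing a
    product. *)
Definition max_matching : rel 'I_n := iter n.+1 (iter n.+1 improve) (fun _ _ => false).

Definition deficient_set : {set 'I_n} := Lf :\: (search max_matching).2.

Record matching M : Prop := Matching {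
  matching_adj : forall r l, M r l -> adj l r;
  matching_fun : forall r l l', M r l -> M r l' -> l = l';
  matching_inj : forall r r' l, M r l -> M r' l -> r = r' }.

Definition reach_level M j := iter j (reach_next M) set0.

Lemma reach_next_mono M D D' : D \subset D' -> reach_next M D \subset reach_next M D'.
Proof.
move=> sD; apply/subsetP => l; rewrite !inE => /existsP[r /andP[lr /forallP h]].
apply/existsP; exists r; rewrite lr /=; apply/forallP => l'; apply/implyP => rl'.
by apply: (subsetP sD); apply: (implyP (h l')).
Qed.

Lemma reach_level_fix M : reach_next M (reach_level M n) = reach_level M n.
Proof.
by have := fixsetK (@reach_next_mono M); rewrite /fixset card_ord.
Qed.

Definition hits_unmatched M j := reach_level M j.+1 :&: unmatched M != set0.
(** Equals n if no level contains an unmatched vertex. Position j refers to level j + 1, as level 0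
    is empty. *)
Definition hit_level M := find (hits_unmatched M) (iota 0 n).

Lemma hit_level_le M : hit_level M <= n.
Proof. by have := find_size (hits_unmatched M) (iota 0 n); rewrite size_iota. Qed.

Lemma hit_level_before M j : j < hit_level M -> hits_unmatched M j = false.
Proof.
move=> h; have := before_find 0 h; rewrite nth_iota ?add0n //.
exact: leq_trans h (hit_level_le M).
Qed.

Lemma hit_levelP M : hit_level M < n -> hits_unmatched M (hit_level M).
Proof.
move=> h; have := @nth_find _ 0 (hits_unmatched M) (iota 0 n).
by rewrite has_find size_iota => /(_ h); rewrite nth_iota // add0n.
Qed.

Lemma hit_level_min M j : hits_unmatched M j -> hit_level M <= j.
Proof. by case: (leqP (hit_level M) j) => // /hit_level_before ->. Qed.

Lemma searchE M : search M = (reach_level M (hit_level M), reach_level M (hit_level M).+1).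
Proof.
have h j : j <= n ->
    iter j (search_step M) (set0, reach_next M set0) =
    (reach_level M (minn j (hit_level M)), reach_level M (minn j (hit_level M)).+1).
  elim: j => [|j IH] jn; first by rewrite min0n.
  rewrite iterS IH ?(ltnW jn) // /search_step /=.
  case: (leqP (hit_level M) j) => hj.
    have hl : hit_level M < n by lia.
    by rewrite (minn_idPr (leqW hj)); have := hit_levelP hl; rewrite /hits_unmatched /= => ->.
  by rewrite (minn_idPl hj); have := hit_level_before hj; rewrite /hits_unmatched /= => ->.
by rewrite /search h // (minn_idPr (hit_level_le M)).
Qed.

Definition exhausted M := (search M).2 :&: unmatched M == set0.

Lemma exhausted_fix M : exhausted M ->
  reach_next M (search M).2 = (search M).2.
Proof.
rewrite /exhausted searchE /= => h; have nh : ~~ hits_unmatched M (hit_level M) by rewrite /hits_unmatched h.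
have E : hit_level M = n.
  apply/eqP; rewrite eqn_leq hit_level_le leqNgt; apply/negP => /hit_levelP.
  exact/negP.
by rewrite E /reach_level /= -/(reach_level M n) !reach_level_fix.
Qed.

Definition matched_right M := [set r | [exists l, M r l]].
(** A lexicographic order written as one number: [hit_level] is at most n, so the weight n + 1 makes
    the number of uncovered right vertices dominate. *)
Definition matching_potential M := (n - #|matched_right M|) * n.+1 + hit_level M.

(* Either one more right vertex is matched, or the left vertex that loses its
   partner lies on a lower level than the one that gains it. *)
Lemma augmentP M : matching M -> ~~ exhausted M ->
  matching (augment M) /\ matching_potential (augment M) < matching_potential M.
Proof.
move=> [Madj Mfun Minj] nex.
have [l0 l0D El0] := leastP nex; rewrite -/(augment_left M) in El0.
move: l0D; rewrite searchE inE /= -/(reach_level M (hit_level M)) => /andP[l0D l0u].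
have l0free r : M r l0 = false.
  by move: l0u; rewrite inE => /andP[_ /existsPn /(_ r) /negbTE].
pose R := [set r | [exists l, (l \in augment_left M) && adj l r]
   && [forall l', M r l' ==> (l' \in (search M).1)]].
have R0 : R != set0.
  move: (l0D); rewrite inE => /existsP[r /andP[lr hr]].
  apply/set0Pn; exists r; rewrite inE searchE hr andbT; apply/existsP; exists l0.
  by rewrite El0 set11.
have [r0 r0R Er0] := leastP R0; rewrite -/(augment_right M) in Er0.
move: r0R; rewrite inE El0 => /andP[/existsP[l /andP[/set1P -> l0r0]] /forallP r0D].
have E r l1 : augment M r l1 = if r == r0 then l1 == l0 else M r l1.
  by rewrite /augment Er0 El0 !inE.
have mM : matching (augment M).
  split=> [r l1|r l1 l2|r r' l1]; rewrite !E.
  - by case: eqP => [->|_]; [move/eqP->|apply: Madj].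
  - by case: eqP => [_ /eqP-> /eqP->|_]; [|apply: Mfun].
  - case: (r =P r0) => [->|_]; case: (r' =P r0) => [->|_] //.
    + by move/eqP->; rewrite l0free.
    + by move=> h /eqP E1; rewrite E1 l0free in h.
    + exact: Minj.
split=> //.
have domle : #|matched_right (augment M)| <= n by rewrite -[X in _ <= X]card_ord max_card.
have domE : matched_right (augment M) = r0 |: matched_right M.
  apply/setP => r; rewrite !inE; case: (r =P r0) => [->|nr] /=.
    by apply/existsP; exists l0; rewrite E !eqxx.
  by apply: eq_existsb => l1; rewrite E; case: eqP nr.
(* If [r0] was free, one more right vertex is matched, which outweighs any growth of [hit_level]. *)
have [r0M|r0M] := boolP (r0 \in matched_right M); last first.
  move: domle; rewrite /matching_potential domE cardsU1 r0M; have := hit_level_le (augment M).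
  move: (hit_level _) (hit_level _) #|matched_right M| => a b d /=.
  move=> an dn; have -> : n - d = (n - (1 + d)).+1 by lia.
  by rewrite mulSn; lia.
rewrite /matching_potential domE (setUidPr _) ?sub1set // ltn_add2l.
move: r0M; rewrite inE => /existsP[l' r0l'].
have := implyP (r0D l') r0l'; rewrite searchE /= => l'D.
have exl : exists j, l' \in reach_level M j by exists (hit_level M).
case: (ex_minnP exl) => t l't tmin.
have tlev : t <= hit_level M by apply: tmin.
have t0 : 0 < t by case: (t) l't => //; rewrite inE.
have sub j : j <= t -> reach_level M j \subset reach_level (augment M) j.
  elim: j => [|j IH] jt; first exact: sub0set.
  apply/subsetP => x; rewrite !inE => /existsP[r /andP[xr /forallP hr]].
  apply/existsP; exists r; rewrite xr /=; apply/forallP => l2; rewrite E.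
  case: eqP => [Er|_]; last first.
    apply/implyP => rl2; apply: (subsetP (IH (ltnW jt))).
    exact: (implyP (hr l2)).
  have := implyP (hr l'); rewrite Er => /(_ r0l') /tmin; lia.
(* After the switch [l'] is unmatched and still on level t, so the new hit occurs at position t - 1,
   while t is at most the old [hit_level]. *)
apply: (@leq_trans t) => //; rewrite -(prednK t0) ltnS; apply: hit_level_min.
apply/set0Pn; exists l'; rewrite inE prednK // (subsetP (sub t (leqnn t))) //=.
rewrite inE (adjLf (Madj _ _ r0l')) /=; apply/existsPn => r; rewrite E.
case: eqP => [_|nr]; last by apply/negP => /(Minj _ _ _ r0l') /esym.
by apply/negP => /eqP El; rewrite El l0free in r0l'.
Qed.

Lemma max_matchingP : matching max_matching /\ exhausted max_matching.
Proof.
rewrite /max_matching -iterM.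
have h p M : matching M -> matching_potential M <= p ->
    matching (iter p improve M) /\ exhausted (iter p improve M).
  elim: p M => [|p IH] M mM hp.
    split=> //; case: (boolP (exhausted M)) => // nex.
    by have [_] := augmentP mM nex; lia.
  rewrite iterSr; case: (boolP (exhausted M)) => [ex|nex].
    have E : improve M = M by rewrite /improve; move: ex; rewrite /exhausted => ->.
    rewrite E; suff -> : iter p improve M = M by [].
    by elim: (p) => //= q ->.
  have [mA pA] := augmentP mM nex.
  by rewrite /improve ifT //; apply: IH => //; lia.
apply: h; first by split.
by rewrite /matching_potential; have := hit_level_le (fun _ _ => false); nia.
Qed.

Definition bnbr (P : {set 'I_n}) := [set r | [exists l, (l \in P) && adj l r]].

(* The neighbours of the deficient set are matched into it, and every matched
   vertex of P has its partner in bnbr P. *)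
Lemma deficient_set_max (P : {set 'I_n}) : P \subset Lf ->
  #|P| + #|bnbr deficient_set| <= #|deficient_set| + #|bnbr P|.
Proof.
move=> sP; have [[Madj Mfun Minj] ex] := max_matchingP.
have fixD := exhausted_fix ex; move: ex fixD; rewrite /deficient_set.
set M := max_matching in Madj Mfun Minj *; set D := (search M).2 => ex fixD.
set Q := Lf :\: D; set U := unmatched M.
have sUQ : U \subset Q.
  apply/subsetP => l lU; rewrite inE; move: (lU); rewrite inE => /andP[-> _]; rewrite andbT.
  apply/negP => lD; move/eqP/setP/(_ l): ex; rewrite in_setI in_set0.
  by rewrite -/D -/M lD lU.
pose f r := odflt r [pick l | M r l].
have fP r l : M r l -> f r = l.
  rewrite /f; case: pickP => [l' rl' rl|/(_ l) -> //]; exact: Mfun rl' rl.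
pose g l := odflt l [pick r | M r l].
have gP r l : M r l -> g l = r.
  rewrite /g; case: pickP => [r' r'l rl|/(_ r) -> //]; exact: Minj r'l rl.
have h1 : #|bnbr Q| <= #|Q :\: U|.
  have part r : r \in bnbr Q -> exists2 l, M r l & l \in Q :\: U.
    rewrite inE => /existsP[l /andP[]]; rewrite inE => /andP[lD lL] lr.
    (* Were every partner of r in D, the fixed point equation would put l into D as well. *)
    have : ~~ [forall l', M r l' ==> (l' \in D)].
      apply: contra lD => h; rewrite -fixD inE; apply/existsP; exists r.
      by rewrite lr.
    rewrite negb_forall => /existsP[l']; rewrite negb_imply => /andP[rl' l'D].
    exists l' => //; rewrite !inE l'D (adjLf (Madj _ _ rl')) /= andbT negbK.
    by apply/existsP; exists r.
  rewrite -(card_in_imset (f := f) (D := bnbr Q)); last first.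
    move=> r r' /part[l rl _] /part[l' rl' _]; rewrite (fP _ _ rl) (fP _ _ rl') => El.
    by apply: Minj rl _; rewrite El.
  apply: subset_leq_card; apply/subsetP => x /imsetP[r /part[l rl lQ] ->].
  by rewrite (fP _ _ rl).
have h2 : #|P :\: U| <= #|bnbr P|.
  have part l : l \in P :\: U -> exists2 r, M r l & r \in bnbr P.
    rewrite 2!inE => /andP[lU lP]; move: lU; rewrite (subsetP sP _ lP) /= negbK.
    case/existsP => r rl; exists r => //; rewrite inE; apply/existsP; exists l.
    by rewrite lP (Madj _ _ rl).
  rewrite -(card_in_imset (f := g) (D := P :\: U)); last first.
    move=> l l' /part[r rl _] /part[r' rl' _]; rewrite (gP _ _ rl) (gP _ _ rl') => Er.
    by apply: Mfun rl _; rewrite Er.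
  apply: subset_leq_card; apply/subsetP => x /imsetP[l /part[r rl rP] ->].
  by rewrite (gP _ _ rl).
(* Altogether #|P| - #|N(P)| is at most #|P :&: U|, hence at most #|U|, and #|U| = #|Q| - #|Q :\: U|
   is at most #|Q| - #|N(Q)|. *)
have := cardsID U P; have := cardsID U Q; rewrite (setIidPr sUQ).
have := subset_leq_card (subsetIr P U); lia.
Qed.

End Matching.

(** * Minimum vertex cuts *)

Section Cut.
Variables (n : nat) (E : rel 'I_n) (C A B : {set 'I_n}).

(** Every vertex has a left copy, its candidacy for P, and a right copy, its cost as a member of the
    closed neighbourhood; the diagonal makes the neighbourhood closed. Vertices of B may not enter
    P, and vertices of A have no right copy because they are counted in any case. Equality is taken
    on nat to match the unary encoding. *)
Definition cut_adj : rel 'I_n :=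
  fun l r => ((l \in C) && ~~ (l \in B)) && (((r \in C) && ~~ (r \in A)) && ((l == r :> nat) || E l r)).

Definition cut_side : {set 'I_n} := deficient_set cut_adj (C :\: B).

Definition cut_closure (P : {set 'I_n}) : {set 'I_n} :=
  [set v | (v \in C) && ((v \in P) || [exists u, (u \in P) && E u v])].

Definition cut_boundary (P : {set 'I_n}) : {set 'I_n} := (A :|: cut_closure P) :\: P.

Lemma cut_side_sub : cut_side \subset C :\: B.
Proof. exact: subsetDl. Qed.

(** Both sides count A together with the closed neighbourhood of P, split once along P and once
    along A. Hence a smallest boundary is the same as a largest #|P| - #|bnbr cut_adj P|. *)
Lemma card_cut_boundary (P : {set 'I_n}) : A \subset C -> P \subset C :\: B ->
  #|cut_boundary P| + #|P| = #|A| + #|bnbr cut_adj P|.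
Proof.
move=> sA sP; set N := cut_closure P.
have sPN : P \subset A :|: N.
  apply/subsetP => v vP; rewrite !inE vP andbT; have := subsetP sP _ vP.
  by rewrite inE => /andP[_ ->]; rewrite orbT.
have EN : bnbr cut_adj P = N :\: A.
  apply/setP => r; rewrite !inE; apply/existsP/idP.
    case=> l /andP[lP /andP[_ /andP[/andP[-> ->]]]] /=.
    case/orP => [/eqP/val_inj <-|lr]; first by rewrite lP.
    by apply/orP; right; apply/existsP; exists l; rewrite lP.
  case/andP => rA /andP[rC]; case/orP => [rP|/existsP[l /andP[lP lr]]].
    exists r; rewrite rP /cut_adj rC rA eqxx /=.
    by have := subsetP sP _ rP; rewrite inE => /andP[-> _].
  exists l; rewrite lP /cut_adj rC rA lr orbT.
  by have := subsetP sP _ lP; rewrite inE => /andP[-> ->].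
have h1 := cardsID A (A :|: N); have h2 := cardsID P (A :|: N).
move: h1 h2; rewrite (setIidPr sPN) (setIidPr (subsetUl A N)) setDUl setDv set0U EN.
by rewrite /cut_boundary -/N => h1 h2; rewrite addnC h2 h1.
Qed.

Lemma cut_side_min (P : {set 'I_n}) : A \subset C -> P \subset C :\: B ->
  #|cut_boundary cut_side| <= #|cut_boundary P|.
Proof.
move=> sA sP; have h1 := card_cut_boundary sA sP.
have h2 := card_cut_boundary sA cut_side_sub.
have adjL l r : cut_adj l r -> l \in C :\: B.
  by case/andP => /andP[lC lB] _; rewrite inE lB lC.
by have := deficient_set_max adjL sP; rewrite -/cut_side; lia.
Qed.

End Cut.

(** * Computing minimum vertex cuts in polynomial time *)

Section CutFeasible.
Variables (I : Type) (e : I -> sexp) (n : I -> nat).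
Hypothesis hn : feasible e (fun i => enc_unary (n i)).

Lemma pbounded_vertices : pbounded (sexp_size \o e) n.
Proof.
by apply: pbounded_le (feasible_size hn) => i /=; rewrite size_enc_unary; lia.
Qed.

Lemma feasible_iter_rel (m : I -> nat) (F : forall i, rel 'I_(n i) -> rel 'I_(n i))
    (R : forall i, rel 'I_(n i)) :
  feasible e (fun i => enc_unary (m i)) -> feasible e (fun i => enc_rel (R i)) ->
  feasible (fun j : {i & rel 'I_(n i)} => Pair (enc_rel (tagged j)) (e (tag j)))
    (fun j => enc_rel (F _ (tagged j))) ->
  feasible e (fun i => enc_rel (iter (m i) (F i) (R i))).
Proof.
move=> hm hR hF; apply: (feasible_iter_bounded (A := fun i => rel 'I_(n i))
  (ea := fun i => @enc_rel (n i))) => //.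
have bn := pbounded_vertices.
exists (fun i => n i * (n i * 4 + 2) + 1); first by pbd.
by move=> i a; apply: size_enc_rel.
Qed.

Lemma feasible_if_rel (b : I -> bool) (R R' : forall i, rel 'I_(n i)) :
  feasible e (fun i => enc_bool (b i)) ->
  feasible e (fun i => enc_rel (R i)) -> feasible e (fun i => enc_rel (R' i)) ->
  feasible e (fun i => enc_rel (if b i then R i else R' i)).
Proof. by move=> hb hR hR'; apply: feasible_ext (feasible_if hb hR hR') => i; case: (b i). Qed.

Variables (adj M : forall i, rel 'I_(n i)) (Lf D : forall i, {set 'I_(n i)}).
Arguments adj : clear implicits.
Arguments M : clear implicits.
Hypothesis hadj : feasible e (fun i => enc_rel (adj i)).
Hypothesis hM : feasible e (fun i => enc_rel (M i)).
Hypothesis hLf : feasible e (fun i => enc_set (Lf i)).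
Hypothesis hD : feasible e (fun i => enc_set (D i)).

Lemma feasible_reach_next : feasible e (fun i => enc_set (reach_next (adj i) (M i) (D i))).
Proof. by apply: feasible_set => //; feasible_tac. Qed.

Lemma feasible_unmatched : feasible e (fun i => enc_set (unmatched (Lf i) (M i))).
Proof. by apply: feasible_set => //; feasible_tac. Qed.

End CutFeasible.

Section MatchingFeasible.
Variables (I : Type) (e : I -> sexp) (n : I -> nat).
Hypothesis hn : feasible e (fun i => enc_unary (n i)).
Variables (adj M : forall i, rel 'I_(n i)) (Lf : forall i, {set 'I_(n i)}).
Arguments adj : clear implicits.
Arguments M : clear implicits.
Hypothesis hadj : feasible e (fun i => enc_rel (adj i)).
Hypothesis hM : feasible e (fun i => enc_rel (M i)).
Hypothesis hLf : feasible e (fun i => enc_set (Lf i)).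

Let enc_sets i (D : {set 'I_(n i)} * {set 'I_(n i)}) := Pair (enc_set D.1) (enc_set D.2).

Lemma feasible_search : feasible e (fun i => enc_sets (search (adj i) (Lf i) (M i))).
Proof.
have h0 := feasible_set0 hn.
apply: (feasible_iter_bounded (A := fun i => ({set 'I_(n i)} * {set 'I_(n i)})%type)
  (ea := enc_sets) (F := fun i => search_step (adj i) (Lf i) (M i))) => //.
- by apply: feasible_pair => //; apply: feasible_reach_next.
- set e' := fun j : {i & ({set 'I_(n i)} * {set 'I_(n i)})%type} => _.
  have wk f (hf : feasible e f) : feasible e' (fun j => f (tag j)) := feasible_wk _ hf.
  have c1 := feasible_hd (feasible_hd (feasible_id e') : feasible e' (fun j => enc_sets (tagged j))).
  have c2 := feasible_tl (feasible_hd (feasible_id e') : feasible e' (fun j => enc_sets (tagged j))).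
  have wn := wk _ hn; have wa := wk _ hadj; have wM := wk _ hM; have wL := wk _ hLf.
  have wu := feasible_unmatched wn wM wL.
  have wr := feasible_reach_next wn wa wM c2.
  have wb := feasible_set_neq0 wn (feasible_setI wn c2 wu).
  apply: feasible_ext (feasible_if wb (feasible_pair c1 c2) (feasible_pair c2 wr)) => j.
  by rewrite /search_step; case: ifP.
- have bn := pbounded_vertices hn.
  exists (fun i => n i * 8 + 3); first by pbd.
  move=> i D /=; have := size_enc_set D.1; have := size_enc_set D.2; lia.
Qed.

Lemma feasible_improve : feasible e (fun i => enc_rel (improve (adj i) (Lf i) (M i))).
Proof.
have hs1 := feasible_hd feasible_search; have hs2 := feasible_tl feasible_search.
rewrite /= in hs1 hs2.
have hu := feasible_unmatched hn hM hLf.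
have hi := feasible_setI hn hs2 hu.
have hl := feasible_least hn hi.
have hr : feasible e (fun i => enc_set (augment_right (adj i) (Lf i) (M i))).
  by apply: feasible_least => //; apply: feasible_set => //; feasible_tac.
apply: feasible_if_rel => //; first exact: feasible_set_neq0.
apply: feasible_rel => //; apply: (feasible_set (feasible_up _ hn)).
by apply: feasible_if_bool; feasible_tac.
Qed.

End MatchingFeasible.

Lemma feasible_cut_side I (e : I -> sexp) (n : I -> nat) (E : forall i, rel 'I_(n i))
    (C A B : forall i, {set 'I_(n i)}) :
  feasible e (fun i => enc_unary (n i)) -> feasible e (fun i => enc_rel (E i)) ->
  feasible e (fun i => enc_set (C i)) -> feasible e (fun i => enc_set (A i)) ->
  feasible e (fun i => enc_set (B i)) ->
  feasible e (fun i => enc_set (cut_side (E i) (C i) (A i) (B i))).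
Proof.
move=> hn hE hC hA hB.
have hadj : feasible e (fun i => enc_rel (cut_adj (E i) (C i) (A i) (B i))).
  apply: feasible_rel => //; apply: (feasible_set (feasible_up _ hn)).
  by feasible_tac.
have hL := feasible_setD hn hC hB.
have hm : feasible e (fun i => enc_rel (max_matching (cut_adj (E i) (C i) (A i) (B i)) (C i :\: B i))).
  have h1 := feasible_succ hn.
  apply: feasible_iter_rel => //.
    apply: feasible_rel => //; apply: (feasible_set (feasible_up _ hn)).
    exact: feasible_const.
  set e' := fun j : {i & rel 'I_(n i)} => _.
  have wk f (hf : feasible e f) : feasible e' (fun j => f (tag j)) :=
    @feasible_wk I (fun i => rel 'I_(n i)) (fun i => @enc_rel (n i)) e f hf.
  apply: (feasible_iter_rel (wk _ hn) (wk _ h1)).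
    exact: feasible_hd (feasible_id e').
  set e2 := fun j : {j : {i & rel 'I_(n i)} & rel 'I_(n (tag j))} => _.
  have wk2 f (hf : feasible e' f) : feasible e2 (fun j => f (tag j)) :=
    @feasible_wk _ (fun j => rel 'I_(n (tag j))) (fun j => @enc_rel (n (tag j))) e' f hf.
  apply: (feasible_improve (wk2 _ (wk _ hn)) (wk2 _ (wk _ hadj)) _ (wk2 _ (wk _ hL))).
  exact: feasible_hd (feasible_id e2).
apply: feasible_setD => //.
exact: feasible_tl (feasible_search hn hadj hm hL).
Qed.

Lemma feasible_cut_boundary I (e : I -> sexp) (n : I -> nat) (E : forall i, rel 'I_(n i))
    (C A P : forall i, {set 'I_(n i)}) :
  feasible e (fun i => enc_unary (n i)) -> feasible e (fun i => enc_rel (E i)) ->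
  feasible e (fun i => enc_set (C i)) -> feasible e (fun i => enc_set (A i)) ->
  feasible e (fun i => enc_set (P i)) ->
  feasible e (fun i => enc_set (cut_boundary (E i) (C i) (A i) (P i))).
Proof.
move=> hn hE hC hA hP.
have hcl : feasible e (fun i => enc_set (cut_closure (E i) (C i) (P i))).
  by apply: feasible_set => //; feasible_tac.
by apply: feasible_setD => //; apply: feasible_setU.
Qed.

(** * Partial decompositions *)

(* An item (C, S, p) asks for a decomposition of G[C :|: S] hanging below the
   node p, whose bag contains S. *)
Definition item n := ({set 'I_n} * {set 'I_n} * nat)%type.

(** Nodes are stored in order of creation with the position of their parent, so parents precede
    children. [guess] is the counter of attempts for the first item only. *)
Record work n := Work {
  nodes : seq (nat * {set 'I_n});
  lpart : {set 'I_n};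
  items : seq (item n);
  guess : seq bool }.

Section Work.
Variables (n : nat) (G : sgraph 'I_n) (K : {set 'I_n}) (k : nat).
Implicit Types (w : work n) (C S Y L : {set 'I_n}) (g : seq bool).

(** One bit for the kind of split and two bits for each of the 4k + 4 vertices of S. *)
Definition guess_size := 8 * k + 9.
Definition sep_size := 4 * k + 4.

Definition bag_of w j := (nth (0, set0) (nodes w) j).2.
Definition par_of w j := (nth (0, set0) (nodes w) j).1.

(** Empty tasks are dropped, so every item owns an uncovered vertex and the list never has more than
    n items. *)
Definition add_item C S p (its : seq (item n)) :=
  if C != set0 then (C, S, p) :: its else its.

Definition emit w C S p Y L C1 S1 C2 S2 (rest : seq (item n)) :=
  Work (rcons (nodes w) (p, S :|: Y)) (lpart w :|: L)
    (add_item C1 S1 (size (nodes w)) (add_item C2 S2 (size (nodes w)) rest))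
    (nseq guess_size false).

Definition covered w : {set 'I_n} := [set v | has (fun x : nat * {set 'I_n} => v \in x.2) (nodes w)].

(** The larger bound is affordable when C avoids K, because the item is then closed at once by a
    leaf whose bag counts only S towards the width. *)
Definition small S C : Prop :=
  #|S| <= sep_size \/ (C :&: K = set0 /\ #|S| <= 5 * k + 5).

Record item_ok w (it : item n) : Prop := ItemOk {
  item_neq0 : it.1.1 != set0;
  item_par : it.2 < size (nodes w);
  item_sub : it.1.2 \subset bag_of w it.2;
  item_free : [disjoint bag_of w it.2 & lpart w];
  item_nbr : forall u v, u \in it.1.1 -> edge G u v -> v \in it.1.1 :|: it.1.2;
  item_small : small it.1.2 it.1.1 }.

(** [work_top] expresses connectedness locally: each vertex enters the tree at one node only. The
    root is its own parent, so a vertex of its bag would never enter; this is why the root has an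
    empty bag, and why there is one node more than vertices. [work_count] says that the sets C of
    the items partition the uncovered vertices, and [work_leaf] that a bag containing a vertex of
    the L-part never acquires children. *)
Record work_ok w : Prop := WorkOk {
  work_root : size (nodes w) > 0 /\ nth (0, set0) (nodes w) 0 = (0, set0);
  work_par : forall j, 0 < j < size (nodes w) -> par_of w j < j;
  work_width : forall j, #|bag_of w j :\: lpart w| <= 5 * k + 6;
  work_items : forall it, it \in items w -> item_ok w it;
  work_count : forall v, count (fun it : item n => v \in it.1.1) (items w) = (v \notin covered w);
  work_edge : forall u v, u \in covered w -> v \in covered w -> edge G u v ->
    exists j, (u \in bag_of w j) && (v \in bag_of w j);
  work_top : forall v j j', v \in bag_of w j -> v \notin bag_of w (par_of w j) ->
    v \in bag_of w j' -> v \notin bag_of w (par_of w j') -> j = j';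
  work_leaf : forall j, j < size (nodes w) -> [disjoint bag_of w (par_of w j) & lpart w];
  work_lcov : lpart w \subset covered w;
  work_lone : forall v j j', v \in lpart w -> v \in bag_of w j -> v \in bag_of w j' -> j = j';
  work_lK : lpart w :&: K = set0;
  work_size : size (nodes w) <= #|covered w|.+1 }.

Lemma bag_lt w v j : v \in bag_of w j -> j < size (nodes w).
Proof.
by rewrite /bag_of; case: ltnP => // h; rewrite nth_default //= inE.
Qed.

Lemma coveredP w v : reflect (exists j, v \in bag_of w j) (v \in covered w).
Proof.
rewrite inE; apply: (iffP (has_nthP (0, set0))) => [[j _ h]|[j h]]; exists j => //.
exact: bag_lt h.
Qed.

Lemma par_lt w j : work_ok w -> par_of w j < size (nodes w).
Proof.
move=> wok; have [s0 r0] := work_root wok.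
case: (ltnP j (size (nodes w))) => h; last by rewrite /par_of nth_default.
case: j h => [|j] h; first by rewrite /par_of r0.
exact: ltn_trans (work_par wok (j := j.+1) h) h.
Qed.

Lemma item_disjoint w it v : work_ok w -> it \in items w -> v \in it.1.1 -> v \notin covered w.
Proof.
move=> wok itw vit; have := work_count wok v; case: (v \in covered w) => // h.
have : has (fun it : item n => v \in it.1.1) (items w) by apply/hasP; exists it.
by rewrite has_count h.
Qed.

Section Emit.
Variables (w : work n) (C S : {set 'I_n}) (p : nat) (rest : seq (item n)).
Variables (Y L C1 S1 C2 S2 : {set 'I_n}).
Hypothesis wok : work_ok w.
Hypothesis w_items : items w = (C, S, p) :: rest.
Hypothesis Y_neq0 : Y != set0.
Hypothesis Y_sub : Y \subset C.
Hypothesis L_sub : L \subset Y.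
Hypothesis L_K : L :&: K = set0.
Hypothesis L_child : L = set0 \/ (C1 = set0 /\ C2 = set0).
Hypothesis bag_small : #|(S :|: Y) :\: L| <= 5 * k + 6.
(** As an equation between numbers this says that [C1] and [C2] are disjoint and that together they
    are the rest of C, in the form in which [work_count] consumes it. *)
Hypothesis children : forall v, (v \in C1) + (v \in C2) = (v \in C :\: Y).
Hypothesis S1_sub : S1 \subset S :|: Y.
Hypothesis S2_sub : S2 \subset S :|: Y.
Hypothesis C1_nbr : forall u v, u \in C1 -> edge G u v -> v \in C1 :|: S1.
Hypothesis C2_nbr : forall u v, u \in C2 -> edge G u v -> v \in C2 :|: S2.
Hypothesis S1_small : small S1 C1.
Hypothesis S2_small : small S2 C2.

Let w' := emit w C S p Y L C1 S1 C2 S2 rest.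
Let q := size (nodes w).

Let itw : (C, S, p) \in items w. Proof. by rewrite w_items mem_head. Qed.
Let iok : item_ok w (C, S, p). Proof. exact (work_items wok itw). Qed.
Let Ccov v : v \in C -> v \notin covered w. Proof. exact (item_disjoint wok itw). Qed.
Let pq : p < q. Proof. exact (item_par iok). Qed.

Let bagE j : bag_of w' j = if j == q then S :|: Y else bag_of w j.
Proof.
rewrite /bag_of /= nth_rcons -/q; case: ltngtP => //= h.
by rewrite nth_default // ltnW.
Qed.

Let parE j : par_of w' j = if j == q then p else par_of w j.
Proof.
rewrite /par_of /= nth_rcons -/q; case: ltngtP => //= h.
by rewrite nth_default // ltnW.
Qed.

Let bag_old j : j < q -> bag_of w' j = bag_of w j.
Proof. by move=> h; rewrite bagE ltn_eqF. Qed.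

Let Scov v : v \in S -> v \in covered w.
Proof. by move=> h; apply/coveredP; exists p; apply: (subsetP (item_sub iok)). Qed.

Let covE v : (v \in covered w') = (v \in covered w) || (v \in Y).
Proof.
have := @Scov v; rewrite [v \in covered w]inE [LHS]inE /= has_rcons /= in_setU.
by case: (v \in S) => [/(_ isT) ->|_]; rewrite /= ?orbT // orbC.
Qed.

Let SL v : v \in S -> v \notin lpart w.
Proof.
move=> vS; have := item_free iok; rewrite /= disjoint_sym => /disjointFl ->//.
by apply: (subsetP (item_sub iok)).
Qed.

Let CL v : v \in C -> v \notin lpart w.
Proof. by move=> vC; apply: contra (Ccov vC); apply: (subsetP (work_lcov wok)). Qed.

Let YC v : v \in Y -> v \in C. Proof. exact: (subsetP Y_sub). Qed.
Let LY v : v \in L -> v \in Y. Proof. exact: (subsetP L_sub). Qed.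

Let disj_old j : [disjoint bag_of w j & lpart w] -> [disjoint bag_of w j & lpart w :|: L].
Proof.
move=> h; rewrite disjoint_subset; apply/subsetP => v vj; rewrite !inE negb_or.
rewrite (disjointFr h vj) /=; apply/negP => /LY/YC/Ccov/negP; apply.
by apply/coveredP; exists j.
Qed.

Lemma mem_add_item C0 S0 p0 (its : seq (item n)) it :
  it \in add_item C0 S0 p0 its -> (C0 != set0 /\ it = (C0, S0, p0)) \/ it \in its.
Proof.
rewrite /add_item; case: ifP => [h|_]; last by right.
by rewrite inE => /orP[/eqP->|]; [left|right].
Qed.

Lemma count_add_item C0 S0 p0 (its : seq (item n)) v :
  count (fun it : item n => v \in it.1.1) (add_item C0 S0 p0 its) =
  (v \in C0) + count (fun it : item n => v \in it.1.1) its.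
Proof. by rewrite /add_item; case: eqP => [->|//]; rewrite inE. Qed.

Let child_ok C0 S0 : C0 != set0 -> L = set0 -> S0 \subset S :|: Y ->
  (forall u v, u \in C0 -> edge G u v -> v \in C0 :|: S0) -> small S0 C0 ->
  item_ok w' (C0, S0, q).
Proof.
move=> C0n L0 sS0 nbr sm; split=> //=.
- by rewrite size_rcons.
- by rewrite bagE eqxx.
- rewrite bagE eqxx L0 setU0 disjoint_subset; apply/subsetP => v.
  by rewrite !inE => /orP[/SL|/YC/CL].
Qed.

Lemma emit_ok : work_ok w'.
Proof.
have [s0 r0] := work_root wok.
split.
- by split; rewrite /= ?size_rcons // nth_rcons s0.
- move=> j; rewrite /= size_rcons ltnS -/q => /andP[j0 jq]; rewrite parE.
  case: eqP => [-> //|/eqP nj]; apply: work_par => //.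
  by rewrite j0 ltn_neqAle nj.
- move=> j; rewrite bagE /=; case: eqP => _.
    apply: leq_trans bag_small; apply: subset_leq_card; apply: setDS; exact: subsetUr.
  apply: leq_trans (work_width wok j); apply: subset_leq_card; apply: setDS; exact: subsetUl.
- move=> it /= /mem_add_item[[n1 ->]|/mem_add_item[[n2 ->]|itr]].
  + apply: child_ok => //; case: L_child => // -[E _].
    by rewrite E eqxx in n1.
  + apply: child_ok => //; case: L_child => // -[_ E].
    by rewrite E eqxx in n2.
  + have itw' : it \in items w by rewrite w_items inE itr orbT.
    have [h1 h2 h3 h4 h5 h6] := work_items wok itw'.
    split=> //=; first by rewrite size_rcons ltnW.
      by rewrite bag_old.
    by rewrite bag_old //; apply: disj_old.
- move=> v; rewrite /= !count_add_item addnA children covE.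
  have := work_count wok v; rewrite w_items /=.
  case: (boolP (v \in Y)) => [vY|vY].
    by rewrite in_setD vY /= orbT (YC vY) (negbTE (Ccov (YC vY))); lia.
  by rewrite in_setD vY orbF.
- have old u v : u \in covered w -> v \in covered w -> edge G u v ->
      exists j, (u \in bag_of w' j) && (v \in bag_of w' j).
    move=> hu hv /(work_edge wok hu hv)[j /andP[uj vj]]; exists j.
    by rewrite bag_old ?uj ?vj //; apply: bag_lt uj.
  (* A neighbour of u lies in C or in S. If it is covered and in C, then it is in Y, since no vertex
     of C was covered before; so the new bag contains the edge. *)
  have new u v : u \in Y -> v \in covered w' -> edge G u v ->
      exists j, (u \in bag_of w' j) && (v \in bag_of w' j).
    move=> uY vc uv; exists q; rewrite bagE eqxx !inE uY orbT /=.
    have := item_nbr iok (YC uY) uv; rewrite !inE => /orP[vC|->] //.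
    by move: vc; rewrite covE (negbTE (Ccov vC)) /= => ->; rewrite orbT.
  move=> u v; rewrite [u \in _]covE => /orP[hu|hu] hv uv; last exact: new.
  move: (hv); rewrite covE => /orP[hv'|hv']; first exact: old.
  have [||j /andP[vj uj]] := new v u hv'; last by exists j; rewrite uj.
    by rewrite covE hu.
  by rewrite edge_sym.
(* Since S lies in the parent bag, the vertices that enter at the new node are those of Y, and they
   occur in no older bag. *)
- have topq v j : v \in bag_of w' j -> v \notin bag_of w' (par_of w' j) ->
      if j == q then v \in Y else (v \in bag_of w j) && (v \notin bag_of w (par_of w j)).
    rewrite [bag_of w' j]bagE parE; case: eqP => [_|_].
      rewrite bag_old // inE => /orP[vS|//] /negP[].
      by apply: (subsetP (item_sub iok)).
    by rewrite bag_old ?par_lt // => -> ->.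
  move=> v j j' vj tj vj' tj'; have := topq _ _ vj tj; have := topq _ _ vj' tj'.
  case: eqP => [->|_]; case: eqP => [->|_] //.
  + by move=> /YC/Ccov/negP h /andP[vj0 _]; case: h; apply/coveredP; exists j.
  + by move=> /andP[vj0 _] /YC/Ccov/negP []; apply/coveredP; exists j'.
  + by move=> /andP[a b] /andP[c d]; apply: work_top wok _ _ _ c d a b.
- move=> j; rewrite /= size_rcons ltnS -/q parE => jq.
  case: eqP => [_|nj]; first by rewrite bag_old //; apply: disj_old; apply: item_free iok.
  rewrite bag_old ?par_lt //; apply: disj_old; apply: work_leaf => //; rewrite -/q; lia.
- apply/subsetP => v; rewrite /= inE covE => /orP[/(subsetP (work_lcov wok))->//|/LY->].
  by rewrite orbT.
- move=> v j j'; rewrite [lpart w']/= inE => /orP[vL|vL].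
    have nq i : v \in bag_of w' i -> v \in bag_of w i.
      rewrite bagE; case: (i == q) => //; rewrite inE => /orP[/SL|/YC/CL]; by rewrite vL.
    by move=> /nq vj /nq; apply: (work_lone wok).
  have nq i : v \in bag_of w' i -> i = q.
    rewrite bagE; case: (i =P q) => // _ vi; have /negP[] := Ccov (YC (LY vL)).
    by apply/coveredP; exists i.
  by move=> /nq -> /nq ->.
- by rewrite /= setIUl L_K setU0 (work_lK wok).
- rewrite /= size_rcons; apply: leq_ltn_trans (work_size wok) _; rewrite ltnS.
  apply: proper_card; rewrite properEneq; apply/andP; split; last first.
    by apply/subsetP => v; rewrite covE => ->.
  have /set0Pn[v vY] := Y_neq0; apply/eqP => /setP/(_ v); rewrite covE vY orbT.
  by apply/negP; apply: Ccov; apply: YC.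
Qed.

Lemma emit_covered : #|covered w| < #|covered w'|.
Proof.
apply: proper_card; rewrite properEneq; apply/andP; split; last first.
  by apply/subsetP => v; rewrite covE => ->.
have /set0Pn[v vY] := Y_neq0; apply/eqP => /setP/(_ v); rewrite covE vY orbT.
by apply/negP; apply: Ccov; apply: YC.
Qed.

End Emit.

Definition init_work :=
  Work [:: (0, set0)] set0 (add_item setT set0 0 [::]) (nseq guess_size false).

Lemma init_ok : work_ok init_work.
Proof.
have b0 j : bag_of init_work j = set0 by rewrite /bag_of; case: j => [|[|j]].
have c0 : covered init_work = set0 by apply/setP => v; rewrite in_set0 inE /= in_set0.
split=> //.
- by case=> [|[|j]].
- by move=> j; rewrite b0 set0D cards0.
- move=> it /mem_add_item[[nT ->]|//]; split=> //=; rewrite ?b0 ?sub0set //.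
  + by rewrite disjoint_subset; apply/subsetP => v; rewrite inE.
  + by move=> u v _ _; rewrite inE in_setT.
  + by left; rewrite cards0.
- by move=> v; rewrite count_add_item in_setT c0 inE.
- by move=> u v; rewrite c0 inE.
- by move=> v j j'; rewrite b0 inE.
- by move=> j _; rewrite b0 disjoint_subset; apply/subsetP => v; rewrite inE.
- by rewrite sub0set.
- by move=> v j j'; rewrite inE.
- by rewrite set0I.
Qed.

End Work.

(** * Complete decompositions and balanced separators *)

Section FinalDecomposition.
Variables (n : nat) (G : sgraph 'I_n) (K : {set 'I_n}) (k : nat) (w : work n).
Hypothesis wok : work_ok G K k w.
Hypothesis no_items : items w = [::].

Let m := size (nodes w).
Let m_gt0 : 0 < m. Proof. by case: (work_root wok). Qed.

Definition out_parent (x : 'I_m) : 'I_m := Ordinal (par_lt x wok).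
Definition out_root : 'I_m := Ordinal m_gt0.

Lemma out_parent_lt x : x != out_root -> out_parent x < x.
Proof.
move=> xr; apply: (work_par wok); rewrite ltn_ord andbT lt0n.
by apply: contra xr => /eqP h; apply/eqP/val_inj.
Qed.

Lemma out_parent_root : out_parent out_root = out_root.
Proof. by apply: val_inj; case: (work_root wok) => _ h; rewrite /= /par_of h. Qed.

Lemma out_parent_to_root x : exists i, iter i out_parent x = out_root.
Proof.
have [N] := ubnP (x : nat); elim: N x => // N IH x xN.
have [->|xr] := eqVneq x out_root; first by exists 0.
have [|i hi] := IH (out_parent x); first by have := out_parent_lt xr; lia.
by exists i.+1; rewrite iterSr.
Qed.

Definition out_tree := RTree out_parent_root out_parent_to_root.
Definition out_triple := Triple out_tree (fun x : 'I_m => bag_of w x) (lpart w).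

Lemma all_covered v : v \in covered w.
Proof. by have := work_count wok v; rewrite no_items /=; case: (v \in _). Qed.

Lemma bag_root0 v : v \in bag_of w 0 = false.
Proof. by case: (work_root wok) => _ h; rewrite /bag_of h inE. Qed.

Lemma out_subtree v : subtree out_tree [set x : 'I_m | v \in bag_of w x].
Proof.
have [j vj] := coveredP _ _ (all_covered v).
have inN i (vi : v \in bag_of w i) : i < m := bag_lt vi.
split; first by apply/set0Pn; exists (Ordinal (inN j vj)); rewrite inE.
set S := [set x : 'I_m | v \in bag_of w x]; set r := [rel a b | _].
have rsym : symmetric r.
  by move=> a b; rewrite /r /= /tree_adj andbCA eq_sym orbC.
(* Climbing from any bag that contains v ends at a node where v enters; by [work_top] it is the same
   node for all starting points. *)
have top (x : 'I_m) : x \in S -> exists t : 'I_m,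
    [/\ v \in bag_of w t, v \notin bag_of w (par_of w t) & connect r x t].
  have [N] := ubnP (x : nat); elim: N x => // N IH x xN xS.
  have vx : v \in bag_of w x by rewrite inE in xS.
  have [vp|vp] := boolP (v \in bag_of w (par_of w x)); last by exists x.
  have xr : x != out_root.
    by apply/eqP => xr; rewrite xr bag_root0 in vx.
  have lt := out_parent_lt xr.
  have pS : out_parent x \in S by rewrite inE.
  have [|t [h1 h2 h3]] := IH (out_parent x) _ pS; first by lia.
  exists t; split=> //; apply: connect_trans h3; apply: connect1.
  rewrite /r /= xS pS /tree_adj eqxx /= andbT.
  by apply/eqP => E; rewrite -E ltnn in lt.
move=> x y xS yS; have [t [t1 t2 xt]] := top x xS; have [s [s1 s2 ys]] := top y yS.
have E : s = t by apply: val_inj; apply: (work_top wok) s1 s2 t1 t2.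
apply: connect_trans xt _; rewrite -E (sym_connect_sym rsym); exact: ys.
Qed.

Lemma out_decomposition : kfree_decomposition G K out_triple.
Proof.
split=> /=.
- exact: out_subtree.
- move=> u v uv; have [j /andP[uj vj]] := work_edge wok (all_covered u) (all_covered v) uv.
  by exists (Ordinal (bag_lt uj)); rewrite uj vj.
- move=> v vL; have [j vj] := coveredP _ _ (subsetP (work_lcov wok) _ vL).
  exists (Ordinal (bag_lt vj)).
    apply/forallP => y; apply/implyP => _; apply/eqP => E.
    have := disjointFl (work_leaf wok (ltn_ord y)) vL.
    have Ej : par_of w y = j := congr1 val E.
    by rewrite Ej vj.
  move=> y; apply/idP/eqP => [vy|-> //].
  by apply: val_inj; apply: (work_lone wok vL) vy vj.
- by move=> x; rewrite -setIA (work_lK wok) setI0.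
Qed.

Lemma out_width : width out_triple <= 5 * k + 5.
Proof.
apply/bigmax_leqP => x _; have := work_width wok x.
by rewrite /=; lia.
Qed.

Lemma out_size : m <= n.+1.
Proof.
apply: leq_trans (work_size wok) _; rewrite ltnS.
by apply: leq_trans (max_card _) _; rewrite card_ord.
Qed.

Definition enc_node (x : nat * {set 'I_n}) := Pair (enc_unary x.1) (enc_set x.2).

Lemma out_enc : enc_triple out_triple =
  Pair Nil (Pair (enc_seq (map enc_node (nodes w))) (enc_set (lpart w))).
Proof.
rewrite /enc_triple /=; congr (Pair _ (Pair (enc_seq _) _)).
have E : nodes w = [seq nth (0, set0) (nodes w) i | i <- iota 0 m].
  by rewrite map_nth_iota0 // take_size.
rewrite [in RHS]E -val_enum_ord -[RHS]map_comp -[RHS]map_comp; apply: eq_map => x /=.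
by rewrite /enc_node.
Qed.

End FinalDecomposition.

(** * Balanced separators obtained from a decomposition *)

Section Separator.
Variables (n : nat) (G : sgraph 'I_n) (K : {set 'I_n}) (k : nat).
Variables (T : finType) (D : triple 'I_n T) (S : {set 'I_n}).
Hypothesis dec : kfree_decomposition G K D.
Hypothesis dec_width : width D <= k.
Hypothesis card_S : #|S| = 4 * k + 4.

Local Notation par := (parent (tree D)).
Local Notation rt := (root (tree D)).

Definition desc (x : T) : {set T} := [set y | fconnect par y x].

Lemma descP x y : reflect (exists i, iter i par y = x) (y \in desc x).
Proof.
rewrite inE; apply: (iffP idP) => [h|[i <-]]; last exact: fconnect_iter.
by exists (findex par y x); apply: iter_findex.
Qed.

Lemma desc_refl x : x \in desc x.
Proof. by apply/descP; exists 0. Qed.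

Lemma desc_up x y : y \in desc x -> y != x -> par y \in desc x.
Proof.
move=> /descP[[|i] <-]; first by rewrite eqxx.
by move=> _; apply/descP; exists i; rewrite -iterSr.
Qed.

Lemma desc_down x y : par y \in desc x -> y \in desc x.
Proof. by move=> /descP[i <-]; apply/descP; exists i.+1; rewrite iterSr. Qed.

Lemma desc_trans x y z : y \in desc x -> z \in desc y -> z \in desc x.
Proof. by rewrite !inE => h1 h2; apply: connect_trans h2 h1. Qed.

Lemma desc_root y : y \in desc rt.
Proof. by apply/descP; apply: parent_to_root. Qed.

Lemma iter_root i : iter i par rt = rt.
Proof. by elim: i => //= i ->; apply: parent_root. Qed.

Lemma parent_notin_desc y : y != rt -> par y \notin desc y.
Proof.
move=> yr; apply/negP => /descP[i]; rewrite -iterSr => E.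
(* A descent from y to its own parent would close a cycle. Running around it often enough passes the
   step at which y reaches the root, and the root is a fixed point. *)
have cyc p : iter (p * i.+1) par y = y by elim: p => // p IH; rewrite mulSn iterD IH.
have [j hj] := parent_to_root (tree D) y.
move/eqP: yr; apply; rewrite -(cyc j).
by rewrite -(subnK (leq_pmulr j (ltn0Sn i))) iterD hj iter_root.
Qed.

Definition below (x : T) : {set 'I_n} := [set v | [exists y, (y \in desc x) && (v \in bag D y)]].

Lemma belowP x v : reflect (exists2 y, y \in desc x & v \in bag D y) (v \in below x).
Proof.
by rewrite inE; apply: (iffP existsP) => [[y /andP[]]|[y h1 h2]]; exists y; rewrite ?h1.
Qed.

(** The only tree edge that leaves the descendants of y joins y to its parent, and the nodes
    containing v are connected. *)
Lemma bag_crossing v a b y : a \in desc y -> v \in bag D a -> b \notin desc y -> v \in bag D b ->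
  v \in bag D (par y).
Proof.
move=> ay va byn vb; have [_ conn] := kfd_A dec v.
have := conn a b; rewrite !inE => /(_ va vb) /connectP[p].
elim: p a ay {va} => [|c p IH] a ay /=; first by move=> _ E; rewrite E ay in byn.
case/andP => /and3P[_ cv ac] pp E.
have [cy|cy] := boolP (c \in desc y); first exact: IH cy pp E.
move: ac; rewrite /tree_adj => /andP[_ /orP[/eqP pa|/eqP pc]]; last first.
  by case/negP: cy; apply: desc_down; rewrite pc.
have [ay'|ay'] := eqVneq a y; first by rewrite -ay' pa; rewrite inE in cv.
by case/negP: cy; rewrite -pa; apply: desc_up.
Qed.

Lemma bag_notL x : #|bag D x :\: lset D| <= k.+1.
Proof.
have := leq_bigmax (F := fun x => #|bag D x :\: lset D| - 1) x.
by move: dec_width; rewrite /width; lia.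
Qed.

(* X is taken from the bag of a lowest node with more than half of S at or below
   it; if that node is not a leaf, PA is a minimal union of subtrees of its
   children that contains enough of S. *)
Lemma exists_separator : exists PA X : {set 'I_n},
  [/\ [disjoint PA & X], #|X| <= k.+1,
      forall u v, u \in PA -> edge G u v -> v \in PA :|: X &
      (k + 2 <= #|PA :&: S| + #|S :&: X| /\ k + 1 <= #|S :\: (PA :|: X)|) \/
      (PA :&: K = set0 /\ k + 2 <= #|PA :&: S|)].
Proof.
(* The threshold 2k + 2 is half of #|S|. *)
pose heavy x := 2 * k + 2 < #|below x :&: S|.
have hroot : heavy rt.
  rewrite /heavy; have -> : below rt = setT.
    apply/setP => v; rewrite in_setT; apply/belowP.
    have [/set0Pn[x]] := kfd_A dec v; rewrite inE => vx _.
    by exists x => //; apply: desc_root.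
  by rewrite setTI card_S; lia.
case: (arg_minnP (fun x => #|desc x|) hroot) => x hx xmin.
have cX := bag_notL x.
have [leaf|nleaf] := boolP (is_leaf (tree D) x).
  (* At a heavy leaf at least 2k + 3 vertices of S are in the bag, and at most k + 1 of them are
     outside L. The remaining k + 2 belong to L, and L avoids K inside a bag. *)
  exists (bag D x :&: lset D), (bag D x :\: lset D).
  have Ex : below x = bag D x.
    apply/setP => v; apply/belowP/idP => [[y /descP[i]]|vx]; last by exists x => //; apply: desc_refl.
    elim: i y => [|i IH] y /=; first by move=> ->.
    move=> E vy; have [z1|z1] := eqVneq (iter i par y) rt.
      by apply: (IH y) => //; rewrite z1 -E z1 parent_root.
    by have := forallP leaf (iter i par y); rewrite z1 E eqxx.
  split=> //.
  - by rewrite -setI_eq0; apply/eqP/setP => v; rewrite !inE; case: (v \in lset D); rewrite ?andbF.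
  - move=> u v; rewrite inE => /andP[ux uL] uv; have [y /andP[uy vy]] := kfd_B dec uv.
    have [x0 _ ux0] := kfd_C dec uL; move: ux uy; rewrite !ux0 => /eqP-> /eqP Ey.
    by rewrite -Ey !inE vy /=; case: (v \in lset D).
  - right; split; first exact: (kfd_D dec x).
    move: hx; rewrite /heavy Ex -(cardsID (lset D) (bag D x :&: S)).
    have -> : (bag D x :&: S) :&: lset D = bag D x :&: lset D :&: S by rewrite setIAC.
    have : #|(bag D x :&: S) :\: lset D| <= #|bag D x :\: lset D|.
      by apply: subset_leq_card; apply: setSD; apply: subsetIl.
    by lia.
have xL : bag D x :&: lset D = set0.
  apply/setP => v; rewrite in_set0; apply/negP; rewrite inE => /andP[vx vL].
  have [x0 lx0 vx0] := kfd_C dec vL; move: vx; rewrite vx0 => /eqP E.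
  by rewrite E lx0 in nleaf.
have {}cX : #|bag D x| <= k.+1.
  by rewrite -(cardsID (lset D)) xL cards0.
set X := bag D x in cX xL *.
pose ch := [set y | (y != rt) && (par y == x)].
pose Q y := below y :\: X.
pose U (Z : {set T}) := \bigcup_(y in Z) Q y.
have chE y : y \in ch -> y != rt /\ par y = x by rewrite inE => /andP[-> /eqP].
have light y : y \in ch -> #|below y :&: S| <= 2 * k + 2.
  case/chE => yr yx; rewrite leqNgt; apply/negP => /xmin; rewrite leqNgt => /negP; apply.
  apply: proper_card; apply/properP; split.
    apply/subsetP => z; apply: desc_trans; apply: desc_down; rewrite yx; exact: desc_refl.
  by exists x; [exact: desc_refl|rewrite -[X in X \notin _]yx; apply: parent_notin_desc].
have Qclosed y u v : y \in ch -> u \in Q y -> edge G u v -> v \in Q y :|: X.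
  case/chE => yr yx; rewrite inE => /andP[uX /belowP[a ay ua]] uv.
  have [b /andP[ub vb]] := kfd_B dec uv.
  have bd : b \in desc y.
    apply/negPn/negP => bd; case/negP: uX; rewrite /X -yx.
    exact: bag_crossing ay ua bd ub.
  rewrite !inE; case: (v \in X) => //=; rewrite orbF; apply/existsP; exists b.
  by rewrite bd vb.
have cov v : v \in below x -> v \in X \/ v \in U ch.
  move=> /belowP[y /descP[i E] vy]; case: (boolP (v \in X)) => vX; [by left|right].
  elim: i y E vy => [|i IH] y /= E vy; first by rewrite E in vy; rewrite /X vy in vX.
  have [z1|z1] := eqVneq (iter i par y) rt.
    by apply: (IH y) => //; rewrite z1 -E z1 parent_root.
  apply/bigcupP; exists (iter i par y); first by rewrite inE z1 E eqxx.
  by rewrite inE vX; apply/belowP; exists y => //; apply/descP; exists i.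
pose good (Z : {set T}) := (Z \subset ch) && (k + 2 <= #|U Z :&: S| + #|S :&: X|).
have gch : good ch.
  rewrite /good subxx /=; apply: (@leq_trans #|below x :&: S|); first by move: hx; rewrite /heavy; lia.
  apply: leq_trans (leq_card_setU _ _); apply: subset_leq_card; apply/subsetP => v.
  rewrite inE => /andP[/cov[vX|vU] vS]; rewrite !inE vS ?vX ?orbT //.
  by rewrite andbT /= vU.
case: (arg_minnP (fun Z : {set T} => #|Z|) gch) => Z /andP[sZ gZ] Zmin.
have SX : #|S :&: X| <= k.+1 by apply: leq_trans cX; apply: subset_leq_card; apply: subsetIr.
have /set0Pn[y yZ] : Z != set0.
  by apply/eqP => Z0; move: gZ; rewrite Z0 /U big_set0 set0I cards0; lia.
have bad : ~~ good (Z :\ y).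
  by apply/negP => /Zmin; rewrite (cardsD1 y Z) yZ; lia.
have {}bad : #|U (Z :\ y) :&: S| + #|S :&: X| <= k + 1.
  move: bad; rewrite /good (subset_trans (subsetDl _ _) sZ) /= -ltnNge; lia.
have UZ : #|U Z :&: S| <= #|U (Z :\ y) :&: S| + (2 * k + 2).
  apply: leq_trans (leq_add (leqnn _) (light y (subsetP sZ _ yZ))).
  apply: leq_trans (leq_card_setU _ _); apply: subset_leq_card; rewrite -setIUl setSI //.
  apply/subsetP => v /bigcupP[z zZ vz]; rewrite inE.
  have [Ez|nz] := eqVneq z y; last first.
    by apply/orP; left; apply/bigcupP; exists z; rewrite // !inE nz.
  by move: vz; rewrite Ez inE => /andP[_ ->]; rewrite orbT.
exists (U Z), X; split=> //.
- rewrite disjoint_subset; apply/subsetP => v /bigcupP[z _]; rewrite inE => /andP[h _].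
  by rewrite inE.
- move=> u v /bigcupP[z zZ uz] uv; have := Qclosed _ _ _ (subsetP sZ _ zZ) uz uv.
  case/setUP => [vz|vX]; apply/setUP; [left|by right].
  by apply/bigcupP; exists z.
(* By minimality the union without y, together with X, holds at most k + 1 vertices of S, and the
   light child y adds at most 2k + 2. So at least 4k + 4 - (3k + 3) = k + 1 vertices of S remain on
   the other side. *)
- left; split=> //.
  have h1 := cardsID (U Z :|: X) S; rewrite card_S setIUr in h1.
  have h2 := (leq_card_setU (S :&: U Z) (S :&: X)).1.
  rewrite [U Z :&: S]setIC in UZ; move: h1 h2 UZ bad.
  by lia.
Qed.

End Separator.

(** * One step of the algorithm *)

Fixpoint add_carry (c : bool) (g : seq bool) : seq bool :=
  if g is b :: g' then (b (+) c) :: add_carry (b && c) g' else [::].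

Definition incr_bits := add_carry true.

Fixpoint bits_val (g : seq bool) : nat := if g is b :: g' then b + 2 * bits_val g' else 0.

Lemma add_carry0 g : add_carry false g = g.
Proof. by elim: g => //= b g IH; rewrite andbF addbF IH. Qed.

Lemma size_incr g : size (incr_bits g) = size g.
Proof. by rewrite /incr_bits; elim: g true => //= b g IH c; rewrite IH. Qed.

Lemma val_incr g : ~~ all id g -> bits_val (incr_bits g) = (bits_val g).+1.
Proof.
rewrite /incr_bits; elim: g => //= -[] g IH /=; first by move=> /IH ->; lia.
by rewrite add_carry0.
Qed.

Lemma val_lt g : bits_val g < 2 ^ size g.
Proof. by elim: g => //= b g IH; rewrite expnS; case: b; lia. Qed.

Lemma val_all g : all id g -> bits_val g = 2 ^ size g - 1.
Proof.
elim: g => //= -[] //= g IH /IH ->; rewrite expnS.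
by have := expn_gt0 2 (size g); lia.
Qed.

Lemma val_inj_size g g' : size g = size g' -> bits_val g = bits_val g' -> g = g'.
Proof.
elim: g g' => [|b g IH] [|b' g'] //= [/IH h] E.
have [Eb Ev] : b = b' /\ bits_val g = bits_val g' by case: b b' E => -[] E; split=> //; lia.
by rewrite Eb (h Ev).
Qed.

Lemma val_nseq m : bits_val (nseq m false) = 0.
Proof. by elim: m => //= m ->. Qed.

(** Here m is the size of Y, c that of the minimum cut, and x and s count the vertices of the
    separator in C and in S. An empty cut is enlarged to one vertex, so m + s may reach k + 2; hence
    the k + 2 in [exists_separator]. *)
Lemma cut_arith m c x s k : m <= maxn 1 c -> c <= x -> x + s <= k.+1 ->
  m <= k.+1 /\ m + s <= k + 2.
Proof. lia. Qed.

Section Step.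
Variables (n : nat) (G : sgraph 'I_n) (K : {set 'I_n}) (k : nat).
Implicit Types (w : work n) (C S Y L P : {set 'I_n}) (g : seq bool).

(* Bit 0 of a guess tells that the A-side has to avoid K; bits r + 1 and
   r + sep_size k + 1 place the vertex of rank r in S on the A-side, on the B-side
   or in the separator. *)
Definition rank S (v : 'I_n) := #|[set u | (u \in S) && (u < v)]|.

Definition guess_A g S := [set v | (v \in S) && nth false g (rank S v).+1].
Definition guess_B g S :=
  [set v | (v \in S) && (~~ nth false g (rank S v).+1 && nth false g (rank S v + sep_size k).+1)].
Definition touch C S := [set v | (v \in C) && [exists u, (u \in S) && edge G u v]].
Definition guess_sink g C S :=
  if nth false g 0 then touch C (guess_B g S) :|: (K :&: C) else touch C (guess_B g S).
Definition split_side g C S :=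
  cut_side (edge G) C (touch C (guess_A g S)) (guess_sink g C S).
Definition split_cut g C S :=
  cut_boundary (edge G) C (touch C (guess_A g S)) (split_side g C S).
(** Every node has to introduce a vertex, so an empty cut is replaced by one vertex of C; removing a
    further vertex from both sides does not reconnect them. *)
Definition split_new g C S := if split_cut g C S != set0 then split_cut g C S else least C.
(** The comparisons ensure that exchanging [guess_A] or [guess_B] for Y does not enlarge S. With bit
    0 set, the side that loses [guess_B] avoids K and is allowed to grow. *)
Definition split_ok g C S :=
  ~~ [exists u, (u \in guess_A g S) && [exists v, (v \in guess_B g S) && edge G u v]] &&
  ((#|split_new g C S| <= k.+1) && ((#|split_new g C S| <= #|guess_A g S|) &&
   (nth false g 0 || (#|split_new g C S| <= #|guess_B g S|)))).

Definition cur w : item n := head (set0, set0, 0) (items w).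
Definition cur_C w := (cur w).1.1.
Definition cur_S w := (cur w).1.2.

Definition is_free w := ~~ (cur_C w :&: K != set0).
Definition is_small w := #|cur_S w|.+1 <= sep_size k.
Definition progress w := is_free w || (is_small w || split_ok (guess w) (cur_C w) (cur_S w)).

Definition new_Y w := if is_free w then cur_C w else
  if is_small w then least (cur_C w) else split_new (guess w) (cur_C w) (cur_S w).
Definition new_L w := if is_free w then cur_C w else set0.
Definition new_C1 w := if is_free w then set0 else
  if is_small w then cur_C w :\: new_Y w
  else split_side (guess w) (cur_C w) (cur_S w) :\: new_Y w.
Definition new_S1 w := if is_free w then set0 else
  if is_small w then cur_S w :|: new_Y w
  else (cur_S w :\: guess_B (guess w) (cur_S w)) :|: new_Y w.
Definition new_C2 w := if is_free w then set0 else
  if is_small w then set0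
  else (cur_C w :\: split_side (guess w) (cur_C w) (cur_S w)) :\: new_Y w.
Definition new_S2 w := if is_free w then set0 else
  if is_small w then set0
  else (cur_S w :\: guess_A (guess w) (cur_S w)) :|: new_Y w.

Definition next_work w := if progress w then
    emit k w (cur_C w) (cur_S w) (cur w).2 (new_Y w) (new_L w) (new_C1 w) (new_S1 w)
      (new_C2 w) (new_S2 w) (behead (items w))
  else Work (nodes w) (lpart w) (items w) (incr_bits (guess w)).

Definition stop w := nilp (items w) || (~~ progress w && all id (guess w)).

Lemma guess_A_sub g S : guess_A g S \subset S.
Proof. by apply/subsetP => v; rewrite inE => /andP[]. Qed.

Lemma guess_B_sub g S : guess_B g S \subset S.
Proof. by apply/subsetP => v; rewrite inE => /andP[]. Qed.

Lemma touchP C S v : reflect (v \in C /\ exists2 u, u \in S & edge G u v) (v \in touch C S).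
Proof.
rewrite inE; apply: (iffP andP) => -[vC].
  by move=> /existsP[u /andP[uS uv]]; split=> //; exists u.
by move=> [u uS uv]; split=> //; apply/existsP; exists u; rewrite uS.
Qed.

Lemma split_cut_sub g C S : split_cut g C S \subset C.
Proof.
apply/subsetP => v; rewrite in_setD in_setU => /andP[_ /orP[/touchP[]//|]].
by rewrite inE => /andP[].
Qed.

Lemma split_newP g C S : C != set0 ->
  [/\ split_new g C S != set0, split_new g C S \subset C,
      split_cut g C S \subset split_new g C S &
      #|split_new g C S| <= maxn 1 #|split_cut g C S| ].
Proof.
move=> C0; rewrite /split_new; case: (eqVneq (split_cut g C S) set0) => [->|h] /=.
  have [v vC ->] := leastP C0; split; rewrite ?sub0set ?sub1set ?cards1 ?leq_maxl //.
  by apply/set0Pn; exists v; rewrite inE.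
by split=> //; [apply: split_cut_sub|apply: leq_maxr].
Qed.

Lemma progress_ok w C S p rest : work_ok G K k w -> items w = (C, S, p) :: rest ->
  progress w -> work_ok G K k (next_work w) /\ #|covered w| < #|covered (next_work w)|.
Proof.
move=> wok iw pw; rewrite /next_work pw.
have Ec : cur w = (C, S, p) by rewrite /cur iw.
have EC : cur_C w = C by rewrite /cur_C Ec.
have ES : cur_S w = S by rewrite /cur_S Ec.
have Er : behead (items w) = rest by rewrite iw.
have iin : (C, S, p) \in items w by rewrite iw mem_head.
have [/= C0 _ _ _ nbr sm] := work_items wok iin.
rewrite Er Ec /= EC ES.
suff [hY1 hY2 hL1 hL2 [hL3 [hb [hc [h1 [h2 [h3 [h4 [h5 h6]]]]]]]]] :
  [/\ new_Y w != set0, new_Y w \subset C, new_L w \subset new_Y w, new_L w :&: K = set0 &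
   (new_L w = set0 \/ new_C1 w = set0 /\ new_C2 w = set0) /\
   (#|(S :|: new_Y w) :\: new_L w| <= 5 * k + 6 /\
   ((forall v, (v \in new_C1 w) + (v \in new_C2 w) = (v \in C :\: new_Y w)) /\
   (new_S1 w \subset S :|: new_Y w /\ (new_S2 w \subset S :|: new_Y w /\
   ((forall u v, u \in new_C1 w -> edge G u v -> v \in new_C1 w :|: new_S1 w) /\
   ((forall u v, u \in new_C2 w -> edge G u v -> v \in new_C2 w :|: new_S2 w) /\
   (small K k (new_S1 w) (new_C1 w) /\ small K k (new_S2 w) (new_C2 w))))))))].
  by split; [apply: (emit_ok wok iw hY1 hY2 hL1 hL2 hL3 hb hc h1 h2 h3 h4 h5 h6)|by eapply emit_covered; eassumption].
move: pw; rewrite /progress /new_L /new_C1 /new_S1 /new_C2 /new_S2 /new_Y EC ES.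
have no0 S0 u v : u \in (set0 : {set 'I_n}) -> edge G u v -> v \in set0 :|: S0 by rewrite inE.
have sm0 : small K k set0 set0 by left; rewrite cards0.
case: (boolP (is_free w)) => [Ef _|/negbTE Ef].
  have CK : C :&: K = set0 by apply/eqP; move: Ef; rewrite /is_free EC negbK.
  split=> //; split; [by right|split; [|split; [|do 2 (split; first exact: sub0set)]]].
  (* The whole of C goes into L, so only S counts towards the width. *)
  - apply: (@leq_trans #|S|); last by case: sm => [|[_]]; rewrite /sep_size; lia.
    by apply: subset_leq_card; apply/subsetP => v; rewrite !inE; case: (v \in C); rewrite ?orbF.
  - by move=> v; rewrite !inE; case: (v \in C).
  - by do 2 (split; first exact: no0).
have CK : C :&: K != set0 by move: Ef; rewrite /is_free EC => /negbFE.
have {}sm : #|S| <= 4 * k + 4 by case: sm => // -[E]; rewrite E eqxx in CK.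
have cardU (A B : {set 'I_n}) : #|A :|: B| <= #|A| + #|B| := (leq_card_setU A B).1.
case: (boolP (is_small w)) => [Es _|/negbTE Es /= ok].
  have [v0 v0C ->] := leastP C0; rewrite /is_small ES /sep_size in Es.
  split; rewrite ?sub0set ?set0I //; first by apply/set0Pn; exists v0; rewrite inE.
    by rewrite sub1set.
  split; [by left|split; [|split; [|do 2 (split; first by rewrite ?subxx ?sub0set)]]].
  - rewrite setD0; apply: leq_trans (cardU _ _) _; rewrite cards1; lia.
  - by move=> v; rewrite [v \in set0]inE addn0.
  - split; last first.
      split; first exact: no0.
      split; last exact: sm0.
      by left; apply: leq_trans (cardU _ _) _; rewrite cards1 /sep_size; lia.
    move=> u v; rewrite inE => /andP[_ uC] uv; have := nbr u v uC uv; rewrite !inE.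
    by case: (v == v0); case: (v \in C); case: (v \in S).
have [Y0 YC cutY _] := split_newP (guess w) S C0.
move: ok; rewrite /split_ok.
set g := guess w in Y0 YC cutY *; set Y := split_new g C S in Y0 YC cutY *.
set SA := guess_A g S; set SB := guess_B g S; set P := split_side g C S.
move=> /andP[_ /and3P[Yk YA YB]].
have sPB : P \subset C :\: guess_sink g C S by apply: cut_side_sub.
have PC v : v \in P -> v \in C by move=> /(subsetP sPB); rewrite inE => /andP[].
(* This is the separation property of the cut: a vertex of C outside P that sees [SA] or P belongs
   to Y. *)
have cutP v : v \notin P -> v \in touch C SA \/ v \in cut_closure (edge G) C P -> v \in Y.
  move=> vP h; apply: (subsetP cutY); rewrite in_setD vP in_setU.
  by case: h => ->; rewrite ?orbT.
have clP u v : u \in P -> v \in C -> edge G u v -> v \in P \/ v \in Y.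
  move=> uP vC uv; case: (boolP (v \in P)) => vP; [by left|right].
  apply: cutP => //; right; rewrite inE vC /=; apply/orP; right.
  by apply/existsP; exists u; rewrite uP.
clearbody P.
have sub_small (A : {set 'I_n}) : A \subset S -> #|Y| <= #|A| -> #|(S :\: A) :|: Y| <= sep_size k.
  move=> sA hA; apply: leq_trans (cardU _ _) _; apply: leq_trans sm.
  by rewrite -(cardsID A S) (setIidPr sA) addnC leq_add2r.
split; rewrite ?sub0set ?set0I //; split; [by left|split; [|split; [|split; [|split; [|split; [|split; [|split]]]]]]].
- by rewrite setD0; apply: leq_trans (cardU _ _) _; apply: leq_trans (leq_add sm Yk) _; clear; lia.
- move=> v; rewrite !in_setD; case: (boolP (v \in P)) => [/PC->|_]; by rewrite ?andbF ?addn0 ?andbT.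
- by apply: setSU; apply: subsetDl.
- by apply: setSU; apply: subsetDl.
- move=> u v; rewrite in_setD => /andP[uY uP] uv.
  have := nbr u v (PC u uP) uv; rewrite in_setU => /orP[vC|vS].
    by case: (clP u v uP vC uv) => h; rewrite !inE h ?orbT //; case: (v \in Y); rewrite ?orbT.
  rewrite !in_setU !in_setD vS andbT; case: (boolP (v \in SB)) => [vB|]; last by rewrite ?orbT.
  (* A neighbour in [SB] would make u a vertex of the sink, which P avoids. *)
  have := subsetP sPB _ uP; rewrite in_setD => /andP[/negP[]].
  have uT : u \in touch C SB by apply/touchP; split; [exact: PC|exists v; rewrite // edge_sym].
  by rewrite /guess_sink; case: ifP; rewrite // in_setU uT.
- move=> u v; rewrite !in_setD => /and3P[uY uP uC] uv.
  have := nbr u v uC uv; rewrite in_setU => /orP[vC|vS].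
    rewrite !in_setU !in_setD vC andbT; case: (boolP (v \in Y)) => vY; rewrite ?orbT //=.
    rewrite orbF; case: (boolP (v \in P)) => [vP|//].
    have [] := clP v u vP uC; first by rewrite edge_sym.
      by rewrite (negbTE uP).
    by rewrite (negbTE uY).
  rewrite !in_setU !in_setD vS andbT; case: (boolP (v \in SA)) => [vA|]; last by rewrite ?orbT.
  case/negP: uY; apply: cutP => //; left; apply/touchP; split=> //.
  by exists v; rewrite // edge_sym.
- case E : (nth false g 0) YB => /= YB; last by left; apply: sub_small; first exact: guess_B_sub.
  (* With bit 0 set the sink contains all of K inside C, so this child avoids K and 4k + 4 + k + 1
     vertices are allowed. *)
  right; split.
    apply/setP => v; rewrite in_set0 in_setI in_setD; apply/negP => /andP[/andP[_ vP] vK].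
    have := subsetP sPB _ vP; rewrite in_setD /guess_sink E in_setU in_setI vK => /andP[h vC].
    by rewrite vC orbT in h.
  apply: leq_trans (cardU _ _) _.
  apply: leq_trans (leq_add (leq_trans (subset_leq_card (subsetDl S SB)) sm) Yk) _.
  by clear; lia.
- by left; apply: sub_small; first exact: guess_A_sub.
Qed.

Lemma rank_lt S (u v : 'I_n) : u \in S -> u < v -> rank S u < rank S v.
Proof.
move=> uS uv; apply: proper_card; apply/properP; split.
  apply/subsetP => x; rewrite !inE => /andP[-> xu] /=; exact: ltn_trans xu uv.
by exists u; rewrite inE ?uS ?uv // ltnn andbF.
Qed.

Lemma rank_inj S (u v : 'I_n) : u \in S -> v \in S -> rank S u = rank S v -> u = v.
Proof.
move=> uS vS E; apply: val_inj; case: (ltngtP u v) => // h.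
  by have := rank_lt uS h; rewrite E ltnn.
by have := rank_lt vS h; rewrite E ltnn.
Qed.

Lemma rank_max S (v : 'I_n) : v \in S -> rank S v < #|S|.
Proof.
move=> vS; apply: proper_card; apply/properP; split.
  by apply/subsetP => x; rewrite inE => /andP[].
by exists v; rewrite // inE ltnn andbF.
Qed.

(** The bit string that encodes a given split, a right inverse of [guess_A] and [guess_B]; ranks
    serve as positions because they are distinct and below #|S|. *)
Definition guess_of (b : bool) (A B S : {set 'I_n}) : seq bool :=
  b :: mkseq (fun i => [exists v, (v \in A) && (rank S v == i)]) (sep_size k) ++
       mkseq (fun i => [exists v, (v \in B) && (rank S v == i)]) (sep_size k).

Lemma guess_ofP b (A B S : {set 'I_n}) : #|S| = sep_size k -> A \subset S -> B \subset S -> [disjoint A & B] ->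
  guess_A (guess_of b A B S) S = A /\ guess_B (guess_of b A B S) S = B.
Proof.
move=> cS sA sB dAB.
have memE (X : {set 'I_n}) v : X \subset S -> v \in S ->
    [exists u, (u \in X) && (rank S u == rank S v)] = (v \in X).
  move=> sX vS; apply/existsP/idP => [[u /andP[uX /eqP E]]|vX]; last by exists v; rewrite vX eqxx.
  by rewrite -(rank_inj (subsetP sX _ uX) vS E).
have nA v : v \in S -> nth false (guess_of b A B S) (rank S v).+1 = (v \in A).
  move=> vS; have := rank_max vS; rewrite cS => h.
  by rewrite /= nth_cat size_mkseq h nth_mkseq // memE.
have nB v : v \in S -> nth false (guess_of b A B S) (rank S v + sep_size k).+1 = (v \in B).
  move=> vS; have := rank_max vS; rewrite cS => h.
  by rewrite /= nth_cat size_mkseq ltnNge leq_addl /= addnK nth_mkseq // memE.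
split; apply/setP => v; rewrite inE.
  by case: (boolP (v \in S)) => vS /=; [exact: nA|apply/esym/negbTE; apply: contra vS; exact: (subsetP sA)].
case: (boolP (v \in S)) => vS; last by apply/esym/negbTE; apply: contra vS; exact: (subsetP sB).
rewrite andTb nA // nB //; case: (boolP (v \in A)) => // vA /=.
by rewrite (disjointFr dAB vA).
Qed.

Lemma guess_exists w C S p rest (T : finType) (D : triple 'I_n T) :
  work_ok G K k w -> items w = (C, S, p) :: rest -> C :&: K != set0 -> sep_size k <= #|S| ->
  kfree_decomposition G K D -> width D <= k ->
  exists2 g, size g = guess_size k & split_ok g C S.
Proof.
move=> wok iw CK lS dec wD.
have iin : (C, S, p) \in items w by rewrite iw mem_head.
have [/= C0 _ sS _ nbr sm] := work_items wok iin.
have cS : #|S| = sep_size k.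
  by case: sm => [h|[E]]; [apply/eqP; rewrite eqn_leq h|rewrite E eqxx in CK].
have CS v : v \in C -> v \notin S.
  move=> vC; apply: contra (item_disjoint wok iin vC) => vS.
  by apply/coveredP; exists p; apply: (subsetP sS).
have [PA [X [dPX cX clPA alt]]] := exists_separator dec wD cS.
pose b := [&& PA :&: K == set0 & k + 2 <= #|PA :&: S|].
pose A := PA :&: S; pose B := S :\: (PA :|: X).
have dAB : [disjoint A & B].
  rewrite -setI_eq0; apply/eqP/setP => v; rewrite !inE.
  by case: (v \in PA); rewrite ?andbF.
have [EA EB] := guess_ofP b cS (subsetIr PA S) (subsetDl S (PA :|: X)) dAB.
rewrite -/A -/B in EA EB.
exists (guess_of b A B S); first by rewrite /= size_cat !size_mkseq /sep_size /guess_size; lia.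
set g := guess_of b A B S in EA EB *.
(* The separator yields a competitor for the minimum cut: P avoids the sink and its boundary lies in
   C :&: X. *)
pose P := PA :&: C.
have notB v : v \in PA -> v \notin touch C B.
  move=> vP; apply/negP => /touchP[_ [u uB uv]]; move: uB; rewrite in_setD => /andP[/negP nu _].
  by apply: nu; apply: (clPA v u vP); rewrite edge_sym.
have sP : P \subset C :\: guess_sink g C S.
  apply/subsetP => v; rewrite inE => /andP[vPA vC]; rewrite in_setD vC andbT /guess_sink EB.
  case: ifP => [|_]; last exact: notB.
  rewrite in_setU negb_or notB //= => /andP[/eqP PK _]; rewrite inE vC andbT.
  by apply/negP => vK; move/setP/(_ v): PK; rewrite !inE vPA vK.
have sA : touch C (guess_A g S) \subset C by apply/subsetP => v /touchP[].
have bd : cut_boundary (edge G) C (touch C (guess_A g S)) P \subset C :&: X.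
  apply/subsetP => v; rewrite in_setD in_setU EA => /andP[vP h].
  have [vC vPX] : v \in C /\ v \in PA :|: X.
    case/orP: h => [/touchP[vC [u]]|]; first by rewrite inE => /andP[uP _] uv; split=> //; apply: clPA uP uv.
    rewrite inE => /andP[vC /orP[h|/existsP[u /andP[]]]]; first by rewrite h in vP.
    by rewrite inE => /andP[uP _] uv; split=> //; apply: clPA uP uv.
  rewrite inE vC /=; move: vPX; rewrite in_setU => /orP[vPA|//].
  by rewrite inE vPA vC in vP.
have cut_le : #|split_cut g C S| <= #|C :&: X|.
  by apply: (leq_trans (cut_side_min (edge G) sA sP)); apply: subset_leq_card.
(* C and S are disjoint, so their parts of the separator share the budget k + 1. *)
have CX : #|C :&: X| + #|S :&: X| <= k.+1.
  apply: leq_trans cX; rewrite -cardsUI; set Z := (_ :&: X) :&: _.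
  have -> : Z = set0.
    apply/setP => v; rewrite !inE; apply/negP => /andP[/andP[vC _] /andP[vS _]].
    by have := CS v vC; rewrite vS.
  rewrite cards0 addn0; apply: subset_leq_card; rewrite -setIUl; exact: subsetIr.
have [_ _ _ Yle] := split_newP g S C0.
have [Yk YS] := cut_arith Yle cut_le CX.
rewrite /split_ok EA EB; apply/and4P; split.
- apply/existsPn => u; rewrite negb_and; case: (boolP (u \in A)) => //= uA.
  apply/existsPn => v; rewrite negb_and; case: (boolP (v \in B)) => //= vB.
  apply/negP => uv; move: uA vB; rewrite !inE => /andP[uP _].
  by have := clPA u v uP uv; rewrite !inE => ->.
- exact: Yk.
(* In the first case Y and S :&: X have at most k + 2 vertices together and so do at most [A] and S
   :&: X in reverse: cancelling S :&: X gives #|Y| at most #|A|. In the second case #|A| alone is at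
   least k + 2. *)
- case: alt => [[hA hB]|[_ hA]]; rewrite -/A in hA.
    by rewrite -(leq_add2r #|S :&: X|); apply: leq_trans YS hA.
  by apply: leq_trans Yk _; apply: leq_trans hA; rewrite addn2 leqnSn.
- have -> : nth false g 0 = b by [].
  case: alt => [[hA hB]|[hK hA]]; last by rewrite /b hK eqxx hA.
  rewrite -/B in hB; apply/orP; right.
  by apply: leq_trans Yk _; rewrite -addn1.
Qed.

(** The last clause records that all smaller guesses have failed for the current first item. When
    the counter is all ones and fails too, no guess is left. *)
Definition run_ok w : Prop :=
  [/\ work_ok G K k w, size (guess w) = guess_size k &
      forall C S p rest, items w = (C, S, p) :: rest -> C :&: K != set0 -> sep_size k <= #|S| ->
      forall g, size g = guess_size k -> bits_val g < bits_val (guess w) -> ~~ split_ok g C S].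

(** Lexicographic: covering a vertex pays for resetting the counter, and otherwise the number of
    remaining guesses drops. *)
Definition measure w := #|~: covered w| * 2 ^ guess_size k + (2 ^ guess_size k - 1 - bits_val (guess w)).

Lemma not_progress w C S p rest : items w = (C, S, p) :: rest -> ~~ progress w ->
  [/\ C :&: K != set0, sep_size k <= #|S| & ~~ split_ok (guess w) C S].
Proof.
move=> iw; rewrite /progress /is_free /is_small /cur_C /cur_S /cur iw /= !negb_or negbK -ltnNge ltnS.
by case/and3P.
Qed.

Lemma next_ok w : run_ok w -> ~~ stop w -> run_ok (next_work w) /\ measure (next_work w) < measure w.
Proof.
move=> [wok sg hg]; rewrite /stop negb_or => /andP[ni st].
case iw : (items w) ni => [//|[[C S] p] rest] _.
have vw := val_lt (guess w); rewrite sg in vw.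
have [pw|npw] := boolP (progress w).
  have [wok' cov] := progress_ok wok iw pw.
  have Eg : guess (next_work w) = nseq (guess_size k) false by rewrite /next_work pw.
  split; first by split=> //; rewrite Eg ?size_nseq ?val_nseq.
  have h1 := cardsC (covered w); have h2 := cardsC (covered (next_work w)).
  have cc : #|~: covered (next_work w)| < #|~: covered w| by lia.
  rewrite /measure Eg val_nseq; move: cc vw; set N := 2 ^ _.
  move: #|~: covered (next_work w)| #|~: covered w| => a b ab vN.
  by have := leq_mul ab (leqnn N); rewrite mulSn; lia.
have nall : ~~ all id (guess w) by move: st; rewrite npw.
have En : next_work w = Work (nodes w) (lpart w) (items w) (incr_bits (guess w)).
  by rewrite /next_work (negbTE npw).
have vi := val_incr nall.
split; last first.
  have vi2 := val_lt (incr_bits (guess w)).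
  rewrite size_incr sg in vi2; rewrite En /measure /= vi /covered /=; rewrite vi in vi2.
  by rewrite ltn_add2l; lia.
rewrite En; split=> /=; [|by rewrite size_incr|].
  by case: wok => ? ? ? ok *; split=> // it /ok[]; split.
move=> C' S' p' rest' iw' CK' lS' g sgg; rewrite vi ltnS leq_eqVlt => /orP[/eqP E|]; last first.
  exact: hg iw' CK' lS' g sgg.
have -> : g = guess w by apply: val_inj_size => //; rewrite sg.
by case: (not_progress iw' npw).
Qed.

Lemma init_run_ok : run_ok (init_work n k).
Proof.
split; [exact: init_ok|by rewrite size_nseq|].
by move=> C S p rest _ _ _ g _; rewrite val_nseq.
Qed.

(** A decomposition of width at most k would provide a successful guess, but all of them have
    failed. The bound on k holds since the n vertices include an S of size at least 4k + 4. *)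
Lemma stop_reject w : run_ok w -> stop w -> ~~ nilp (items w) ->
  (k < n) /\ forall (T : finType) (D : triple 'I_n T),
    kfree_decomposition G K D -> k < width D.
Proof.
move=> [wok sg hg]; rewrite /stop.
case iw : (items w) => [//|[[C S] p] rest] /= /andP[npw al] _.
have [CK lS nok] := not_progress iw npw.
split.
  have : #|S| <= n by rewrite -[X in _ <= X]card_ord; apply: max_card.
  by move: lS; rewrite /sep_size; lia.
move=> T D dec; rewrite ltnNge; apply/negP => wD.
have [g sgg ok] := guess_exists wok iw CK lS dec wD.
have : bits_val g <= bits_val (guess w).
  by rewrite (val_all al) sg; have := val_lt g; rewrite sgg; lia.
rewrite leq_eqVlt => /orP[/eqP E|lt].
  have Eg : g = guess w by apply: val_inj_size => //; rewrite sg.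
  by rewrite Eg (negbTE nok) in ok.
by have := hg C S p rest iw CK lS g sgg lt; rewrite ok.
Qed.

Lemma run_stops : exists N, [/\ N <= measure (init_work n k),
   stop (iter N next_work (init_work n k)),
   forall t, t < N -> ~~ stop (iter t next_work (init_work n k)) &
   forall t, t <= N -> run_ok (iter t next_work (init_work n k))].
Proof.
move: init_run_ok; move: (init_work n k) => w.
have [M] := ubnP (measure w); elim: M w => // M IH w hM rok.
have [st|nst] := boolP (stop w).
  by exists 0; split=> // t; rewrite leqn0 => /eqP->.
have [rok' lt] := next_ok rok nst.
have [|N [h1 h2 h3 h4]] := IH _ _ rok'; first by apply: leq_trans lt _; rewrite -ltnS.
exists N.+1; split.
- exact: leq_ltn_trans h1 lt.
- by rewrite iterSr.
- by case=> [//|t] ht; rewrite iterSr; apply: h3.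
- by case=> [//|t] ht; rewrite iterSr; apply: h4.
Qed.

End Step.

(** * The step is computable in polynomial time *)

Definition enc_bits (g : seq bool) : sexp := enc_seq [seq enc_bool b | b <- g].

Section BitsFeasible.
Variables (I : Type) (e : I -> sexp).

Lemma feasible_nth_bool (g : I -> seq bool) (m : I -> nat) :
  feasible e (fun i => enc_bits (g i)) -> feasible e (fun i => enc_unary (m i)) ->
  feasible e (fun i => enc_bool (nth false (g i) (m i))).
Proof.
move=> hg hm; apply: feasible_ext (feasible_nth hm hg) => i.
case: (ltnP (m i) (size (g i))) => h; first by rewrite (nth_map false).
by rewrite !nth_default ?size_map.
Qed.

Lemma size_enc_bits g : sexp_size (enc_bits g) <= size g * 4 + 1.
Proof. by elim: g => //= -[] g; rewrite /enc_bits /=; lia. Qed.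

Lemma feasible_all (g : I -> seq bool) :
  feasible e (fun i => enc_bits (g i)) -> feasible e (fun i => enc_bool (all id (g i))).
Proof.
move=> hg.
have E (a : bool) g' : foldl andb a g' = a && all id g'.
  by elim: g' a => [|b g' IH] a /=; rewrite ?andbT // IH andbA.
apply: (feasible_ext (f := fun i => enc_bool (foldl andb true (g i)))).
  by move=> i; rewrite E.
apply: (@feasible_foldl I e (fun=> bool) (fun=> bool) (fun=> enc_bool) (fun=> enc_bool) g
  (fun=> andb)) => //.
- exact: feasible_const.
- have c := feasible_hd (feasible_id (fun j : {i : I & (bool * bool)%type} =>
    Pair (Pair (enc_bool (tagged j).1) (enc_bool (tagged j).2)) (e (tag j)))).
  exact: (feasible_and (feasible_tl c) (feasible_hd c)).
- by exists (fun=> 3); [pbd|move=> i t _; case: foldl].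
Qed.

(** The fold carries the current carry bit and the digits produced so far in reverse order. *)
Lemma feasible_incr (g : I -> seq bool) :
  feasible e (fun i => enc_bits (g i)) -> feasible e (fun i => enc_bits (incr_bits (g i))).
Proof.
move=> hg; have sg := feasible_size hg.
pose F (a : bool * seq bool) (b : bool) := (b && a.1, b (+) a.1 :: a.2).
pose ea (a : bool * seq bool) := Pair (enc_bool a.1) (enc_bits a.2).
have E c r g' : (foldl F (c, r) g').2 = catrev (add_carry c g') r.
  by elim: g' c r => //= b g' IH c r; rewrite IH.
apply: (feasible_ext (f := fun i => enc_seq (rev [seq enc_bool b | b <- (foldl F (true, [::]) (g i)).2]))).
  by move=> i; rewrite E -map_rev catrevE cats0 revK.
apply: feasible_rev.
apply: (feasible_ext (f := fun i => stl (ea (foldl F (true, [::]) (g i))))) => //.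
apply: feasible_tl.
apply: (@feasible_foldl I e (fun=> bool) (fun=> (bool * seq bool)%type) (fun=> enc_bool) (fun=> ea) g
  (fun=> F)) => //.
- exact: feasible_const.
- have c := feasible_hd (feasible_id (fun j : {i : I & (bool * (bool * seq bool))%type} =>
    Pair (Pair (enc_bool (tagged j).1) (ea (tagged j).2)) (e (tag j)))).
  have cb := feasible_hd c; have c1 := feasible_hd (feasible_tl c); have c2 := feasible_tl (feasible_tl c).
  apply: feasible_pair; first exact: (feasible_and cb c1).
  apply: feasible_pair; last exact: c2.
  apply: feasible_ext (feasible_if_bool cb (feasible_neg c1) c1) => j.
  by case: (tagged j).1.
- exists (fun i => sexp_size (enc_bits (g i)) * 4 + 6); first by pbd.
  move=> i t ti; rewrite [sexp_size _]/=.
  have := size_enc_bits (foldl F (true, [::]) (take t (g i))).2.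
  rewrite E catrevE cats0 size_rev.
  have -> : size (add_carry true (take t (g i))) = size (take t (g i)) by apply: size_incr.
  rewrite size_takel //; have : size (g i) < sexp_size (enc_bits (g i)) by apply: size_map_le_enc.
  by case: (foldl _ _ _).1 => /=; lia.
Qed.

Lemma feasible_mulc c (m : I -> nat) :
  feasible e (fun i => enc_unary (m i)) -> feasible e (fun i => enc_unary (c * m i)).
Proof.
move=> hm; elim: c => [|c IH]; first exact: feasible_const.
by apply: feasible_ext (feasible_add hm IH) => i; rewrite mulSn.
Qed.

Lemma feasible_nilp (X : I -> Type) (ex : forall i, X i -> sexp) (s : forall i, seq (X i)) :
  feasible e (fun i => enc_seq (map (@ex i) (s i))) -> feasible e (fun i => enc_bool (nilp (s i))).
Proof.
move=> hs; apply: feasible_ext (feasible_case hs (feasible_const e (enc_bool true))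
  (feasible_const e (enc_bool false))) => i.
by case: (s i).
Qed.

Lemma feasible_head (X : I -> Type) (ex : forall i, X i -> sexp) (s : forall i, seq (X i))
    (x0 : forall i, X i) :
  feasible e (fun i => enc_seq (map (@ex i) (s i))) -> feasible e (fun i => ex i (x0 i)) ->
  feasible e (fun i => ex i (head (x0 i) (s i))).
Proof.
move=> hs h0; apply: feasible_ext (feasible_if (feasible_nilp hs) h0 (feasible_hd hs)) => i.
by case: (s i).
Qed.

Lemma feasible_behead (X : I -> Type) (ex : forall i, X i -> sexp) (s : forall i, seq (X i)) :
  feasible e (fun i => enc_seq (map (@ex i) (s i))) ->
  feasible e (fun i => enc_seq (map (@ex i) (behead (s i)))).
Proof. by move=> hs; apply: feasible_ext (feasible_tl hs) => i; case: (s i). Qed.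

End BitsFeasible.

Record state := State {
  st_n : nat;
  st_G : sgraph 'I_st_n;
  st_K : {set 'I_st_n};
  st_k : nat;
  st_w : work st_n }.

Definition enc_item n (it : item n) : sexp :=
  Pair (Pair (enc_set it.1.1) (enc_set it.1.2)) (enc_unary it.2).

Definition enc_work n (w : work n) : sexp :=
  Pair (enc_seq (map (@enc_node n) (nodes w)))
    (Pair (enc_set (lpart w))
      (Pair (enc_seq (map (@enc_item n) (items w))) (enc_bits (guess w)))).

Definition enc_state (s : state) : sexp :=
  Pair (enc_graph (st_G s)) (Pair (enc_set (st_K s)) (Pair (enc_unary (st_k s)) (enc_work (st_w s)))).

Definition next_state (s : state) : state :=
  State (st_G s) (st_K s) (st_k s) (next_work (st_G s) (st_K s) (st_k s) (st_w s)).

Definition stop_state (s : state) := stop (st_G s) (st_K s) (st_k s) (st_w s).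

Definition result n (w : work n) : sexp :=
  if nilp (items w)
  then Pair Nil (Pair (enc_seq (map (@enc_node n) (nodes w))) (enc_set (lpart w))) else Nil.

Lemma feasible_graph_size I (e : I -> sexp) (n : I -> nat) (G : forall i, sgraph 'I_(n i)) :
  feasible e (fun i => enc_graph (G i)) -> feasible e (fun i => enc_unary (n i)).
Proof.
move=> hG; apply: feasible_ext (feasible_length hG) => i.
by rewrite size_map size_enum_ord.
Qed.

Section StateFeasible.
Let e := enc_state.
Let n := st_n.
Let w (i : state) := st_w i.

Let he : feasible e e := feasible_id e.
Let hG : feasible e (fun i => enc_rel (edge (st_G i))) := feasible_hd he.
Let hn : feasible e (fun i => enc_unary (n i)) := feasible_graph_size (feasible_hd he).
Let hK : feasible e (fun i => enc_set (st_K i)) := feasible_hd (feasible_tl he).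
Let hk : feasible e (fun i => enc_unary (st_k i)) := feasible_hd (feasible_tl (feasible_tl he)).
Let hw : feasible e (fun i => enc_work (w i)) := feasible_tl (feasible_tl (feasible_tl he)).
Let hnodes : feasible e (fun i => enc_seq (map (@enc_node (n i)) (nodes (w i)))) := feasible_hd hw.
Let hlp : feasible e (fun i => enc_set (lpart (w i))) := feasible_hd (feasible_tl hw).
Let hits : feasible e (fun i => enc_seq (map (@enc_item (n i)) (items (w i)))) :=
  feasible_hd (feasible_tl (feasible_tl hw)).
Let hg : feasible e (fun i => enc_bits (guess (w i))) := feasible_tl (feasible_tl (feasible_tl hw)).
Let h0 : feasible e (fun i => enc_set (set0 : {set 'I_(n i)})) := feasible_set0 hn.

Let hcur : feasible e (fun i => enc_item (cur (w i))).
Proof.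
apply: (feasible_head (ex := fun i => @enc_item (n i)) (x0 := fun i => (set0, set0, 0))) => //.
by apply: feasible_pair; [apply: feasible_pair|exact: feasible_const].
Qed.
Let hC : feasible e (fun i => enc_set (cur_C (w i))) := feasible_hd (feasible_hd hcur).
Let hS : feasible e (fun i => enc_set (cur_S (w i))) := feasible_tl (feasible_hd hcur).
Let hp : feasible e (fun i => enc_unary (cur (w i)).2) := feasible_tl hcur.

Let hsep : feasible e (fun i => enc_unary (sep_size (st_k i))).
Proof. by apply: (feasible_add (feasible_mulc _ hk)); exact: feasible_const. Qed.

Let hrank : feasible (vctx e n) (fun j => enc_unary (rank (cur_S (w (tag j))) (tagged j))).
Proof.
apply: feasible_card; first exact: (feasible_up _ hn).
apply: (feasible_set (feasible_up _ hn)); apply: feasible_and; first by feasible_tac.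
by apply: feasible_leq; [apply: feasible_succ|]; feasible_tac.
Qed.

Let hgu : feasible (vctx e n) (fun j => enc_bits (guess (w (tag j)))) := feasible_up _ hg.
Let hsu : feasible (vctx e n) (fun j => enc_unary (sep_size (st_k (tag j)))) := feasible_up _ hsep.

Let hgA : feasible (vctx e n)
  (fun j => enc_bool (nth false (guess (w (tag j))) (rank (cur_S (w (tag j))) (tagged j)).+1)).
Proof. by apply: feasible_nth_bool => //; apply: feasible_succ. Qed.

Let hA : feasible e (fun i => enc_set (guess_A (guess (w i)) (cur_S (w i)))).
Proof. by apply: feasible_set => //; apply: feasible_and; feasible_tac. Qed.

Let hB : feasible e (fun i => enc_set (guess_B (st_k i) (guess (w i)) (cur_S (w i)))).
Proof.
apply: feasible_set => //; apply: feasible_and; first by feasible_tac.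
apply: feasible_and; first exact: feasible_neg.
by apply: feasible_nth_bool => //; apply: feasible_succ; apply: feasible_add.
Qed.

Let htouch (A : forall i, {set 'I_(n i)}) : feasible e (fun i => enc_set (A i)) ->
  feasible e (fun i => enc_set (touch (st_G i) (cur_C (w i)) (A i))).
Proof.
move=> hX; apply: feasible_set => //; apply: feasible_and; first by feasible_tac.
apply: feasible_exists; first by feasible_tac.
apply: feasible_and; first by feasible_tac.
by apply: (feasible_relapp (R := fun j => edge (st_G (tag (tag j))))); feasible_tac.
Qed.

Let hkind : feasible e (fun i => enc_bool (nth false (guess (w i)) 0)).
Proof. by apply: feasible_nth_bool => //; apply: feasible_const. Qed.

Let hsink : feasible e (fun i => enc_set
  (guess_sink (st_G i) (st_K i) (st_k i) (guess (w i)) (cur_C (w i)) (cur_S (w i)))).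
Proof.
apply: feasible_if_set => //; last exact: htouch.
by apply: feasible_setU => //; [apply: htouch|apply: feasible_setI].
Qed.

Let hside : feasible e (fun i => enc_set
  (split_side (st_G i) (st_K i) (st_k i) (guess (w i)) (cur_C (w i)) (cur_S (w i)))).
Proof. by apply: feasible_cut_side => //; apply: htouch. Qed.

Let hcut : feasible e (fun i => enc_set
  (split_cut (st_G i) (st_K i) (st_k i) (guess (w i)) (cur_C (w i)) (cur_S (w i)))).
Proof. by apply: feasible_cut_boundary => //; apply: htouch. Qed.

Let hnew : feasible e (fun i => enc_set
  (split_new (st_G i) (st_K i) (st_k i) (guess (w i)) (cur_C (w i)) (cur_S (w i)))).
Proof.
apply: feasible_if_set => //; first exact: feasible_set_neq0.
exact: feasible_least.
Qed.

Let hok : feasible e (fun i => enc_bool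
  (split_ok (st_G i) (st_K i) (st_k i) (guess (w i)) (cur_C (w i)) (cur_S (w i)))).
Proof.
have c1 := feasible_card hn hnew; have c2 := feasible_card hn hA; have c3 := feasible_card hn hB.
apply: feasible_and.
  apply: feasible_neg; apply: feasible_exists => //; apply: feasible_and; first by feasible_tac.
  apply: feasible_exists; first by feasible_tac.
  apply: feasible_and; first by feasible_tac.
  by apply: (feasible_relapp (R := fun j => edge (st_G (tag (tag j))))); feasible_tac.
apply: feasible_and; first by apply: feasible_leq => //; apply: feasible_succ.
apply: feasible_and; first exact: feasible_leq.
by apply: feasible_or => //; apply: feasible_leq.
Qed.

Let hfree : feasible e (fun i => enc_bool (is_free (st_K i) (w i))).
Proof. by apply: feasible_neg; apply: feasible_set_neq0 => //; apply: feasible_setI. Qed.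

Let hsmall : feasible e (fun i => enc_bool (is_small (st_k i) (w i))).
Proof. by apply: feasible_leq => //; apply: feasible_succ; apply: feasible_card. Qed.

Let hprog : feasible e (fun i => enc_bool (progress (st_G i) (st_K i) (st_k i) (w i))).
Proof. by do 2 apply: feasible_or => //. Qed.

Let hY : feasible e (fun i => enc_set (new_Y (st_G i) (st_K i) (st_k i) (w i))).
Proof. by do 2 apply: feasible_if_set => //; apply: feasible_least. Qed.

Let hL : feasible e (fun i => enc_set (new_L (st_K i) (w i))).
Proof. exact: feasible_if_set. Qed.

Let hC1 : feasible e (fun i => enc_set (new_C1 (st_G i) (st_K i) (st_k i) (w i))).
Proof. by do 2 apply: feasible_if_set => //; apply: feasible_setD. Qed.

Let hS1 : feasible e (fun i => enc_set (new_S1 (st_G i) (st_K i) (st_k i) (w i))).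
Proof.
by do 2 apply: feasible_if_set => //; apply: feasible_setU => //; apply: feasible_setD.
Qed.

Let hC2 : feasible e (fun i => enc_set (new_C2 (st_G i) (st_K i) (st_k i) (w i))).
Proof. by do 2 apply: feasible_if_set => //; apply: feasible_setD => //; apply: feasible_setD. Qed.

Let hS2 : feasible e (fun i => enc_set (new_S2 (st_G i) (st_K i) (st_k i) (w i))).
Proof.
by do 2 apply: feasible_if_set => //; apply: feasible_setU => //; apply: feasible_setD.
Qed.

Let hadd (C S : forall i, {set 'I_(n i)}) (p : state -> nat) (its : forall i, seq (item (n i))) :
  feasible e (fun i => enc_set (C i)) -> feasible e (fun i => enc_set (S i)) ->
  feasible e (fun i => enc_unary (p i)) ->
  feasible e (fun i => enc_seq (map (@enc_item (n i)) (its i))) ->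
  feasible e (fun i => enc_seq (map (@enc_item (n i)) (add_item (C i) (S i) (p i) (its i)))).
Proof.
move=> xC xS xp xi.
apply: feasible_ext (feasible_if (feasible_set_neq0 hn xC)
  (feasible_pair (feasible_pair (feasible_pair xC xS) xp) xi) xi) => i.
by rewrite /add_item; case: ifP.
Qed.

Let hsize : feasible e (fun i => enc_unary (size (nodes (w i)))).
Proof. by apply: feasible_ext (feasible_length hnodes) => i; rewrite size_map. Qed.

Let hnext : feasible e (fun i => enc_work (st_w (next_state i))).
Proof.
apply: feasible_ext (feasible_if hprog (f := fun i => enc_work (emit (st_k i) (w i) (cur_C (w i))
   (cur_S (w i)) (cur (w i)).2 (new_Y (st_G i) (st_K i) (st_k i) (w i)) (new_L (st_K i) (w i))
   (new_C1 (st_G i) (st_K i) (st_k i) (w i)) (new_S1 (st_G i) (st_K i) (st_k i) (w i))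
   (new_C2 (st_G i) (st_K i) (st_k i) (w i)) (new_S2 (st_G i) (st_K i) (st_k i) (w i))
   (behead (items (w i)))))
  (g := fun i => enc_work (Work (nodes (w i)) (lpart (w i)) (items (w i)) (incr_bits (guess (w i))))) _ _).
- by move=> i; rewrite /next_state /= /next_work; case: ifP.
- apply: feasible_pair.
    apply: (feasible_ext (f := fun i => enc_seq (map (@enc_node (n i)) (nodes (w i)) ++
      [:: enc_node ((cur (w i)).2, cur_S (w i) :|: new_Y (st_G i) (st_K i) (st_k i) (w i))]))).
      by move=> i; rewrite /= map_rcons cats1.
    apply: feasible_cat => //; apply: feasible_pair (feasible_nil _).
    by apply: feasible_pair => //; apply: feasible_setU.
  apply: feasible_pair; first exact: feasible_setU.
  apply: feasible_pair; first by do 2 apply: hadd => //; apply: (feasible_behead (ex := fun i => @enc_item (n i))).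
  apply: (feasible_ext (f := fun i => enc_unary (guess_size (st_k i)))).
    by move=> i; rewrite /= /enc_bits map_nseq; elim: (guess_size _) => //= m ->.
  by apply: (feasible_add (feasible_mulc _ hk)); exact: feasible_const.
- apply: feasible_pair => //; apply: feasible_pair => //; apply: feasible_pair => //.
  exact: feasible_incr.
Qed.

Lemma feasible_loop : feasible enc_state (fun i => if stop_state i then Pair Nil (result (st_w i))
  else Pair (Pair Nil Nil) (enc_state (next_state i))).
Proof.
have hnil := feasible_nilp (ex := fun i => @enc_item (n i)) hits.
apply: feasible_if.
- apply: feasible_or => //; apply: feasible_and; first exact: feasible_neg.
  exact: feasible_all.
- apply: feasible_pair; first exact: feasible_nil.
  apply: feasible_if => //; last exact: feasible_nil.
  by apply: feasible_pair; [exact: feasible_nil|exact: feasible_pair].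
- apply: feasible_pair; first exact: feasible_const.
  by do 3 apply: feasible_pair => //.
Qed.

End StateFeasible.

(** * Initialization and the size of states *)

Record input := Input {
  in_n : nat;
  in_G : sgraph 'I_in_n;
  in_K : {set 'I_in_n};
  in_k : int }.

Definition enc_in (i : input) := enc_input (in_G i) (in_K i) (in_k i).

(** The input gives k in binary, so its value may be exponential in the input size, while a state
    stores k in unary and a counter of 8k + 9 bits. Capping at n is harmless: a smaller k only
    lowers the width of the result, and rejection forces the capped value below n, where it is the
    true one. *)
Definition cap_k (i : input) := minn (in_n i) `|in_k i|%N.

Definition init_state (i : input) :=
  State (in_G i) (in_K i) (cap_k i) (init_work (in_n i) (cap_k i)).

Lemma bits_val_binary m j : m < 2 ^ j -> bits_val [seq odd (m %/ 2 ^ i) | i <- iota 0 j] = m.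
Proof.
elim: j m => [|j IH] m; first by case: m.
rewrite expnS => h /=; rewrite divn1 (iotaDl 1 0 j) -map_comp.
have -> : [seq ((fun i => odd (m %/ 2 ^ i)) \o addn 1) x | x <- iota 0 j] =
    [seq odd (m %/ 2 %/ 2 ^ i) | i <- iota 0 j].
  by apply: eq_map => i /=; rewrite add1n expnS divnMA.
rewrite IH; last by rewrite ltn_divLR // mulnC.
by rewrite divn2 mul2n odd_double_half.
Qed.

Lemma binary_digitsK m : bits_val (binary_digits m) = m.
Proof. by apply: bits_val_binary; apply: up_logP. Qed.

Section InitFeasible.
Let e := enc_in.
Let n := in_n.
Let he : feasible e e := feasible_id e.
Let hgr : feasible e (fun i => enc_graph (in_G i)) := feasible_hd he.
Let hn : feasible e (fun i => enc_unary (n i)) := feasible_graph_size hgr.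
Let hK : feasible e (fun i => enc_set (in_K i)) := feasible_hd (feasible_tl he).
Let hneg : feasible e (fun i => enc_bool (in_k i < 0)%R) := feasible_hd (feasible_tl (feasible_tl he)).
Let hdig : feasible e (fun i => enc_bits (binary_digits `|in_k i|%N)) :=
  feasible_tl (feasible_tl (feasible_tl he)).

Let hcap : feasible e (fun i => enc_unary (cap_k i)).
Proof.
(* Horner's rule from the most significant digit. Truncating at n in every round commutes with the
   rule and keeps the unary accumulator small. *)
pose F i (a : nat) (b : bool) := minn (n i) (if b then (a + a).+1 else a + a).
have E i g : foldr (fun b a => F i a b) 0 g = minn (n i) (bits_val g).
  elim: g => [|b g IH] /=; first by rewrite minn0.
  by rewrite IH /F; case: b; lia.
apply: (feasible_ext (f := fun i => enc_unary (foldl (F i) 0 (rev (binary_digits `|in_k i|%N))))).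
  by move=> i; rewrite foldl_rev E binary_digitsK.
apply: (@feasible_foldl input e (fun=> bool) (fun=> nat) (fun=> enc_bool) (fun=> enc_unary) _ F).
- by apply: feasible_ext (feasible_rev hdig) => i; rewrite map_rev.
- exact: feasible_const.
- set e' := fun j : {i : input & (bool * nat)%type} => _.
  have c := feasible_hd (feasible_id e' : feasible e' (fun j =>
    Pair (Pair (enc_bool (tagged j).1) (enc_unary (tagged j).2)) (e (tag j)))).
  have cb := feasible_hd c; have ca := feasible_tl c.
  have ce := feasible_tl (feasible_id e' : feasible e' (fun j =>
    Pair (Pair (enc_bool (tagged j).1) (enc_unary (tagged j).2)) (e (tag j)))).
  have cn := feasible_comp ce (feasible_reindex (fun j : {i : input & (bool * nat)%type} => tag j) hn).
  have cs := feasible_add ca ca.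
  have ci := feasible_if_unary cb (feasible_succ cs) cs.
  by apply: feasible_if_unary; [apply: feasible_leq => //; apply: feasible_succ| |].
- exists (fun i => sexp_size (enc_unary (n i))); first exact: feasible_size.
  move=> i t _; rewrite !size_enc_unary ltnS leq_double.
  case: (take _ _) => [|b g]; first by [].
  by case/lastP: {b g}(b :: g) => // g b; rewrite -cats1 foldl_cat /= /F geq_minl.
Qed.

(** A negative k is rejected before the loop starts, as the treewidth is a natural number. *)
Lemma feasible_init : feasible e (fun i => if (in_k i < 0)%R then Pair Nil Nil
  else Pair (Pair Nil Nil) (enc_state (init_state i))).
Proof.
have h0 : feasible e (fun i => enc_set (set0 : {set 'I_(n i)})) := feasible_set0 hn.
apply: feasible_if => //; first exact: feasible_const.
apply: feasible_pair; first exact: feasible_const.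
apply: feasible_pair => //; apply: feasible_pair => //; apply: feasible_pair => //.
apply: feasible_pair.
  apply: feasible_pair (feasible_nil _); apply: feasible_pair h0; exact: feasible_nil.
apply: feasible_pair => //; apply: feasible_pair.
  have hT := feasible_setT hn.
  apply: feasible_ext (feasible_if (feasible_set_neq0 hn hT) (feasible_pair (feasible_pair
    (feasible_pair hT h0) (feasible_nil e)) (feasible_nil e)) (feasible_nil e)) => i.
  by rewrite /init_state /= /add_item; case: ifP.
apply: (feasible_ext (f := fun i => enc_unary (guess_size (cap_k i)))).
  by move=> i; rewrite /= /enc_bits map_nseq; elim: (guess_size _) => //= m ->.
by apply: (feasible_add (feasible_mulc _ hcap)); exact: feasible_const.
Qed.

End InitFeasible.

Lemma size_enc_seq_le M (s : seq sexp) : (forall x, List.In x s -> sexp_size x <= M) ->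
  sexp_size (enc_seq s) <= size s * M.+1 + 1.
Proof.
elim: s => //= x s IH h; rewrite mulSn.
have := h x (or_introl erefl); have := IH (fun y ys => h y (or_intror ys)); lia.
Qed.

Lemma In_map_nth (X : Type) (f : X -> sexp) (x0 : X) s y : List.In y (map f s) ->
  exists2 j, j < size s & y = f (nth x0 s j).
Proof.
elim: s => //= x s IH [<-|/IH[j js ->]]; first by exists 0.
by exists j.+1.
Qed.

Section StateSize.
Variables (n : nat) (G : sgraph 'I_n) (K : {set 'I_n}) (k : nat) (w : work n).
Hypothesis wok : run_ok G K k w.

(** The sets C of the items are non-empty, and their sizes add up to the number of uncovered
    vertices. *)
Lemma size_items : size (items w) <= n.
Proof.
case: wok => ok _ _.
apply: (@leq_trans (\sum_(it <- items w) #|it.1.1|)).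
  rewrite -sum1_size big_seq [X in _ <= X]big_seq; apply: leq_sum => it /(work_items ok)[h *].
  by rewrite card_gt0.
have -> : \sum_(it <- items w) #|it.1.1| = \sum_(v : 'I_n) (v \notin covered w).
  rewrite (eq_bigr (fun it : item n => \sum_(v : 'I_n) (v \in it.1.1))); last first.
    by move=> it _; rewrite -sum1_card big_mkcond; apply: eq_bigr => v _; case: (v \in _).
  rewrite exchange_big /=; apply: eq_bigr => v _; rewrite -(work_count ok v).
  by rewrite -sum1_count [RHS]big_mkcond; apply: eq_bigr => it _; case: (v \in _).
apply: (@leq_trans (\sum_(v : 'I_n) 1)); first by apply: leq_sum => v _; case: (v \in _).
by rewrite sum1_card card_ord.
Qed.

(** There are at most n + 1 nodes and n items, each of linear size; k at most n keeps the unary k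
    and the counter linear as well. So the space does not depend on the number of guesses. *)
Lemma size_enc_state : k <= n -> sexp_size (enc_state (State G K k w)) <= 200 * n.+2 ^ 2.
Proof.
move=> kn; case: wok => ok sg _.
have hG : sexp_size (enc_graph G) <= n * (n * 4 + 2) + 1 := size_enc_rel (edge G).
have hK := size_enc_set K; have hL := size_enc_set (lpart w).
have hN := out_size ok.
have hNs : sexp_size (enc_seq (map (@enc_node n) (nodes w))) <= n.+1 * (6 * n + 6) + 1.
  have := size_enc_seq_le (M := 6 * n + 5) (s := map (@enc_node n) (nodes w)).
  rewrite size_map => h; apply: leq_trans (h _) _; last by rewrite leq_add2r leq_mul; lia.
  move=> x /(In_map_nth (0, set0))[j js ->]; rewrite /enc_node [sexp_size _]/= size_enc_unary.
  have := size_enc_set (nth (0, set0) (nodes w) j).2.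
  have := par_lt j ok; rewrite /par_of; lia.
have hIs : sexp_size (enc_seq (map (@enc_item n) (items w))) <= n * (10 * n + 10) + 1.
  have := size_enc_seq_le (M := 10 * n + 9) (s := map (@enc_item n) (items w)).
  rewrite size_map => h; apply: leq_trans (h _) _; last by rewrite leq_add2r leq_mul; have := size_items; lia.
  move=> x /(In_map_nth (set0, set0, 0))[j js ->]; have itin := mem_nth (set0, set0, 0) js.
  have [_ hp *] := work_items ok itin; move: (nth _ _ _) hp {itin} => it hp.
  rewrite /enc_item [sexp_size _]/= size_enc_unary.
  move: (size_enc_set it.1.1) (size_enc_set it.1.2) (leq_trans hp hN).
  by move: (sexp_size _) (sexp_size _) it.2; clear; lia.
have hgs := size_enc_bits (guess w); rewrite sg /guess_size in hgs.
rewrite /enc_state /enc_work /= size_enc_unary.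
move: hG hK hL hNs hIs hgs.
do 6 move: (sexp_size _); clear - kn; intros; nia.
Qed.

End StateSize.

(** * The program *)

Definition answer (i : input) (y : sexp) : Prop :=
  (exists (m : nat) (D : triple 'I_(in_n i) 'I_m),
     [/\ kfree_decomposition (in_G i) (in_K i) D,
         ((width D)%:Z <= 5%:Z * in_k i + 5%:Z)%R, m <= (in_n i).+1 & y = enc_triple D]) \/
  (y = enc_reject /\ (in_k i < (tw_K (in_G i) (in_K i))%:Z)%R).

Lemma tw_K_witness n (G : sgraph 'I_n) K :
  exists (T : finType) (D : triple 'I_n T), kfree_decomposition G K D /\ width D = tw_K G K.
Proof. by rewrite /tw_K; case: ex_minnP => m /asboolP[T [D h]] _; exists T, D. Qed.

Lemma result_answer (i : input) (w : work (in_n i)) : (0 <= in_k i)%R ->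
  run_ok (in_G i) (in_K i) (cap_k i) w -> stop (in_G i) (in_K i) (cap_k i) w ->
  answer i (result w).
Proof.
move=> k0 wok st; rewrite /result; case: ifP => [/nilP no_items|/negbT nn]; [left|right].
  have ok : work_ok (in_G i) (in_K i) (cap_k i) w by case: wok.
  exists (size (nodes w)), (out_triple ok); split.
  - exact: out_decomposition.
  - have : width (out_triple ok) <= 5 * cap_k i + 5 by exact: out_width.
    have : cap_k i <= `|in_k i|%N := geq_minr _ _.
    move: (width _) => wd; move: (cap_k i) => k'.
    by move: (in_k i) k0; clear; lia.
  - exact: out_size ok.
  - by rewrite out_enc.
have [kn tw] := stop_reject wok st nn; split=> //.
have [T [D [dec wD]]] := tw_K_witness (in_G i) (in_K i).
have Ek : cap_k i = `|in_k i|%N by move: kn; rewrite /cap_k; lia.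
by have := tw T D dec; rewrite wD Ek; move: (tw_K _ _) (in_k i) k0; clear; lia.
Qed.

Section Program.
Variables (p_init p_loop : code) (c_init c_loop : nat).
Hypothesis init_computes : forall i, computes p_init (enc_in i)
  (if (in_k i < 0)%R then Pair Nil Nil else Pair (Pair Nil Nil) (enc_state (init_state i)))
  ((sexp_size (enc_in i)).+2 ^ c_init) ((sexp_size (enc_in i)).+2 ^ c_init).
Hypothesis loop_computes : forall s, computes p_loop (enc_state s)
  (if stop_state s then Pair Nil (result (st_w s)) else Pair (Pair Nil Nil) (enc_state (next_state s)))
  ((sexp_size (enc_state s)).+2 ^ c_loop) ((sexp_size (enc_state s)).+2 ^ c_loop).

Definition state_bound i := 200 * (in_n i).+2 ^ 2.
Definition step_bound i := (state_bound i).+2 ^ c_loop.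

Definition total_time i := (sexp_size (enc_in i)).+2 ^ c_init +
  ((in_n i).+1 * 2 ^ guess_size (cap_k i) * (step_bound i + 12) + 10) + 9.

Definition total_space i := sexp_size (enc_in i) + (sexp_size (enc_in i)).+2 ^ c_init +
  (4 * (step_bound i + state_bound i + 10) + 9) + 9.

Lemma program_computes i : exists y,
  computes (comp_code (while_code p_loop) p_init) (enc_in i) y (total_time i) (total_space i)
  /\ answer i y.
Proof.
have hi := init_computes i; case: (boolP (in_k i < 0)%R) hi => [kneg|kpos] hi.
  exists Nil; split; last by right; split=> //; lia.
  apply: (computes_comp hi); apply: computes_le (computes_while _) _ _.
  - by apply: (@WhileStop p_loop 0 (step_bound i + state_bound i + 10)) => /=; lia.
  - by rewrite mul0n add0n leq_addl.
  - by [].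
set w0 := init_work (in_n i) (cap_k i).
set nx := next_work (in_G i) (in_K i) (cap_k i).
have [N [hN hst hnst hok]] := run_stops (in_G i) (in_K i) (cap_k i).
pose s t := State (in_G i) (in_K i) (cap_k i) (iter t nx w0).
have ss t : t <= N -> sexp_size (enc_state (s t)) <= state_bound i.
  by move=> tN; apply: (size_enc_state (hok t tN)); exact: geq_minl.
exists (result (st_w (s N))); split; last first.
  by apply: result_answer; [lia|exact: hok|exact: hst].
apply: (computes_comp hi); apply: computes_le (computes_while_seq (N := N)
  (T := step_bound i) (S := step_bound i + state_bound i + 10) (st := fun t => enc_state (s t))
  (y := result (st_w (s N))) _ _) _ _.
- by move=> t /ss; lia.
- move=> t tN.
  have hle : (sexp_size (enc_state (s t))).+2 ^ c_loop <= step_bound i.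
    by rewrite /step_bound; case: (c_loop) => // c; rewrite leq_exp2r //; exact: (ss t tN).
  have E : stop_state (s t) = ~~ (t < N).
    case: ltnP => h; first by apply/negbTE; apply: hnst.
    have -> : t = N by apply/eqP; rewrite eqn_leq tN.
    exact: hst.
  have := loop_computes (s t); rewrite E.
  have -> : (if ~~ (t < N) then Pair Nil (result (st_w (s t)))
      else Pair (Pair Nil Nil) (enc_state (next_state (s t)))) =
    (if t < N then Pair (Pair Nil Nil) (enc_state (s t.+1)) else Pair Nil (result (st_w (s N)))).
    case: ltnP => h //=.
    by have -> : t = N by apply/eqP; rewrite eqn_leq tN.
  move=> h; apply: (computes_le h hle); apply: (leq_trans hle).
  by rewrite -addnA leq_addr.
(* Initially nothing is covered, so with g the length of the counter the measure is n 2^g + 2^g - 1;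
   the N + 1 evaluations of the body are at most (n + 1) 2^g. *)
- rewrite leq_add2r leq_mul2r; apply/orP; right.
  apply: leq_ltn_trans hN _; rewrite /measure.
  have -> : covered (init_work (in_n i) (cap_k i)) = set0.
    by apply/setP => v; rewrite in_set0 inE /= in_set0.
  rewrite setC0 cardsT card_ord mulSn addnC ltn_add2r.
  by have := expn_gt0 2 (guess_size (cap_k i)); lia.
- by [].
Qed.

(** A polynomial in this quantity is a polynomial in n times 2^O(k), so the calculus of [pbounded]
    also yields the time bound. *)
Definition time_scale i := (in_n i).+1 * 2 ^ `|in_k i|%N.

Lemma pbounded_in_n : pbounded time_scale in_n.
Proof.
apply: pbounded_le (pbounded_id _) => i; rewrite /time_scale.
by have := expn_gt0 2 `|in_k i|%N; nia.
Qed.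

Lemma pbounded_pow : pbounded time_scale (fun i => 2 ^ `|in_k i|%N).
Proof. by apply: pbounded_le (pbounded_id _) => i; rewrite /time_scale leq_pmull. Qed.

Lemma size_enc_int k : sexp_size (enc_int k) <= 4 * 2 ^ `|k|%N + 5.
Proof.
have h := size_enc_bits (binary_digits `|k|%N).
have : size (binary_digits `|k|%N) <= `|k|%N.
  by rewrite /binary_digits size_map size_iota; apply: up_log_min => //; apply: ltn_expl.
have := ltn_expl `|k|%N (isT : 1 < 2).
by rewrite /enc_int -/(enc_bits _) /=; case: (k < 0)%R => /=; lia.
Qed.

Lemma pbounded_in_size : pbounded time_scale (sexp_size \o enc_in).
Proof.
have hn := pbounded_in_n; have hk := pbounded_pow.
apply: (@pbounded_le _ _ _ (fun i => in_n i * (in_n i * 4 + 2) + in_n i * 4 + 4 * 2 ^ `|in_k i|%N + 20)).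
  move=> i.
  have -> : (sexp_size \o enc_in) i = (sexp_size (enc_graph (in_G i)) +
    (sexp_size (enc_set (in_K i)) + sexp_size (enc_int (in_k i))).+1).+1 by [].
  have hG : sexp_size (enc_graph (in_G i)) <= in_n i * (in_n i * 4 + 2) + 1 :=
    size_enc_rel (edge (in_G i)).
  move: (size_enc_set (in_K i)) (size_enc_int (in_k i)) hG.
  by do 3 move: (sexp_size _); move: (in_n i * _) (2 ^ _); clear; lia.
by pbd.
Qed.

Lemma pbounded_succ_exp I (s q : I -> nat) c : pbounded s q -> pbounded s (fun i => (q i).+2 ^ c).
Proof.
by move=> h; apply: pbounded_exp; apply: pbounded_le (pbounded_add h (pbounded_const _ 2)) => i; lia.
Qed.

Lemma pbounded_step I (s : I -> nat) (h : I -> input) : pbounded s (in_n \o h) ->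
  pbounded s (step_bound \o h) /\ pbounded s (state_bound \o h).
Proof.
move=> hn; have hs : pbounded s (state_bound \o h).
  by apply: pbounded_mul; [apply: pbounded_const|apply: (pbounded_succ_exp 2 hn)].
by split=> //; apply: (pbounded_succ_exp c_loop hs).
Qed.

Lemma pbounded_time : pbounded time_scale total_time.
Proof.
have hn := pbounded_in_n; have [hs _] := pbounded_step (h := id) hn.
have hk := pbounded_pow.
have hp : pbounded time_scale (fun i => 2 ^ guess_size (cap_k i)).
  (* The counter has at most 8 |k| + 9 bits, so the number of guesses is a polynomial in 2^|k|. *)
  apply: (@pbounded_le _ _ _ (fun i => 2 ^ 9 * (2 ^ `|in_k i|%N) ^ 8)).
    move=> i; rewrite -expnM -expnD leq_exp2l // /guess_size /cap_k; lia.
  by apply: pbounded_mul; [apply: pbounded_const|apply: pbounded_exp].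
have h1 : pbounded time_scale (fun i => (in_n i).+1).
  by apply: pbounded_le (pbounded_add hn (pbounded_const _ 1)) => i; lia.
have h2 := pbounded_succ_exp c_init pbounded_in_size.
by rewrite /total_time; pbd.
Qed.

Lemma pbounded_space : pbounded (sexp_size \o enc_in) total_space.
Proof.
have hn : pbounded (sexp_size \o enc_in) in_n.
  apply: pbounded_le (pbounded_id _) => i /=.
  have : in_n i <= sexp_size (enc_graph (in_G i)).
    by have := size_map_le_enc (fun u => enc_set [set v | edge (in_G i) u v]) (enum 'I_(in_n i));
      rewrite size_enum_ord; apply: ltnW.
  by rewrite /enc_in /enc_input /=; lia.
have [hs hb] := pbounded_step (h := id) hn.
have h2 := pbounded_succ_exp c_init (pbounded_id (sexp_size \o enc_in)).
by rewrite /total_space; pbd.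
Qed.

End Program.

Lemma computes_computes_within (p : code) x y T S : computes p x y T S ->
  computes_within (p 0) x y T S.
Proof.
move=> h; have [t [tT E hS]] := h (p 0) 0 [::] (fun _ _ => erefl).
rewrite addn0 in hS.
have halt d : iter d (step (p 0)) (Ret y [::]) = Ret y [::] by elim: d => //= d ->; case: (y).
split; first by rewrite -(subnK tT) iterD E halt.
move=> i; case: (leqP i t) => [/hS //|ti].
by rewrite -(subnK (ltnW ti)) iterD E halt -E; apply: hS.
Qed.

Lemma succ2_exp_le s c : 0 < s -> s.+2 ^ c <= 3 ^ c * s ^ c.
Proof. by move=> s0; rewrite -expnMn; case: c => // c; rewrite leq_exp2r //; lia. Qed.

Theorem theorem13 :
  exists (p : program) (c : nat),
  forall (n : nat) (G : sgraph 'I_n) (K : {set 'I_n}) (k : int),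
  exists y : sexp,
    computes_within p (enc_input G K k) y
      (c * n.+1 ^ c * 2 ^ (c * `|k|%N))
      (c * sexp_size (enc_input G K k) ^ c) /\
    ((exists (m : nat) (D : triple 'I_n 'I_m),
        [/\ kfree_decomposition G K D,
            ((width D)%:Z <= 5%:Z * k + 5%:Z)%R,
            m <= c * n.+1
          & y = enc_triple D])
     \/
     (y = enc_reject /\ (k < (tw_K G K)%:Z)%R)).
Proof.
have [p1 [c1 h1]] := feasibleP feasible_init.
have [p2 [c2 h2]] := feasibleP feasible_loop.
have [ct ht] := pbounded_time c1 c2.
have [cs hs] := pbounded_space c1 c2.
(* One constant serves as factor and as exponent of both bounds; the powers of 3 pay for replacing s
   + 2 by 3 s. *)
pose c := 3 ^ ct + 3 ^ cs + ct + cs.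
have ct3 := expn_gt0 3 ct.
have c_gt0 : 0 < c by rewrite /c; lia.
exists (comp_code (while_code p2) p1 0), c => n G K k.
have [y [hy ans]] := program_computes h1 h2 (Input G K k).
exists y; split.
  apply: computes_computes_within; apply: computes_le hy _ _.
    apply: leq_trans (ht _) _; apply: leq_trans (succ2_exp_le _ _) _.
      by rewrite /time_scale muln_gt0 expn_gt0.
    rewrite /time_scale /= expnMn -expnM mulnA.
    apply: leq_mul; last by rewrite leq_exp2l // mulnC leq_mul2r /c; apply/orP; right; lia.
    by apply: leq_mul; [rewrite /c; lia|rewrite leq_pexp2l // /c; lia].
  apply: leq_trans (hs _) _; apply: leq_trans (succ2_exp_le _ _) _; first by [].
  by apply: leq_mul; [rewrite /c; lia|rewrite leq_pexp2l // /c; lia].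
case: ans => [[m [D [hD hw hm hyD]]]|hr]; [left|by right].
exists m, D; split=> //; apply: leq_trans hm _; exact: leq_pmull.
Qed.
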